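(* Let $(A^\theta)_{\theta\in\Theta}$ be a non-empty family of linear operators $A^\theta\colon D(A^\theta)\to C_\kappa(\mathbb R^d)$, $D(A^\theta)\subset C_\kappa(\mathbb R^d)$, with resolvent sets $\varrho(A^\theta)$. Suppose that conditions (i), (ii), (iii), (iv') or conditions (i), (ii'), (iii), (iv') from the following list hold: (i) There exists $\omega\in\mathbb R$ with $(\omega,\infty)\subset\bigcap_{\theta\in\Theta}\varrho(A^\theta)$ such that, for all $\lambda\in(\omega,\infty)$ and $\theta\in\Theta$: $\|(\lambda-\omega)(\lambda-A^\theta)^{-1}f\|_\infty\le\|f\|_\infty$ for all $f\in\mathrm{Lip}_b(\mathbb R^d)$; $\|(\lambda-\omega)(\lambda-A^\theta)^{-1}f\|_\kappa\le\|f\|_\kappa$ for all $f\in C_\kappa(\mathbb R^d)$; and $(\lambda-A^\theta)^{-1}\colon C_\kappa(\mathbb R^d)\to C_\kappa(\mathbb R^d)$ is monotone. (ii) There exists a bounded continuous function $\tilde\kappa\colon\mathbb R^d\to(0,\infty)$ with $\lim_{|x|\to\infty}\frac{\tilde\kappa(x)}{\kappa(x)}=0$ and $\|(\lambda-\omega)(\lambda-A^\theta)^{-1}f\|_{\tilde\kappa}\le\|f\|_{\tilde\kappa}$ for all $\lambda\in(\omega,\infty)$, $\theta\in\Theta$ and $f\in C_\kappa(\mathbb R^d)$. (ii') For every $\epsilon>0$, $r\ge0$ and $K\Subset\mathbb R^d$ there exist a family $(\zeta_x)_{x\in K}$ of continuous functions $\zeta_x\colon\mathbb R^d\to\mathbb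 R$ and $\tilde K\Subset\mathbb R^d$ such that, for all $x\in K$: $0\le\zeta_x\le1$ and $\zeta_x(x)=1$; $\sup_{y\in\tilde K^c}\zeta_x(y)\le\epsilon$; $\frac r\kappa(1-\zeta_x)\in\bigcap_{\theta\in\Theta}D(A^\theta)$ and $\sup_{\theta\in\Theta}\|A^\theta(\frac r\kappa(1-\zeta_x))\|_\kappa\le\epsilon$. (iii) There exists $L\ge0$ with $(\lambda-\omega)^2\|\tau_x(\lambda-A^\theta)^{-1}f-(\lambda-A^\theta)^{-1}(\tau_xf)\|_\infty\le Lr|x|$ for all $r\ge0$, $f\in\mathrm{Lip}_b(\mathbb R^d,r)$, $x\in\mathbb R^d$, $\lambda\in(\omega,\infty)$ and $\theta\in\Theta$. (iv') $C_b^\infty(\mathbb R^d)\subset\bigcap_{\theta\in\Theta}D(A^\theta)$ and, for every $f\in C_b^\infty(\mathbb R^d)$, $\sup_{\theta\in\Theta}\|A^\theta f\|_\kappa<\infty$ and $\lim_{\lambda\to\infty}\sup_{\theta\in\Theta}\|(\lambda-\omega)(\lambda-A^\theta)^{-1}A^\theta f-A^\theta f\|_\kappa=0$. Let $(\lambda_n)_{n\in\mathbb N}\subset(\omega,\infty)$ with $\lambda_n\to\infty$ and $h_n:=\frac1{\lambda_n-\omega}$. Let $A_n^\theta:=(\lambda_n-\omega)A^\theta(\lambda_n-A^\theta)^{-1}$, a bounded linear operator on $(C_\kappa(\mathbb R^d),\|\cdot\|_\kappa)$, and $$J_nf:=\sup_{\theta\in\Theta}e^{h_nA_n^\theta}f,\qquad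 e^{h_nA^\theta_n}:=\sum_{k=0}^\infty\frac{(h_nA_n^\theta)^k}{k!},\qquad n\in\mathbb N,\ f\in C_\kappa(\mathbb R^d).$$ Then there exists a strongly continuous convex monotone semigroup $(T(t))_{t\ge0}$ on $C_\kappa(\mathbb R^d)$ with generator $B\colon D(B)\to C_\kappa(\mathbb R^d)$ given by $$T(t)f=\lim_{n\to\infty}J_n^{k_n^t}f\quad\text{for all }(f,t)\in C_\kappa(\mathbb R^d)\times\mathbb R_+,$$ where $(k_n^t)_{n\in\mathbb N}\subset\mathbb N$ is an arbitrary sequence with $k_n^th_n\to t$. It holds $C_b^\infty(\mathbb R^d)\subset D(B)$ and $Bf=\sup_{\theta\in\Theta}A^\theta f$ for all $f\in C_b^\infty(\mathbb R^d)$. In particular, $T(t)f=S(t)f$ for all $t\ge0$ and $f\in C_\kappa(\mathbb R^d)$, where $S(t)f:=\lim_{n\to\infty}I_n^{k_n^t}f$ with $I_nf:=\sup_{\theta\in\Theta}\lambda_n(\lambda_n-A^\theta)^{-1}f$ and $k_n^th_n\to t$.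
   Context: Fix $d\in\mathbb N$ and a bounded continuous $\kappa:\mathbb R^d\to(0,\infty)$ with $\sup_{x\in\mathbb R^d}\sup_{|y|\le1}\kappa(x)/\kappa(x-y)<\infty$. $C_\kappa(\mathbb R^d)$ is the space of continuous $f:\mathbb R^d\to\mathbb R$ with $\|f\|_\kappa:=\sup_x|f(x)|\kappa(x)<\infty$; $\|f\|_{\tilde\kappa}:=\sup_x|f(x)|\tilde\kappa(x)$; $\|f\|_{\infty,K}:=\sup_{x\in K}|f(x)|$, $\|f\|_\infty:=\|f\|_{\infty,\mathbb R^d}$; $K\Subset\mathbb R^d$ means $K$ is compact. $C_\kappa(\mathbb R^d)$ carries the mixed topology (strongest locally convex topology coinciding on $\|\cdot\|_\kappa$-bounded sets with the topology of uniform convergence on compacts); for sequences, $f_n\to f$ iff $\sup_n\|f_n\|_\kappa<\infty$ and $\|f-f_n\|_{\infty,K}\to0$ for all compact $K$. All limits in $C_\kappa(\mathbb R^d)$ refer to it unless a norm is indicated. Inequalities and suprema of functions are pointwise; $f_n\downarrow f$ means pointwise decreasing convergence. An operator $S$ is monotone if $f\le g$ implies $Sf\le Sg$, and convex if $S(\lambda f+(1-\lambda)g)\le\lambda Sf+(1-\lambda)Sg$ for $\lambda\in[0,1]$. $\mathrm{Lip}_b(\mathbb R^d)$: bounded Lipschitz functions; $\mathrm{Lip}_b(\mathbb R^d,r)$: $r$-Lipschitz $f$ with $\|f\|_\infty\le r$; $C_b^\infty(\mathbb R^d)$: bounded infinitely differentiable functions with all derivatives bounded; $(\tau_xf)(y):=f(x+y)$;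 $\mathbb R_+:=[0,\infty)$. The resolvent set is taken with respect to the norm $\|\cdot\|_\kappa$. A strongly continuous convex monotone semigroup on $C_\kappa(\mathbb R^d)$ is a family $(S(t))_{t\ge0}$ of operators on $C_\kappa(\mathbb R^d)$ such that: each $S(t)$ is convex and monotone with $S(t)f_n\downarrow0$ whenever $f_n\downarrow0$; $S(0)f=f$ and $S(s+t)f=S(s)S(t)f$; $\sup_{t\in[0,T]}\|S(t)\frac r\kappa\|_{\kappa}<\infty$ for all $r,T\ge0$; $\lim_{t\downarrow0}S(t)f=f$ for all $f$. Its generator is $f\mapsto\lim_{h\downarrow0}\frac{S(h)f-f}h$ with domain the set of $f$ for which this limit exists in $C_\kappa(\mathbb R^d)$. *)

(* Defs.v *)
From HB Require Import structures.
From mathcomp Require Export all_boot all_order all_algebra.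
From mathcomp Require Export all_classical all_reals all_analysis.
Export Order.TTheory GRing.Theory Num.Theory.
Export numFieldNormedType.Exports.

Set Implicit Arguments.
Unset Strict Implicit.
Unset Printing Implicit Defensive.

Global Open Scope classical_set_scope.
Global Open Scope ring_scope.

(* Functions and operators are total; an operator on C_kappa is only constrained
   on C_kappa.  R^d is 'rV[R]_d. The topology of 'rV[R]_d (hence continuity and compactness)
   is the usual one, but the library's norm `|x| on it is the maximum norm: the
   Euclidean norm is [enorm]. Suprema that may be infinite are taken in \bar R;
   all of those below are over non-empty sets, so that ereal_sup set0 = -oo
   never occurs. *)

Section FunctionSpaces.
Context (R : realType) (d : nat).
Local Notation E := 'rV[R]_d.
Implicit Types (f g : E -> R) (x y : E) (r : R).

Definition enorm x : R := Num.sqrt (\sum_(i < d) x ord0 i ^+ 2).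

Definition supnorm f : \bar R := ereal_sup (range (fun x => `|f x|%:E)).

Definition wnorm (w : E -> R) f : \bar R :=
  ereal_sup (range (fun x => (`|f x| * w x)%:E)).

Definition bounded_continuous_weight (w : E -> R) : Prop :=
  [/\ continuous w, forall x, 0 < w x & exists M : R, forall x, w x <= M].

(* sup_x sup_{|y| <= 1} w(x) / w(x - y) < oo *)
Definition moderate (w : E -> R) : Prop :=
  exists M : R, forall x y, enorm y <= 1 -> w x / w (x - y) <= M.

Definition translate x f : E -> R := fun y => f (x + y).

Definition lipschitzE r f : Prop :=
  forall x y, `|f x - f y| <= r * enorm (x - y).

Definition Lipb : set (E -> R) :=
  [set f | (exists r, lipschitzE r f) /\ (supnorm f < +oo)%E].

Definition Lipb_r r : set (E -> R) :=
  [set f | lipschitzE r f /\ (supnorm f <= r%:E)%E].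

(* Iterated partial derivative of f in the coordinate directions listed in s. *)
Definition partials (s : seq 'I_d) f : E -> R :=
  foldr (fun i g => (fun x => 'D_(delta_mx ord0 i) g x)) f s.

Definition Cb_infty : set (E -> R) :=
  [set f | forall s : seq 'I_d,
     [/\ forall x (i : 'I_d), derivable (partials s f) x (delta_mx ord0 i),
         continuous (partials s f) &
         (supnorm (partials s f) < +oo)%E]].

Definition decreases_to0 (u : nat -> E -> R) : Prop :=
  forall x, nonincreasing_seq (fun n => u n x) /\
            u n x @[n --> \oo] --> (0 : R).

(* [sup] is the real supremum, meaningful on bounded sets only. *)
Definition psup (I : Type) (F : I -> E -> R) : E -> R :=
  fun x => sup (range (fun i => F i x)).

Section Weighted.
Variable kappa : E -> R.

Definition Ckappa : set (E -> R) :=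
  [set f | continuous f /\ (wnorm kappa f < +oo)%E].

(* Convergence of sequences in the mixed topology of C_kappa. *)
Definition mixed_cvg (u : nat -> E -> R) f : Prop :=
  [/\ forall n, Ckappa (u n), Ckappa f,
      (ereal_sup (range (fun n => wnorm kappa (u n))) < +oo)%E &
      {family compact, u @ \oo --> f}].

(* Limit as t decreases to 0 in the mixed topology: since 0 has a countable
   basis of right neighbourhoods, such a limit in any topology is
   characterised by sequences. *)
Definition mixed_cvg0 (phi : R -> E -> R) f : Prop :=
  forall s : nat -> R, (forall n, 0 < s n) -> s n @[n --> \oo] --> (0 : R) ->
    mixed_cvg (fun n => phi (s n)) f.

(* [app] is only meaningful on [dom]. *)
Record partial_op := PartialOp {
  dom : set (E -> R);
  app :> (E -> R) -> (E -> R) }.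

Definition linear_op (A : partial_op) : Prop :=
  [/\ dom A `<=` Ckappa,
      forall f, dom A f -> Ckappa (A f),
      dom A (fun=> 0) &
      forall (a : R) f g, dom A f -> dom A g ->
        dom A (a *: f + g) /\ A (a *: f + g) = a *: A f + A g].

Definition bounded_linear (B : (E -> R) -> (E -> R)) : Prop :=
  linear_op (PartialOp Ckappa B) /\
  exists M : R, forall f, Ckappa f ->
    (wnorm kappa (B f) <= M%:E * wnorm kappa f)%E.

(* (lam - A)^-1, the inverse of lam - A on the domain of A. *)
Definition resolvent (A : partial_op) (lam : R) : (E -> R) -> (E -> R) :=
  'pinv_(fun=> 0) (dom A) (fun f => lam *: f - A f).

Definition resolvent_set (A : partial_op) : set R :=
  [set lam | set_bij (dom A) Ckappa (fun f => lam *: f - A f) /\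
             bounded_linear (resolvent A lam)].

(* e^B f, the sum in (C_kappa, wnorm kappa) of the series of B^k f / k!. *)
Definition exp_op (B : (E -> R) -> (E -> R)) f : E -> R :=
  xget 0 [set g | Ckappa g /\
    wnorm kappa ((\sum_(k < n) (k`!%:R)^-1 *: iter k B f) - g)
      @[n --> \oo] --> 0%E].

(* Yosida approximation (lam - omega) A (lam - A)^-1. *)
Definition yosida (A : partial_op) (omega lam : R) f : E -> R :=
  (lam - omega) *: A (resolvent A lam f).

Definition convex_on_Ckappa (S : (E -> R) -> (E -> R)) : Prop :=
  forall (l : R) f g, 0 <= l <= 1 -> Ckappa f -> Ckappa g ->
    forall x, S (l *: f + (1 - l) *: g) x <= l * S f x + (1 - l) * S g x.

Definition monotone_on_Ckappa (S : (E -> R) -> (E -> R)) : Prop :=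
  forall f g, Ckappa f -> Ckappa g ->
    (forall x, f x <= g x) -> forall x, S f x <= S g x.

Record sc_convex_monotone_semigroup (S : R -> (E -> R) -> (E -> R)) : Prop := {
  sg_Ckappa : forall (t : R) f, 0 <= t -> Ckappa f -> Ckappa (S t f);
  sg_convex : forall t : R, 0 <= t -> convex_on_Ckappa (S t);
  sg_monotone : forall t : R, 0 <= t -> monotone_on_Ckappa (S t);
  sg_above : forall (t : R) (u : nat -> E -> R), 0 <= t ->
    (forall n, Ckappa (u n)) -> decreases_to0 u ->
    decreases_to0 (fun n => S t (u n));
  sg_0 : forall f, Ckappa f -> S 0 f = f;
  sg_add : forall (s t : R) f, 0 <= s -> 0 <= t -> Ckappa f ->
    S (s + t) f = S s (S t f);
  sg_bounded : forall r T : R, 0 <= r -> 0 <= T ->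
    (ereal_sup [set wnorm kappa (S t (fun x => (r / kappa x)%R))
               | t in `[0%R, T]] < +oo)%E;
  sg_continuous : forall f, Ckappa f -> mixed_cvg0 (fun t => S t f) f }.

Definition is_generator_value (S : R -> (E -> R) -> (E -> R)) f g : Prop :=
  mixed_cvg0 (fun h => h^-1 *: (S h f - f)) g.

Definition generator (S : R -> (E -> R) -> (E -> R)) : partial_op :=
  PartialOp [set f | Ckappa f /\ exists g, is_generator_value S f g]
            (fun f => xget 0 [set g | is_generator_value S f g]).

Section Families.
Context (Theta : Type) (A : Theta -> partial_op) (omega : R).

Definition cond_resolvent : Prop :=
  forall lam : R, omega < lam -> forall th : Theta,
  [/\ resolvent_set (A th) lam,
      forall f, Lipb f ->
        (supnorm ((lam - omega) *: resolvent (A th) lam f)%R <= supnorm f)%E,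
      forall f, Ckappa f ->
        (wnorm kappa ((lam - omega) *: resolvent (A th) lam f)%R
           <= wnorm kappa f)%E &
      monotone_on_Ckappa (resolvent (A th) lam)].

Definition cond_weight : Prop :=
  exists kappat : E -> R,
  [/\ bounded_continuous_weight kappat,
      forall e : R, 0 < e -> exists M : R, forall x, M < enorm x ->
        `|kappat x / kappa x| < e &
      forall (lam : R) (th : Theta) f, omega < lam -> Ckappa f ->
        (wnorm kappat ((lam - omega) *: resolvent (A th) lam f)%R
           <= wnorm kappat f)%E].

Definition cond_cutoff : Prop :=
  forall (e r : R) (K : set E), 0 < e -> 0 <= r -> compact K ->
  exists (zeta : E -> E -> R) (Kt : set E), compact Kt /\
  forall x, K x ->
    let eta : E -> R := fun y => r / kappa y * (1 - zeta x y) in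
    [/\ continuous (zeta x),
        (forall y, 0 <= zeta x y <= 1) /\ zeta x x = 1,
        forall y, ~ Kt y -> zeta x y <= e,
        forall th, dom (A th) eta &
        (ereal_sup (range (fun th => wnorm kappa (A th eta))) <= e%:E)%E].

Definition cond_translation : Prop :=
  exists L : R, 0 <= L /\
  forall (r : R) f x (lam : R) (th : Theta),
    0 <= r -> Lipb_r r f -> omega < lam ->
    (((lam - omega) ^+ 2)%:E *
       supnorm (translate x (resolvent (A th) lam f)
                - resolvent (A th) lam (translate x f))%R
     <= (L * r * enorm x)%:E)%E.

Definition cond_smooth : Prop :=
  forall f, Cb_infty f ->
  [/\ forall th, dom (A th) f,
      (ereal_sup (range (fun th => wnorm kappa (A th f))) < +oo)%E &
      ereal_sup (range (fun th => wnorm kappa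
          ((lam - omega) *: resolvent (A th) lam (A th f) - A th f)))
        @[lam --> +oo%R] --> 0%E].

Definition Jop (lam : R) f : E -> R :=
  psup (fun th : Theta =>
    exp_op (fun g => (lam - omega)^-1 *: yosida (A th) omega lam g) f).

Definition Iop (lam : R) f : E -> R :=
  psup (fun th : Theta => lam *: resolvent (A th) lam f).

End Families.
End Weighted.
End FunctionSpaces.

(* Main.v *)
Require Import Defs.
From mathcomp Require Import ring lra.

Set Implicit Arguments.
Unset Strict Implicit.
Unset Printing Implicit Defensive.

(** With Q = lambda_n (lambda_n - A^theta)^-1 the resolvent identity reads
    h_n A_n^theta = Q - 1. Hence exp (h_n A_n^theta) is the mean of Q^k for a
    Poisson number k of factors of mean 1 ([exp_op_mix]), while I_n uses the
    point mass at k = 1. So I_n and J_n are both suprema over theta of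
    mixtures of powers of Q by a law of mean 1, and one set of estimates
    covers them ([family_chernoff]). Each is a step of size h_n of a sublinear
    monotone operator such that
    - norms, and Lipschitz constants of bounded functions, grow by factors
      exp (O (h_n)), and translations are respected up to a defect O (h_n);
    - the iterates over a bounded time are equicontinuous at 0 on positive
      functions for the mixed topology ([tight]): either because they nearly
      preserve the norm of the auxiliary weight, which is negligible at
      infinity, or because they hardly raise the function built from a
      cut-off, which vanishes at a point and is large far away;
    - (J_n f - f) / h_n tends to sup_theta A^theta f in norm for smooth f
      ([family_consistent]).

    Existence of a limit comes from compactness: along an ultrafilter finer
    than the tails, every bounded sequence converges, so J_n^k f (x) with k the
    integer part of t / h_n has a limit [ulim]. All estimates pass to it. It is
    a semigroup, because the numbers of steps for s, t and s + t match up to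
    one step, in which a smooth function moves by O (h_n); its derivative at 0
    on smooth f is sup_theta A^theta f ([ulim_limit_sg]).

    Uniqueness identifies all these limits ([limit_sg_unique]). Let S and T be
    two of them. Smooth functions are not invariant under S, so S (s) f is
    first averaged over small translations by an operator M with smooth
    values. On the smooth function M (S (s) f) the derivatives of S and T
    agree, and since S is sublinear and almost commutes with translations,
    Jensen's inequality gives S (h) (M u) <= M (S (h) u) + O (h rho), with rho
    the radius of the translations in M. The curve s |-> T (t - s) M S (s) f
    therefore has lower Dini derivative at least - C rho, whence
    T (t) M f <= M S (t) f + C t rho ([compare_mollified]). Letting rho tend
    to 0 gives T <= S on smooth Lipschitz functions, equicontinuity extends it
    to all functions, and exchanging S and T gives equality.

    A sequence all of whose ultrafilter limits coincide converges, so both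
    schemes converge to the same semigroup ([chernoff_cvg], [family_cvg]).

    The operators M are built from finite averages of translates, for which
    Jensen's inequality is plain sublinearity: an infinite composition of
    averages along segments, each itself a limit of two-point averages, plays
    the part of the convolution with a smooth density ([mollify]). *)

(** * The Euclidean norm *)

Section Euclid.
Context (R : realType) (d : nat).
Local Notation E := 'rV[R]_d.
Implicit Types (x y z : E) (f g : E -> R).

Lemma enorm_ge0 x : 0 <= enorm x.
Proof. exact: sqrtr_ge0. Qed.

Lemma enormZ a x : enorm (a *: x) = `|a| * enorm x.
Proof.
rewrite /enorm (eq_bigr (fun i => a ^+ 2 * x ord0 i ^+ 2)); last first.
  by move=> i _; rewrite mxE exprMn.
by rewrite -mulr_sumr sqrtrM ?sqr_ge0// sqrtr_sqr.
Qed.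

Lemma enorm0 : enorm (0 : E) = 0.
Proof. by rewrite -(scale0r 0) enormZ normr0 mul0r. Qed.

Lemma enormN x : enorm (- x) = enorm x.
Proof. by rewrite -scaleN1r enormZ normrN1 mul1r. Qed.

Lemma enorm_delta (i : 'I_d) : enorm (delta_mx ord0 i : E) = 1.
Proof.
rewrite /enorm (bigD1 i)//= big1 ?addr0.
  by rewrite mxE !eqxx expr1n sqrtr1.
by move=> j ji; rewrite mxE (negbTE ji) andbF expr0n.
Qed.

(** The square of the right-hand side exceeds that of the left-hand side by
    a sum of squares (Lagrange's identity). *)
Lemma dot_le x y :
  \sum_(i < d) x ord0 i * y ord0 i <= enorm x * enorm y.
Proof.
pose S (u v : E) := \sum_(i < d) u ord0 i * v ord0 i.
have SE u : enorm u ^+ 2 = S u u.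
  by rewrite sqr_sqrtr ?sumr_ge0// => i _; rewrite sqr_ge0.
have S0 u : 0 <= S u u by rewrite -SE sqr_ge0.
have [/eqP|] := eqVneq (enorm y) 0.
  rewrite -sqrf_eq0 SE psumr_eq0 => [/allP y0|i _]; last exact: sqr_ge0.
  rewrite big1 ?mulr_ge0 ?enorm_ge0// => i _.
  by move: (y0 i (mem_index_enum i)); rewrite /= mulf_eq0 orbb => /eqP ->; rewrite mulr0.
move=> y0; have y_gt0 : 0 < S y y by rewrite -SE exprn_gt0// lt_def y0 enorm_ge0.
(* The sum of the squares of (y.y) x_i - (x.y) y_i is (y.y) times this
   expression. *)
have quad : 0 <= S x x * S y y - S x y ^+ 2.
  have : 0 <= \sum_i (S y y * x ord0 i - S x y * y ord0 i) ^+ 2.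
    by apply: sumr_ge0 => i _; exact: sqr_ge0.
  rewrite (eq_bigr (fun i => S y y ^+ 2 * (x ord0 i * x ord0 i)
      - 2 * S y y * S x y * (x ord0 i * y ord0 i)
      + S x y ^+ 2 * (y ord0 i * y ord0 i))); last by move=> i _; ring.
  rewrite !big_split/= sumrN -!mulr_sumr.
  rewrite -/(S x x) -/(S x y) -/(S y y).
  move: (S x x) (S x y) (S y y) y_gt0 => a b c c0.
  have -> : c ^+ 2 * a - 2 * c * b * b + b ^+ 2 * c = c * (a * c - b ^+ 2) by ring.
  by rewrite pmulr_rge0.
apply: le_trans (ler_norm _) _.
rewrite -(@ler_pXn2r _ 2)// ?nnegrE ?normr_ge0 ?mulr_ge0 ?enorm_ge0//.
by rewrite -normrX ger0_norm ?sqr_ge0// exprMn !SE -subr_ge0.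
Qed.

Lemma enormD x y : enorm (x + y) <= enorm x + enorm y.
Proof.
rewrite -(@ler_pXn2r _ 2)// ?nnegrE ?addr_ge0 ?enorm_ge0//.
have SE (u : E) : enorm u ^+ 2 = \sum_(i < d) u ord0 i ^+ 2.
  by rewrite sqr_sqrtr ?sumr_ge0// => i _; rewrite sqr_ge0.
rewrite sqrrD !SE.
under eq_bigr => i _ do rewrite mxE sqrrD.
rewrite !big_split/= lerD2r lerD2l mulr2n.
by rewrite lerD ?dot_le.
Qed.

Lemma enorm_le x : enorm x <= d%:R * `|x|.
Proof.
have xi i : `|x ord0 i| <= `|x|.
  rewrite [leRHS]mx_normrE.
  exact: (le_bigmax_cond _ (fun ij : 'I_1 * 'I_d => `|x ij.1 ij.2|) (j := (ord0, i))).
have sq : enorm x ^+ 2 <= d%:R * `|x| ^+ 2.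
  rewrite sqr_sqrtr ?sumr_ge0// => [|i _]; last exact: sqr_ge0.
  have -> : d%:R * `|x| ^+ 2 = \sum_(i < d) `|x| ^+ 2.
    by rewrite sumr_const card_ord mulr_natl.
  by apply: ler_sum => i _; rewrite -[leLHS]ger0_norm ?sqr_ge0// normrX lerXn2r ?nnegrE.
rewrite -(@ler_pXn2r _ 2)// ?nnegrE ?enorm_ge0 ?mulr_ge0//.
apply: le_trans sq _; rewrite exprMn ler_wpM2r ?sqr_ge0//.
by rewrite -natrX ler_nat; case: (d) => // n; rewrite -mulnn leq_pmulr.
Qed.

Lemma norm_le_enorm x : `|x| <= enorm x.
Proof.
have xi (ij : 'I_1 * 'I_d) : `|x ij.1 ij.2| <= enorm x.
  rewrite (ord1 ij.1) -sqrtr_sqr ler_sqrt ?sumr_ge0//; last first.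
    by move=> i _; rewrite sqr_ge0.
  by rewrite (bigD1 ij.2)//= lerDl sumr_ge0// => i _; rewrite sqr_ge0.
rewrite [leLHS]mx_normrE.
by apply: bigmax_le => [|ij _]; [exact: enorm_ge0|exact: xi].
Qed.

Lemma lipschitzE_continuous r f : lipschitzE r f -> continuous f.
Proof.
move=> fr x; have xF := @nbhs_filter _ x.
apply/(@cvgrPdist_le _ _ _ (nbhs x)) => e e0; near=> y.
apply: le_trans (fr x y) _.
have dr : 0 < (`|r| * d%:R + 1) by rewrite ltr_wpDl// mulr_ge0.
have : `|x - y| <= e / (`|r| * d%:R + 1).
  near: y; apply: cvgr_dist_le; [exact: cvg_id|by rewrite divr_gt0].
rewrite ler_pdivlMr// mulrDr mulr1 => xye.
apply: le_trans (_ : `|r| * (d%:R * `|x - y|) <= e); last first.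
  by rewrite mulrA mulrC; apply: le_trans xye; rewrite lerDl.
apply: le_trans (ler_wpM2r (enorm_ge0 _) (ler_norm r)) _.
by rewrite ler_wpM2l// enorm_le.
Unshelve. all: by end_near. Qed.

End Euclid.

(** * Local uniformity and weighted bounds *)

Section Spaces.
Context (R : realType) (d : nat).
Local Notation E := 'rV[R]_d.
Implicit Types (x y z : E) (f g : E -> R).

Lemma continuous_epsdelta f :
  continuous f <-> forall x e, 0 < e ->
    exists2 de, 0 < de & forall y, `|x - y| < de -> `|f x - f y| <= e.
Proof.
split=> [fc x e e0|H x].
  have xF := @nbhs_filter _ x.
  have /(@cvgrPdist_le _ _ _ (nbhs x)) /(_ _ e0) := fc x.
  by case/nbhs_ballP => de /= de0 H; exists de => // y xy; apply: H; rewrite mx_norm_ball.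
have xF := @nbhs_filter _ x.
apply/(@cvgrPdist_le _ _ _ (nbhs x)) => e e0.
have [de de0 Hde] := H x e e0.
by apply/nbhs_ballP; exists de => //= y; rewrite mx_norm_ball; exact: Hde.
Qed.

Definition box (rho : R) : set E := [set x | `|x| <= rho].

Lemma compact_box rho : compact (box rho).
Proof.
apply: bounded_closed_compact.
  exists rho; split; first exact: num_real.
  by move=> M rM x /= xr; apply: le_trans xr (ltW rM).
apply: (@closed_comp _ _ (fun x : E => `|x|) [set t : R | t <= rho]).
  by move=> x _; exact: norm_continuous.
exact: closed_le.
Qed.

Lemma compact_sub_box (K : set E) : compact K -> exists rho, K `<=` box rho.
Proof.
move=> /compact_bounded[M [_ KM]]; exists (M + 1) => x Kx.
by apply: (KM (M + 1)); rewrite ?ltrDl.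
Qed.

(** Compactness of boxes in the form in which it is used: a property that
    holds near every point of a box, eventually along a filter, holds on the
    whole box eventually along that filter. *)
Lemma box_cover (I : Type) (F : set_system I) (P : I -> E -> Prop) rho :
  Filter F ->
  (forall x, `|x| <= rho -> exists2 de, 0 < de &
     \forall i \near F, forall y, `|x - y| < de -> P i y) ->
  \forall i \near F, forall x, `|x| <= rho -> P i x.
Proof.
move=> FF H; have /compact_near_coveringP /(_ I F P FF) := compact_box (rho := rho).
apply => x /H [de de0 Hde].
exists ([set y | `|x - y| < de], [set i | forall y, `|x - y| < de -> P i y]).
  by split=> //=; apply/nbhs_ballP; exists de => //= y; rewrite mx_norm_ball.
by move=> [y i]/= [xy]; exact.
Qed.

Lemma continuous_bounded_box f rho : continuous f ->
  exists M, forall x, `|x| <= rho -> `|f x| <= M.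
Proof.
move=> /continuous_epsdelta fc.
have : \forall n \near \oo, forall x, `|x| <= rho -> `|f x| <= n%:R.
  apply: box_cover => x _; have [de de0 H] := fc x 1 ltr01; exists de => //.
  exists (Num.truncn (`|f x| + 1)).+1 => // n /= fxn y /H fxy.
  have : `|f x| + 1 < n%:R by apply: lt_le_trans (truncnS_gt _) _; rewrite ler_nat.
  by move=> /ltW; apply: le_trans; rewrite -lerBlDl; apply: le_trans (lerB_dist _ _) _; rewrite distrC.
by move=> /filter_ex[n Hn]; exists n%:R.
Qed.

Lemma continuous_unif_box f rho e : continuous f -> 0 < e ->
  exists2 de, 0 < de &
    forall x, `|x| <= rho -> forall y, `|x - y| < de -> `|f x - f y| <= e.
Proof.
move=> /continuous_epsdelta fc e0.
have : \forall n \near \oo, forall x, `|x| <= rho ->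
    forall y, `|x - y| < n.+1%:R^-1 -> `|f x - f y| <= e.
  apply: box_cover => x _; have [de de0 H] := fc x (e / 2) (divr_gt0 e0 (ltr0n _ 2)).
  exists (de / 2); first by rewrite divr_gt0.
  (* The point y varies in the neighbourhood, and z near y stays within de
     of x. *)
  have [N _ HN] := near_infty_natSinv_lt (PosNum (divr_gt0 de0 (ltr0n R 2))).
  exists N => // n /HN /= nde y xy z yz.
  rewrite (splitr e) (_ : f y - f z = (f y - f x) + (f x - f z)); last by ring.
  apply: le_trans (ler_normD _ _) _; rewrite lerD//.
    by rewrite distrC; apply: H; apply: lt_trans xy _; rewrite gtr_pMr// invf_lt1// ltr1n.
  apply: H; rewrite (_ : x - z = (x - y) + (y - z)); last by rewrite addrA subrK.
  by apply: le_lt_trans (ler_normD _ _) _; rewrite (splitr de) ltrD//; exact: lt_trans yz nde.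
by move=> /filter_ex[n Hn]; exists n.+1%:R^-1.
Qed.

(** Continuity is a local property, hence survives limits that are uniform on
    boxes only. *)
Lemma locally_uniform_continuous f :
  (forall rho e, 0 < e -> exists2 g, continuous g &
     forall x, `|x| <= rho -> `|f x - g x| <= e) ->
  continuous f.
Proof.
move=> H; apply/continuous_epsdelta => x e e0.
have e3 : 0 < e / 3 by rewrite divr_gt0.
have [g gc fg] := H (`|x| + 1) _ e3.
have [de de0 Hg] := (continuous_epsdelta g).1 gc x _ e3.
exists (Num.min de 1); first by rewrite lt_min de0 ltr01.
move=> y; rewrite lt_min => /andP[xy xy1].
rewrite (_ : f x - f y = (f x - g x) + (g x - g y) - (f y - g y)); last by ring.
rewrite (_ : e = e / 3 + e / 3 + e / 3); last by field.
apply: le_trans (ler_normB _ _) _; rewrite lerD//.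
  apply: le_trans (ler_normD _ _) _; rewrite lerD ?Hg//.
  by apply: fg; rewrite lerDl.
apply: fg; rewrite -[y](subrK x) addrC; apply: le_trans (ler_normD _ _) _.
by rewrite lerD2l distrC ltW.
Qed.

(** Dini's theorem: smallness of u n at a point spreads to a neighbourhood by
    continuity and to later indices by monotonicity, and compactness does the
    rest. *)
Lemma decreasing_unif_box (u : nat -> E -> R) rho e :
  (forall n, continuous (u n)) -> decreases_to0 u -> 0 < e ->
  \forall n \near \oo, forall x, `|x| <= rho -> u n x <= e.
Proof.
move=> uc u0 e0; have e2 : 0 < e / 2 by rewrite divr_gt0.
apply: box_cover => x _; have [ux ucv] := u0 x.
have /cvgrPdist_le/(_ _ e2) [N _ HN] := ucv.
have [de de0 Hde] := (continuous_epsdelta _).1 (uc N) x _ e2.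
exists de => //; exists N => // n /= Nn y xy.
apply: le_trans ((u0 y).1 _ _ Nn) _; rewrite (splitr e).
have := HN N (leqnn N); rewrite sub0r normrN => /(le_trans (ler_norm _)) uN.
rewrite -[u N y](subrK (u N x)) addrC lerD//.
by apply: le_trans (ler_norm _) _; rewrite distrC Hde.
Qed.

(** The norm bound ||f||_w <= M, stated without extended reals. *)
Definition wbd (w : E -> R) (M : R) f := forall x, `|f x| * w x <= M.

Lemma wnorm_leP w M f : (wnorm w f <= M%:E)%E <-> wbd w M f.
Proof.
split=> [H x|H].
  rewrite -lee_fin; apply: le_trans H.
  by apply: ereal_sup_ubound; exists x.
by apply: ge_ereal_sup => _ [x _ <-]; rewrite lee_fin.
Qed.

Lemma supnorm_leP M f : (supnorm f <= M%:E)%E <-> forall x, `|f x| <= M.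
Proof.
split=> [H x|H].
  rewrite -lee_fin; apply: le_trans H.
  by apply: ereal_sup_ubound; exists x.
by apply: ge_ereal_sup => _ [x _ <-]; rewrite lee_fin.
Qed.

Lemma ereal_lt_pinfty_le (x : \bar R) : (x < +oo)%E <-> exists M, (x <= M%:E)%E.
Proof.
split=> [|[M xM]]; last by apply: le_lt_trans xM (ltry _).
by case: x => [r||]// _; [exists r|exists 0; rewrite leNye].
Qed.

Lemma wnorm_ltyP w f : (wnorm w f < +oo)%E <-> exists M, wbd w M f.
Proof.
by rewrite ereal_lt_pinfty_le; split=> -[M H]; exists M; apply/wnorm_leP.
Qed.

Lemma supnorm_ltyP f : (supnorm f < +oo)%E <-> exists M, forall x, `|f x| <= M.
Proof.
by rewrite ereal_lt_pinfty_le; split=> -[M H]; exists M; apply/supnorm_leP.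
Qed.

Lemma wnorm_homo w w' f g :
  (wnorm w f <= wnorm w' g)%E <-> forall M, wbd w' M g -> wbd w M f.
Proof.
split=> [H M /wnorm_leP gM|H]; first by apply/wnorm_leP/(le_trans H).
case E : (wnorm w' g) => [r||]; last 2 first.
- by rewrite leey.
- have : (wnorm w' g <= (- 1)%:E)%E by rewrite E leNye.
  have : ((`|g 0| * w' 0)%:E <= wnorm w' g)%E by apply: ereal_sup_ubound; exists 0.
  by rewrite E leeNy_eq.
by apply/wnorm_leP; apply: (H r); apply/(wnorm_leP w' r g); rewrite E.
Qed.

Lemma supnorm_homo f g :
  (supnorm f <= supnorm g)%E <->
  forall M, (forall x, `|g x| <= M) -> forall x, `|f x| <= M.
Proof.
have e h : supnorm h = wnorm (fun=> 1) h.
  by rewrite /supnorm /wnorm; congr (ereal_sup (_ @` _)); apply/funext => x; rewrite mulr1.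
have e' h M : wbd (fun=> 1) M h <-> forall x, `|h x| <= M.
  by split=> H x; move: (H x); rewrite ?mulr1.
by rewrite !e wnorm_homo; split=> H M /e' /H /e'.
Qed.

End Spaces.

(** * Sublinear operators on the weighted space *)

Section LipschitzFunctions.
Context (R : realType) (d : nat).
Local Notation E := 'rV[R]_d.
Implicit Types (x y z : E) (f g : E -> R).

Lemma addfE f g x : (f + g) x = f x + g x. Proof. by []. Qed.
Lemma oppfE f x : (- f) x = - f x. Proof. by []. Qed.
Lemma scalefE (a : R) f x : (a *: f) x = a * f x. Proof. by []. Qed.
Definition fctE3 := (addfE, oppfE, scalefE).

Definition absf f : E -> R := fun x => `|f x|.

Definition lipb (r : R) f := lipschitzE r f /\ forall x, `|f x| <= r.

Lemma Lipb_rE r f : Lipb_r r f <-> lipb r f.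
Proof. by split=> -[H /supnorm_leP]. Qed.

Lemma lipb_Lipb r f : lipb r f -> Lipb f.
Proof. by move=> [fr fb]; split; [exists r|apply/supnorm_ltyP; exists r]. Qed.

Lemma lipb_ge0 r f : lipb r f -> 0 <= r.
Proof. by move=> [_ /(_ 0)]; apply: le_trans. Qed.

Lemma lipschitzE_le r r' f : r <= r' -> lipschitzE r f -> lipschitzE r' f.
Proof. by move=> rr' fr x y; apply: le_trans (fr x y) _; rewrite ler_wpM2r ?enorm_ge0. Qed.

Lemma lipb_le r r' f : r <= r' -> lipb r f -> lipb r' f.
Proof. by move=> rr' [fr fb]; split=> [|x]; [exact: lipschitzE_le fr|exact: le_trans (fb x) _]. Qed.

Lemma lipschitzED r r' f g :
  lipschitzE r f -> lipschitzE r' g -> lipschitzE (r + r') (f + g).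
Proof.
move=> fr gr x y; rewrite !fctE3 opprD addrACA mulrDl.
by apply: le_trans (ler_normD _ _) _; rewrite lerD ?fr ?gr.
Qed.

Lemma lipschitzEZ r a f : lipschitzE r f -> lipschitzE (`|a| * r) (a *: f).
Proof. by move=> fr x y; rewrite !fctE3 -mulrBr normrM -mulrA ler_wpM2l// fr. Qed.

Lemma lipschitzEN r f : lipschitzE r f -> lipschitzE r (- f).
Proof. by move=> fr x y; rewrite !fctE3 -opprD normrN fr. Qed.

Lemma lipschitzE_translate r z f : lipschitzE r f -> lipschitzE r (translate z f).
Proof. by move=> fr x y; rewrite /translate (le_trans (fr _ _))// opprD addrACA subrr add0r. Qed.

Lemma lipbD r r' f g : lipb r f -> lipb r' g -> lipb (r + r') (f + g).
Proof.
move=> [fr fb] [gr gb]; split=> [|x]; first exact: lipschitzED.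
by apply: le_trans (ler_normD _ _) _; rewrite lerD.
Qed.

Lemma lipbZ r a f : lipb r f -> lipb (`|a| * r) (a *: f).
Proof.
move=> [fr fb]; split=> [|x]; first exact: lipschitzEZ.
by rewrite normrM ler_wpM2l.
Qed.

Lemma lipbN r f : lipb r f -> lipb r (- f).
Proof. by move=> [fr fb]; split=> [|x]; [exact: lipschitzEN|rewrite normrN]. Qed.

Lemma lipb_translate r z f : lipb r f -> lipb r (translate z f).
Proof. by move=> [fr fb]; split=> [|x]; [exact: lipschitzE_translate|exact: fb]. Qed.

Lemma lipschitzE_shift r f x z : lipschitzE r f -> `|f (x + z) - f x| <= r * enorm z.
Proof. by move=> /(_ (x + z) x); rewrite addrAC subrr add0r. Qed.

End LipschitzFunctions.

Section Weighted.
Context (R : realType) (d : nat) (kappa : 'rV[R]_d -> R).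
Local Notation E := 'rV[R]_d.
Implicit Types (x y z : E) (f g : E -> R).
Hypothesis hk : bounded_continuous_weight kappa.
Local Notation Ck := (Ckappa kappa).
Local Notation wb := (wbd kappa).

Lemma weight_gt0 x : 0 < kappa x. Proof. by have [_ /(_ x)] := hk. Qed.

Lemma weight_ge0 x : 0 <= kappa x. Proof. exact: ltW (weight_gt0 x). Qed.

Lemma weight_bound : exists2 kb, 0 < kb & forall x, kappa x <= kb.
Proof.
have [_ _ [M HM]] := hk; exists M => //.
exact: lt_le_trans (weight_gt0 0) (HM 0).
Qed.

Lemma weight_lower rho : exists2 c, 0 < c & forall x, `|x| <= rho -> c <= kappa x.
Proof.
have [kc _ _] := hk.
have : \forall n \near \oo, forall x, `|x| <= rho -> n.+1%:R^-1 <= kappa x.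
  apply: box_cover => x _.
  have k2 : 0 < kappa x / 2 by rewrite divr_gt0// weight_gt0.
  have [de de0 H] := (continuous_epsdelta _).1 kc x _ k2.
  have [N _ HN] := near_infty_natSinv_lt (PosNum k2).
  exists de => //; exists N => // n /HN /= nk y xy.
  apply: le_trans (ltW nk) _.
  have := le_trans (ler_norm _) (H _ xy).
  by rewrite lerBlDr -lerBlDl; apply: le_trans; rewrite lerBrDr -splitr.
by move=> /filter_ex[n Hn]; exists n.+1%:R^-1.
Qed.

Lemma CkP f : Ck f <-> continuous f /\ exists M, wb M f.
Proof. by split=> -[fc /wnorm_ltyP]. Qed.

Lemma wbd_ge0 M f : wb M f -> 0 <= M.
Proof. by move=> /(_ 0); apply: le_trans; rewrite mulr_ge0 ?weight_ge0. Qed.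

Lemma wbd_le M M' f : M <= M' -> wb M f -> wb M' f.
Proof. by move=> MM' fM x; apply: le_trans (fM x) _. Qed.

Lemma wbdD M M' f g : wb M f -> wb M' g -> wb (M + M') (f + g).
Proof.
move=> fM gM x; apply: le_trans (ler_wpM2r (weight_ge0 x) (ler_normD _ _)) _.
by rewrite mulrDl lerD ?fM ?gM.
Qed.

Lemma wbdN M f : wb M f -> wb M (- f).
Proof. by move=> fM x; rewrite normrN. Qed.

Lemma wbdB M M' f g : wb M f -> wb M' g -> wb (M + M') (f - g).
Proof. by move=> fM gM; apply: wbdD => //; exact: wbdN. Qed.

Lemma wbdZ a M f : wb M f -> wb (`|a| * M) (a *: f).
Proof. by move=> fM x; rewrite normrM -mulrA ler_wpM2l ?fM. Qed.

Lemma wbd_abs M f : wb M (absf f) <-> wb M f.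
Proof. by split=> fM x; move: (fM x); rewrite /absf normr_id. Qed.

Lemma wbd_dom M f g : (forall x, `|f x| <= `|g x|) -> wb M g -> wb M f.
Proof. by move=> fg gM x; apply: le_trans (gM x); rewrite ler_wpM2r ?weight_ge0. Qed.

Lemma wbd_at M f x : wb M f -> `|f x| <= M / kappa x.
Proof. by move=> fM; rewrite ler_pdivlMr ?weight_gt0. Qed.

Lemma wbd_sup : exists2 kb, 0 < kb &
  forall M f, (forall x, `|f x| <= M) -> wb (M * kb) f.
Proof.
have [kb kb0 Hkb] := weight_bound; exists kb => // M f fM x.
by apply: ler_pM => //; rewrite weight_ge0.
Qed.

Lemma Ck_wbd f : Ck f -> exists M, wb M f. Proof. by move=> /CkP[]. Qed.

Lemma CkD f g : Ck f -> Ck g -> Ck (f + g).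
Proof.
move=> /CkP[fc [M fM]] /CkP[gc [M' gM]]; apply/CkP; split.
  by move=> x; exact: continuousD (fc x) (gc x).
by exists (M + M'); exact: wbdD.
Qed.

Lemma CkZ a f : Ck f -> Ck (a *: f).
Proof.
move=> /CkP[fc [M fM]]; apply/CkP; split.
  by move=> x; exact: continuousZr (fc x).
by exists (`|a| * M); exact: wbdZ.
Qed.

Lemma CkN f : Ck f -> Ck (- f). Proof. by rewrite -scaleN1r; exact: CkZ. Qed.

Lemma CkB f g : Ck f -> Ck g -> Ck (f - g).
Proof. by move=> fC gC; apply: CkD => //; exact: CkN. Qed.

Lemma Ck_abs f : Ck f -> Ck (absf f).
Proof.
move=> /CkP[fc [M fM]]; apply/CkP; split.
  by move=> x; exact: (continuous_comp (fc x) (@norm_continuous _ _ _)).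
by exists M; exact/wbd_abs.
Qed.

Lemma Ck_lipb r f : lipb r f -> Ck f.
Proof.
move=> [fr fb]; apply/CkP; split; first exact: lipschitzE_continuous fr.
by have [kb _ H] := wbd_sup; exists (r * kb); exact: H.
Qed.

Lemma Ck_invweight r : Ck (fun x => r / kappa x) /\ wb `|r| (fun x => r / kappa x).
Proof.
have rM : wb `|r| (fun x => r / kappa x).
  by move=> x; rewrite normrM normfV (ger0_norm (weight_ge0 x)) mulfVK ?gt_eqF ?weight_gt0.
split=> //; apply/CkP; split; last by exists `|r|.
have [kc _ _] := hk; move=> x.
apply: (@continuousM _ _ (fun=> r) (fun x => (kappa x)^-1)); first exact: cst_continuous.
by apply: continuousV; [rewrite gt_eqF ?weight_gt0|exact: kc].
Qed.

Lemma Ck0 : Ck 0.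
Proof.
apply/CkP; split; first by exact: cst_continuous.
by exists 0 => x; rewrite normr0 mul0r.
Qed.

(** Since the weight is bounded below on boxes, convergence in the weighted
    norm is locally uniform. *)
Lemma Ck_closed f : (forall e, 0 < e -> exists2 g, Ck g & wb e (f - g)) -> Ck f.
Proof.
move=> H; apply/CkP; split.
  apply: locally_uniform_continuous => rho e e0.
  have [c c0 Hc] := weight_lower rho.
  have [g [gc _] fg] := H (e * c) (mulr_gt0 e0 c0); exists g => // x /Hc xc.
  rewrite -(ler_pM2r c0); apply: le_trans (fg x).
  by rewrite ler_wpM2l.
have [g /Ck_wbd[M gM] fg] := H 1 ltr01; exists (1 + M).
by rewrite -[f](subrK g); exact: wbdD.
Qed.

(** The bound C is part of the record because iterates are compared with C to
    the power of the number of steps. *)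
Record slop (Phi : (E -> R) -> E -> R) (C : R) : Prop := {
  slop_ge0 : 0 <= C;
  slop_Ck : forall f, Ck f -> Ck (Phi f);
  slop_add : forall f g, Ck f -> Ck g -> forall x, Phi (f + g) x <= Phi f x + Phi g x;
  slop_hom : forall a f, 0 <= a -> Ck f -> Phi (a *: f) = a *: Phi f;
  slop_mono : monotone_on_Ckappa kappa Phi;
  slop_wbd : forall M f, Ck f -> wb M f -> wb (C * M) (Phi f) }.

Section Slop.
Context (Phi : (E -> R) -> E -> R) (C : R).
Hypothesis HP : slop Phi C.

Lemma slop0 : Phi 0 = 0.
Proof. by have := slop_hom HP (lexx 0) Ck0; rewrite !scale0r. Qed.

Lemma slop_sub f g x : Ck f -> Ck g -> Phi f x - Phi g x <= Phi (f - g) x.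
Proof.
move=> fC gC; rewrite lerBlDr -[f in Phi f x](subrK g).
by apply: (slop_add HP) => //; exact: CkB.
Qed.

(** Sublinearity and monotonicity turn a pointwise bound for the difference of
    two arguments into a bound for the difference of the values; every
    equicontinuity argument below reduces in this way to positive functions. *)
Lemma slop_dist f g h x : Ck f -> Ck g -> Ck h ->
  (forall y, `|f y - g y| <= h y) -> `|Phi f x - Phi g x| <= Phi h x.
Proof.
move=> fC gC hC fgh; rewrite ler_norml lerNl opprB; apply/andP; split.
  apply: le_trans (slop_sub _ gC fC) _.
  apply: (slop_mono HP) => //; first exact: CkB.
  by move=> y; rewrite (le_trans (ler_norm _))// distrC.
apply: le_trans (slop_sub _ fC gC) _.
apply: (slop_mono HP) => //; first exact: CkB.
by move=> y; apply: le_trans (ler_norm _) _; exact: fgh.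
Qed.

Lemma slop_wbd_dist M f g : Ck f -> Ck g -> wb M (f - g) -> wb (C * M) (Phi f - Phi g).
Proof.
move=> fC gC fgM; have fgC := Ck_abs (CkB fC gC).
apply: (@wbd_dom _ _ (Phi (absf (f - g)))).
  by move=> x; apply: le_trans (ler_norm _); exact: slop_dist.
by apply: (slop_wbd HP) => //; exact/wbd_abs.
Qed.

End Slop.

Lemma slop_id : slop id 1.
Proof. by split=> // M f _; rewrite mul1r. Qed.

Lemma slop_comp Phi Psi C C' : slop Phi C -> slop Psi C' -> slop (Phi \o Psi) (C * C').
Proof.
move=> HP HQ; have CQ := slop_Ck HQ; split.
- by rewrite mulr_ge0 ?(slop_ge0 HP) ?(slop_ge0 HQ).
- by move=> f fC; apply: (slop_Ck HP); exact: CQ.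
- move=> f g fC gC x /=; apply: le_trans (slop_add HP (CQ f fC) (CQ g gC) x).
  apply: (slop_mono HP); [exact/CQ/CkD|by apply: CkD; exact: CQ|].
  exact: (slop_add HQ).
- by move=> a f a0 fC /=; rewrite (slop_hom HQ)// (slop_hom HP)//; exact: CQ.
- move=> f g fC gC fg; apply: (slop_mono HP); [exact: CQ|exact: CQ|].
  exact: (slop_mono HQ).
- move=> M f fC fM; rewrite -mulrA; apply: (slop_wbd HP); first exact: CQ.
  exact: (slop_wbd HQ).
Qed.

Lemma slop_iter Phi C k : slop Phi C -> slop (iter k Phi) (C ^+ k).
Proof.
move=> HP; elim: k => [|k IH]; first exact: slop_id.
by rewrite exprS; exact: (slop_comp HP IH).
Qed.

Lemma slop_le Phi C C' : C <= C' -> slop Phi C -> slop Phi C'.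
Proof.
move=> CC' [C0 H1 H2 H3 H4 H5]; split=> //; first exact: le_trans CC'.
move=> M f fC fM; apply: wbd_le (H5 M f fC fM).
by rewrite ler_wpM2r// (wbd_ge0 fM).
Qed.

(** The action on bounded Lipschitz functions: c bounds the supremum norm, b
    the growth of the Lipschitz constant, and l the failure to commute with
    translations. *)
Record lipop (Phi : (E -> R) -> E -> R) (c b l : R) : Prop := {
  lipop_sup : forall r f M, lipb r f -> (forall x, `|f x| <= M) ->
    forall x, `|Phi f x| <= c * M;
  lipop_lip : forall r f, lipb r f -> lipb (b * r) (Phi f);
  lipop_trans : forall r f, lipb r f -> forall x y,
    `|Phi f (x + y) - Phi (translate x f) y| <= l * r * enorm x }.

Lemma sup_dist Phi C c : slop Phi C ->
  (forall r f M, lipb r f -> (forall x, `|f x| <= M) -> forall x, `|Phi f x| <= c * M) ->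
  forall r f g M, lipb r f -> lipb r g -> (forall x, `|f x - g x| <= M) ->
  forall x, `|Phi f x - Phi g x| <= c * M.
Proof.
move=> HP Hs r f g M fr gr fgM x.
have fC := Ck_lipb fr; have gC := Ck_lipb gr.
have H u v : lipb r u -> lipb r v -> (forall x, `|u x - v x| <= M) ->
    Phi u x - Phi v x <= c * M.
  move=> ur vr uv; apply: le_trans (slop_sub HP _ (Ck_lipb ur) (Ck_lipb vr)) _.
  apply: le_trans (ler_norm _) _; apply: (Hs (r + r)) uv _.
  by apply: lipbD => //; exact: lipbN.
rewrite ler_norml H// andbT -opprB lerN2 H// => y.
by rewrite distrC.
Qed.

(** Comparing the values at two points amounts to comparing the operator with
    its translate, so the Lipschitz factor follows from the supremum bound and
    the translation defect. *)
Lemma lipop_of Phi C c l : slop Phi C -> 0 <= c -> 0 <= l ->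
  (forall r f M, lipb r f -> (forall x, `|f x| <= M) -> forall x, `|Phi f x| <= c * M) ->
  (forall r f, lipb r f -> forall x y,
    `|Phi f (x + y) - Phi (translate x f) y| <= l * r * enorm x) ->
  lipop Phi c (c + l) l.
Proof.
move=> HP c0 l0 Hs Ht; split=> // r f fr; have r0 := lipb_ge0 fr.
have fl := fr.1; split; last first.
  move=> x; apply: le_trans (Hs _ _ _ fr fr.2 x) _.
  by rewrite ler_wpM2r// lerDl.
move=> x y; have -> : Phi f x = Phi f ((x - y) + y) by rewrite subrK.
set z := x - y.
rewrite -[X in `|X|](subrKA (Phi (translate z f) y)).
apply: le_trans (ler_normD _ _) _; rewrite [c + l]addrC !mulrDl lerD//; first exact: Ht.
rewrite -mulrA; apply: (sup_dist HP Hs) (lipb_translate z fr) fr _ _.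
by move=> t; rewrite /translate [z + t]addrC lipschitzE_shift//; exact: fl.
Qed.

Lemma lipop_id : lipop id 1 1 0.
Proof.
split=> [r f M _ fM x|r f|r f _ x y]; rewrite ?mul1r//.
by rewrite /translate subrr normr0 !mul0r.
Qed.

Lemma lipop_le Phi c b l c' b' l' : c <= c' -> b <= b' -> l <= l' ->
  lipop Phi c b l -> lipop Phi c' b' l'.
Proof.
move=> cc bb ll [H1 H2 H3]; split.
- move=> r f M fr fM x; apply: le_trans (H1 _ _ _ fr fM x) _.
  by rewrite ler_wpM2r// (le_trans _ (fM 0)).
- move=> r f fr; apply: lipb_le (H2 _ _ fr).
  by rewrite ler_wpM2r// (lipb_ge0 fr).
- move=> r f fr x y; apply: le_trans (H3 _ _ fr x y) _.
  by rewrite ler_wpM2r ?enorm_ge0// ler_wpM2r// (lipb_ge0 fr).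
Qed.

Lemma lipop_comp Phi Psi C c b l c' b' l' : slop Phi C ->
  lipop Phi c b l -> lipop Psi c' b' l' ->
  lipop (Phi \o Psi) (c * c') (b * b') (l * b' + c * l').
Proof.
move=> HP LP LQ; split.
- move=> r f M fr fM x; rewrite -mulrA.
  exact: (lipop_sup LP (lipop_lip LQ fr) (lipop_sup LQ fr fM)).
- by move=> r f fr; rewrite -mulrA; exact: (lipop_lip LP (lipop_lip LQ fr)).
move=> r f fr x y /=; have Qr := lipop_lip LQ fr.
rewrite -[X in `|X|](subrKA (Phi (translate x (Psi f)) y)).
apply: le_trans (ler_normD _ _) _; rewrite !mulrDl lerD//.
  by rewrite -[l * _ * r]mulrA; exact: (lipop_trans LP Qr).
rewrite -!mulrA; apply: (sup_dist HP (lipop_sup LP)).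
- exact: lipb_translate Qr.
- exact: (lipop_lip LQ (lipb_translate x fr)).
- by move=> t; rewrite mulrA; exact: (lipop_trans LQ fr).
Qed.

Lemma lipop_iter Phi C c b l k : slop Phi C -> lipop Phi c b l ->
  c <= b -> 1 <= b -> 0 <= l ->
  lipop (iter k Phi) (c ^+ k) (b ^+ k) (k%:R * l * b ^+ k).
Proof.
move=> HP LP cb b1 l0; elim: k => [|k IH].
  by apply: lipop_le lipop_id; rewrite ?expr0// !mul0r.
rewrite !exprS; apply: lipop_le (lipop_comp HP LP IH) => //.
have bk : 0 <= b ^+ k by rewrite exprn_ge0// (le_trans ler01).
rewrite -addn1 natrD !mulrDl mul1r addrC lerD//.
  rewrite [leRHS]mulrCA; apply: ler_wpM2r => //; first by rewrite !mulr_ge0.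
by rewrite mulrCA ler_peMl// mulr_ge0.
Qed.

End Weighted.

(** * Averages of translates *)

Section RealLemmas.
Context {R : realType}.

(** The constant C may have any sign and size, which spares every limiting
    argument the division by it. *)
Lemma le_of_eps (a b C : R) : (forall e, 0 < e -> a <= b + C * e) -> a <= b.
Proof.
move=> H; apply/ler_addgt0Pr => e e0.
have C0 : 0 < `|C| + 1 by rewrite ltr_wpDl.
apply: le_trans (H _ (divr_gt0 e0 C0)) _; rewrite lerD2l mulrCA ger_pMr//.
by rewrite ler_pdivrMr// mul1r (le_trans (ler_norm _))// lerDl.
Qed.

Lemma half_pow_small (c e : R) : 0 < e -> exists n, c * 2^-1 ^+ n <= e.
Proof.
move=> e0; have h : `|2^-1 : R| < 1 by rewrite ger0_norm ?invr_ge0// invf_lt1// ltr1n.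
have c0 : 0 < `|c| + 1 by rewrite ltr_wpDl.
have /cvgrPdist_le/(_ _ (divr_gt0 e0 c0)) := @cvg_expr R _ h.
move=> /filter_ex[n]; rewrite sub0r normrN ger0_norm ?exprn_ge0 ?invr_ge0// => H.
exists n; rewrite ler_pdivlMr// mulrC in H; apply: le_trans H.
by rewrite ler_wpM2r ?exprn_ge0 ?invr_ge0// (le_trans (ler_norm _))// lerDl.
Qed.

Lemma geometric_cauchy (u : nat -> R) c :
  (forall n, `|u n.+1 - u n| <= c * 2^-1 ^+ n.+1) ->
  forall n, `|u n - limn u| <= c * 2^-1 ^+ n.
Proof.
move=> H.
pose v n := u n + c * 2^-1 ^+ n; pose w n := u n - c * 2^-1 ^+ n.
have e n : c * 2^-1 ^+ n = c * 2^-1 ^+ n.+1 + c * 2^-1 ^+ n.+1.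
  by rewrite exprS; field.
have c0 n : 0 <= c * 2^-1 ^+ n.
  have c0 : 0 <= c by have := le_trans (normr_ge0 _) (H 0); rewrite expr1 pmulr_lge0.
  by rewrite mulr_ge0// exprn_ge0.
have vni : nonincreasing_seq v.
  apply/nonincreasing_seqP => n; rewrite /v (e n) addrA lerD2r.
  by rewrite -lerBlDl; apply: le_trans (ler_norm _) (H n).
have wnd : nondecreasing_seq w.
  apply/nondecreasing_seqP => n; rewrite /w (e n) opprD addrA lerD2r.
  rewrite lerBlDr -lerBlDl; apply: le_trans (ler_norm _) _.
  by rewrite distrC.
have wv n m : w n <= v m.
  apply: le_trans (wnd _ _ (leq_maxl n m)) _.
  apply: le_trans (vni _ _ (leq_maxr n m)).
  by rewrite /w /v lerD2l; apply: le_trans (c0 _); rewrite oppr_le0.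
have vcv : cvgn v by apply: nonincreasing_is_cvgn => //; exists (w 0) => _ [n _ <-].
have lv n : limn v <= v n by exact: nonincreasing_cvgn_ge.
have lw n : w n <= limn v by apply: limr_ge => //; near=> m; exact: wv.
have ul n : `|u n - limn v| <= c * 2^-1 ^+ n.
  by rewrite ler_distl; move: (lv n) (lw n); rewrite /v /w; lra.
suff -> : limn u = limn v by [].
apply/cvg_lim => //; apply/cvgrPdist_le => a a0.
have [N HN] := half_pow_small c a0.
exists N => // n /= Nn; rewrite distrC; apply: le_trans (ul n) _; apply: le_trans HN.
rewrite ler_wpM2l//; last by rewrite ler_wiXn2l ?invr_ge0// invf_le1// ler1n.
by have := c0 0; rewrite expr0 mulr1.
Unshelve. all: by end_near. Qed.

End RealLemmas.

Section Averages.
Context (R : realType) (d : nat).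
Local Notation E := 'rV[R]_d.
Local Notation F := (E -> R).
Implicit Types (x y z : E) (f g : F) (s t : seq E) (M : F -> F).

Definition avg s f : F := fun x => (size s)%:R^-1 * \sum_(y <- s) f (x + y).

Section FiniteAverages.
Context (s : seq E).
Hypothesis s0 : s != [::].

Lemma avg_size_gt0 : 0 < (size s)%:R :> R.
Proof. by rewrite ltr0n lt0n size_eq0. Qed.

Lemma avg_le f g x : {in s, forall y, f (x + y) <= g (x + y)} -> avg s f x <= avg s g x.
Proof.
move=> H; rewrite ler_wpM2l ?invr_ge0// big_seq [leRHS]big_seq.
by apply: ler_sum => y; exact: H.
Qed.

Lemma avg_cst c x : avg s (fun=> c) x = c.
Proof.
rewrite /avg big_const_seq count_predT iter_addr addr0 -[c *+ _]mulr_natl mulKf//.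
by rewrite gt_eqF ?avg_size_gt0.
Qed.

Lemma avgD f g x : avg s (f + g) x = avg s f x + avg s g x.
Proof. by rewrite /avg -mulrDr -big_split. Qed.

Lemma avgZ a f x : avg s (a *: f) x = a * avg s f x.
Proof. by rewrite /avg [RHS]mulrCA; congr (_ * _); rewrite mulr_sumr. Qed.

Lemma avg_dist f g c x : {in s, forall y, `|f (x + y) - g (x + y)| <= c} ->
  `|avg s f x - avg s g x| <= c.
Proof.
move=> H; have B u v : {in s, forall y, u (x + y) - v (x + y) <= c} ->
    avg s u x - avg s v x <= c.
  move=> uv; rewrite lerBlDl -[c](avg_cst c x) -avgD; apply: avg_le => y ys.
  by rewrite addfE -lerBlDl; exact: uv.
rewrite ler_norml lerNl opprB; apply/andP; split; apply: B => y ys.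
  by apply: le_trans (ler_norm _) _; rewrite distrC H.
by apply: le_trans (ler_norm _) (H _ ys).
Qed.

Lemma avg_lip r f : lipschitzE r f -> lipschitzE r (avg s f).
Proof.
move=> fr x y; pose h := translate (x - y) f.
have -> : avg s f x = avg s h y.
  by rewrite /avg; congr (_ * _); apply: eq_bigr => z _; rewrite /h /translate addrA subrK.
apply: avg_dist => z _; rewrite /h /translate [_ + (y + z)]addrC.
exact: lipschitzE_shift.
Qed.

Lemma avg_near r f rho x : 0 <= r -> lipschitzE r f -> {in s, forall y, enorm y <= rho} ->
  `|avg s f x - f x| <= r * rho.
Proof.
move=> r0 fr sr; rewrite -[f x in X in `|X|](avg_cst _ x).
apply: avg_dist => y ys; apply: le_trans (lipschitzE_shift _ _ fr) _.
by rewrite ler_wpM2l// sr.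
Qed.

Lemma avg_translate z f x : avg s (translate z f) x = avg s f (z + x).
Proof. by rewrite /avg; congr (_ * _); apply: eq_bigr => y _; rewrite /translate addrA. Qed.

End FiniteAverages.

Lemma avg_comm s t f x : avg s (avg t f) x = avg t (avg s f) x.
Proof.
rewrite /avg mulr_sumr [RHS]mulr_sumr.
under eq_bigr => y _ do rewrite mulrA mulr_sumr.
under [RHS]eq_bigr => y _ do rewrite mulrA mulr_sumr.
rewrite exchange_big; apply: eq_bigr => y _; apply: eq_bigr => z _.
by rewrite [_^-1 * _]mulrC addrAC.
Qed.

Lemma avg_cat s t f x : avg [seq y + z | y <- s, z <- t] f x = avg s (avg t f) x.
Proof.
rewrite /avg size_allpairs natrM invfM -mulrA; congr (_ * _).
rewrite big_allpairs_dep/= mulr_sumr; apply: eq_bigr => y _; congr (_ * _).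
by apply: eq_bigr => z _; rewrite addrA.
Qed.

(** Limits of finite averages of translates by vectors of length at most rho,
    uniformly over Lipschitz functions. They play the part of the
    convolutions with probability measures carried by a ball. *)
Definition is_avg (rho : R) M := 0 <= rho /\ forall eta, 0 < eta ->
  exists s, [/\ s != [::], {in s, forall y, enorm y <= rho} &
    forall r f, 0 <= r -> lipschitzE r f -> forall x, `|M f x - avg s f x| <= r * eta].

Lemma is_avg_id : is_avg 0 id.
Proof.
split=> // eta eta0; exists [:: 0]; split=> //.
  by move=> y; rewrite inE => /eqP ->; rewrite enorm0.
move=> r f r0 _ x; rewrite /avg big_seq1 invr1 mul1r addr0 subrr normr0.
by rewrite mulr_ge0// ltW.
Qed.

Lemma is_avg_le rho rho' M : rho <= rho' -> is_avg rho M -> is_avg rho' M.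
Proof.
move=> rr [r0 H]; split=> [|eta /H[s [s0 sr sM]]]; first exact: le_trans rr.
by exists s; split=> // y ys; apply: le_trans (sr y ys) rr.
Qed.

Section IsAvg.
Context (rho : R) (M : F -> F).
Hypothesis HM : is_avg rho M.
Implicit Types r : R.

Lemma is_avg_lip r f : 0 <= r -> lipschitzE r f -> lipschitzE r (M f).
Proof.
move=> r0 fr x y; apply: (@le_of_eps R _ _ (r + r)) => e e0.
have [s [s0 _ sM]] := HM.2 e e0.
rewrite (_ : M f x - M f y = (M f x - avg s f x) + (avg s f x - avg s f y)
  - (M f y - avg s f y)); last by ring.
rewrite [(r + r) * e]mulrDl [X in _ <= X]addrA; apply: le_trans (ler_normB _ _) _; rewrite lerD ?sM//.
by apply: le_trans (ler_normD _ _) _; rewrite addrC lerD ?sM// avg_lip.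
Qed.

Lemma is_avg_dist r f g c : 0 <= r -> lipschitzE r f -> lipschitzE r g ->
  (forall y, `|f y - g y| <= c) -> forall x, `|M f x - M g x| <= c.
Proof.
move=> r0 fr gr fg x; apply: (@le_of_eps R _ _ (r + r)) => e e0.
have [s [s0 _ sM]] := HM.2 e e0.
rewrite (_ : M f x - M g x = (M f x - avg s f x) + (avg s f x - avg s g x)
  - (M g x - avg s g x)); last by ring.
rewrite [(r + r) * e]mulrDl [X in _ <= X]addrA; apply: le_trans (ler_normB _ _) _; rewrite lerD ?sM//.
by apply: le_trans (ler_normD _ _) _; rewrite addrC lerD ?sM// avg_dist.
Qed.

Lemma is_avg_near r f x : 0 <= r -> lipschitzE r f -> `|M f x - f x| <= r * rho.
Proof.
move=> r0 fr; apply: (@le_of_eps R _ _ r) => e e0.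
have [s [s0 sr sM]] := HM.2 e e0.
rewrite -[X in `|X|](subrKA (avg s f x)) [leRHS]addrC.
by apply: le_trans (ler_normD _ _) _; rewrite lerD ?sM// avg_near.
Qed.

Lemma is_avg_sup r f c x : 0 <= r -> lipschitzE r f -> (forall y, `|f y| <= c) ->
  `|M f x| <= c.
Proof.
move=> r0 fr fc; apply: (@le_of_eps R _ _ r) => e e0.
have [s [s0 sr sM]] := HM.2 e e0.
rewrite -[X in `|X|](subrK (avg s f x)) [leRHS]addrC.
apply: le_trans (ler_normD _ _) _; rewrite lerD ?sM//.
rewrite -[avg s f x]subr0 -[X in _ - X](avg_cst s0 0 x).
by apply: avg_dist => // y _; rewrite subr0.
Qed.

Lemma lipb_is_avg r f : lipb r f -> lipb r (M f).
Proof.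
move=> fr; have r0 := lipb_ge0 fr; split; first exact: is_avg_lip fr.1.
by move=> x; apply: (is_avg_sup _ r0 fr.1) fr.2.
Qed.

Lemma is_avgD r f g x : 0 <= r -> lipschitzE r f -> lipschitzE r g ->
  M (f + g) x = M f x + M g x.
Proof.
move=> r0 fr gr; apply/eqP; rewrite -subr_eq0 -normr_le0.
apply: (@le_of_eps R _ _ (r + r + r + r)) => e e0.
have [s [s0 _ sM]] := HM.2 e e0; rewrite add0r.
rewrite (_ : M (f + g) x - (M f x + M g x) = (M (f + g) x - avg s (f + g) x)
   - (M f x - avg s f x) - (M g x - avg s g x)); last by rewrite avgD; ring.
rewrite [X in _ <= X]mulrDl; apply: le_trans (ler_normB _ _) _; rewrite lerD ?sM//.
rewrite [X in _ <= X]mulrDl; apply: le_trans (ler_normB _ _) _; rewrite lerD ?sM//.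
  by rewrite addr_ge0.
exact: lipschitzED.
Qed.

Lemma is_avgZ r a f x : 0 <= r -> lipschitzE r f -> M (a *: f) x = a * M f x.
Proof.
move=> r0 fr; apply/eqP; rewrite -subr_eq0 -normr_le0.
apply: (@le_of_eps R _ _ (`|a| * r + `|a| * r)) => e e0.
have [s [s0 _ sM]] := HM.2 e e0; rewrite add0r.
rewrite (_ : M (a *: f) x - a * M f x = (M (a *: f) x - avg s (a *: f) x)
   - a * (M f x - avg s f x)); last by rewrite avgZ; ring.
rewrite [X in _ <= X]mulrDl; apply: le_trans (ler_normB _ _) _; rewrite lerD//.
  by apply: sM; [rewrite mulr_ge0|exact: lipschitzEZ].
by rewrite normrM -mulrA ler_wpM2l// sM.
Qed.

Lemma is_avg_translate r z f x : 0 <= r -> lipschitzE r f ->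
  M (translate z f) x = M f (z + x).
Proof.
move=> r0 fr; apply/eqP; rewrite -subr_eq0 -normr_le0.
apply: (@le_of_eps R _ _ (r + r)) => e e0.
have [s [s0 _ sM]] := HM.2 e e0; rewrite add0r mulrDl.
rewrite -[X in `|X|](subrKA (avg s f (z + x))) -{1}avg_translate.
apply: le_trans (ler_normD _ _) _; rewrite lerD//; last by rewrite distrC sM.
by apply: sM => //; exact: lipschitzE_translate.
Qed.

(** A weight that changes by a bounded factor over the radius of the average
    is respected up to that factor. *)
Lemma is_avg_wbd (w : F) C r f m : (forall x, 0 < w x) -> 0 <= C ->
  (forall x y, enorm y <= rho -> w x <= C * w (x + y)) ->
  0 <= r -> lipschitzE r f -> wbd w m f -> wbd w (C * m) (M f).
Proof.
move=> w0 C0 wC r0 fr fm x; rewrite -ler_pdivlMr//.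
apply: (@le_of_eps R _ _ r) => e e0.
have [s [s0 sr sM]] := HM.2 e e0.
rewrite -[X in `|X|](subrK (avg s f x)) [leRHS]addrC.
apply: le_trans (ler_normD _ _) _; rewrite lerD ?sM//.
rewrite -[avg s f x]subr0 -[X in _ - X](avg_cst s0 0 x).
apply: avg_dist => // y ys; rewrite subr0 ler_pdivlMr//.
have xy := fm (x + y).
apply: le_trans (ler_wpM2l (normr_ge0 _) (wC x y (sr y ys))) _.
by rewrite mulrCA ler_wpM2l.
Qed.

End IsAvg.

Lemma is_avg_comp rho rho' M M' : is_avg rho M -> is_avg rho' M' ->
  is_avg (rho + rho') (M \o M').
Proof.
move=> HM HM'; split=> [|eta eta0]; first by rewrite addr_ge0 ?HM.1 ?HM'.1.
have e0 : 0 < eta / 2 by rewrite divr_gt0.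
have [s [s0 sr sM]] := HM.2 _ e0; have [t [t0 tr tM]] := HM'.2 _ e0.
exists [seq y + z | y <- s, z <- t]; split.
- by rewrite -size_eq0 size_allpairs muln_eq0 !size_eq0 negb_or s0.
- move=> _ /allpairsP[[y z]/= [ys zt ->]]; apply: le_trans (enormD _ _) _.
  by rewrite lerD ?sr ?tr.
move=> r f r0 fr x; rewrite avg_cat (splitr eta) mulrDr.
rewrite -[X in `|X|](subrKA (avg s (M' f) x)); apply: le_trans (ler_normD _ _) _.
rewrite lerD// /comp; first by apply: sM => //; exact: (is_avg_lip HM').
by apply: avg_dist => // y _; exact: tM.
Qed.

(** Finite averages of translates commute because translations do. *)
Lemma is_avg_comm rho rho' M M' r f : is_avg rho M -> is_avg rho' M' ->
  0 <= r -> lipschitzE r f -> M (M' f) = M' (M f).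
Proof.
move=> HM HM' r0 fr; apply/funext => x; apply/eqP; rewrite -subr_eq0 -normr_le0.
apply: (@le_of_eps R _ _ (r + r + (r + r))) => e e0.
have [s [s0 sr sM]] := HM.2 _ e0; have [t [t0 tr tM]] := HM'.2 _ e0.
have M'r := is_avg_lip HM' r0 fr; have Mr := is_avg_lip HM r0 fr.
rewrite (_ : _ - _ = (M (M' f) x - avg s (M' f) x) + (avg s (M' f) x - avg s (avg t f) x)
  - ((M' (M f) x - avg t (M f) x) + (avg t (M f) x - avg t (avg s f) x))); last first.
  by rewrite (avg_comm s t); ring.
rewrite add0r mulrDl; apply: le_trans (ler_normB _ _) _.
rewrite !mulrDl; apply: lerD; apply: le_trans (ler_normD _ _) _; apply: lerD.
- exact: sM.
- by apply: avg_dist => // y _; exact: tM.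
- exact: tM.
- by apply: avg_dist => // y _; exact: sM.
Qed.

(** The new factor is innermost: pcomp A n is A 0 composed with ... with A (n
    - 1), so that successive values differ by the action of a late factor. *)
Fixpoint pcomp (A : nat -> F -> F) n f :=
  if n is n'.+1 then A 0 (pcomp (A \o S) n' f) else f.

Lemma pcompSr A n f : pcomp A n.+1 f = pcomp A n (A n f).
Proof. by elim: n A f => // n IH A f; exact: (congr1 (A 0) (IH (A \o S) f)). Qed.

Definition infcomp (A : nat -> F -> F) : F -> F :=
  fun f x => limn (fun n => pcomp A n f x).

Section InfiniteComposition.
Context (A : nat -> F -> F) (rho : R).
Hypothesis HA : forall n, is_avg (rho * 2^-1 ^+ n.+1) (A n).

Lemma is_avg_pcomp n : is_avg (rho * (1 - 2^-1 ^+ n)) (pcomp A n).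
Proof.
elim: n => [|n IH]; first by rewrite expr0 subrr mulr0; exact: is_avg_id.
have -> : pcomp A n.+1 = pcomp A n \o A n by apply/funext => f; rewrite pcompSr.
have -> : rho * (1 - 2^-1 ^+ n.+1) = rho * (1 - 2^-1 ^+ n) + rho * 2^-1 ^+ n.+1.
  by rewrite exprS; field.
exact: is_avg_comp.
Qed.

Lemma infcomp_dist r f n x : 0 <= r -> lipschitzE r f ->
  `|pcomp A n f x - infcomp A f x| <= r * rho * 2^-1 ^+ n.
Proof.
move=> r0 fr; apply: (@geometric_cauchy R (fun n => pcomp A n f x)) => {}n.
rewrite pcompSr -mulrA; apply: (is_avg_dist (is_avg_pcomp n) r0) => //.
  exact: (is_avg_lip (HA n)).
by move=> y; exact: (is_avg_near (HA n)).
Qed.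

Lemma is_avg_infcomp : is_avg rho (infcomp A).
Proof.
have rho0 : 0 <= rho.
  by have := (HA 0).1; rewrite pmulr_lge0// exprn_gt0.
split=> // eta eta0; have e0 : 0 < eta / 2 by rewrite divr_gt0.
have [n Hn] := half_pow_small rho e0.
have [s [s0 sr sM]] := (is_avg_pcomp n).2 _ e0.
exists s; split=> // [y ys|r f r0 fr x].
  apply: le_trans (sr y ys) _; rewrite ler_piMr// gerBl exprn_ge0//.
rewrite -[X in `|X|](subrKA (pcomp A n f x)) (splitr eta) mulrDr.
apply: le_trans (ler_normD _ _) _; rewrite lerD ?sM//.
rewrite distrC; apply: le_trans (infcomp_dist n x r0 fr) _.
by rewrite -mulrA ler_wpM2l.
Qed.

End InfiniteComposition.

(** The first factor can be split off although the composition is defined by a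
    limit from the other end, because averages do not increase uniform
    distances. *)
Lemma infcompS A rho r f : (forall n, is_avg (rho * 2^-1 ^+ n.+1) (A n)) ->
  0 <= r -> lipschitzE r f ->
  infcomp A f = A 0 (infcomp (A \o S) f).
Proof.
move=> HA r0 fr; apply/funext => x; apply/esym/eqP; rewrite -subr_eq0 -normr_le0.
have HA' n : is_avg (rho / 2 * 2^-1 ^+ n.+1) ((A \o S) n).
  by rewrite -mulrA -exprS; exact: HA.
have Hinf := is_avg_infcomp HA'.
apply: (@le_of_eps R _ _ (r + r)) => e e0.
have rho0 : 0 <= rho := (is_avg_infcomp HA).1.
have [n Hn] := half_pow_small rho e0.
have Hn' : rho * 2^-1 ^+ n.+1 <= e.
  by apply: le_trans Hn; rewrite ler_wpM2l// exprS ger_pMl ?exprn_gt0// invf_le1 ?ler1n.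
rewrite -[X in `|X|](subrKA (pcomp A n.+1 f x)) add0r mulrDl.
apply: le_trans (ler_normD _ _) _; rewrite lerD//; last first.
  by apply: le_trans (infcomp_dist HA n.+1 x r0 fr) _; rewrite -mulrA ler_wpM2l.
apply: (is_avg_dist (HA 0) r0).
- exact: (is_avg_lip Hinf).
- exact: (is_avg_lip (is_avg_pcomp HA' n)).
move=> y; rewrite distrC; apply: le_trans (infcomp_dist HA' n y r0 fr) _.
by rewrite -!mulrA -exprS ler_wpM2l.
Qed.

End Averages.

(** * Mollification *)

Section Smoothing.
Context (R : realType) (d : nat).
Local Notation E := 'rV[R]_d.
Local Notation F := (E -> R).
Implicit Types (x y z : E) (f g : F) (M X : F -> F) (i : 'I_d) (a b r : R).
Local Notation e_ i := (delta_mx ord0 i : E).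

Definition two_point i b f : F := fun x => 2^-1 * (f x + f (x + b *: e_ i)).

Lemma is_avg_two_point i b : 0 <= b -> is_avg b (two_point i b).
Proof.
move=> b0; split=> // eta eta0; exists [:: 0; b *: e_ i]; split=> //.
  move=> y; rewrite !inE => /orP[] /eqP ->; first by rewrite enorm0.
  by rewrite enormZ enorm_delta mulr1 ger0_norm.
move=> r f r0 _ x; rewrite /avg /two_point big_cons big_seq1 addr0 subrr normr0.
by rewrite mulr_ge0// ltW.
Qed.

(** Convolution with the uniform law on the segment from 0 to -a e_i: that law
    is an infinite convolution of two-point laws (binary digits). *)
Definition segment_avg i a : F -> F := infcomp (fun n => two_point i (a * 2^-1 ^+ n.+1)).

Lemma two_pointsP i a n : 0 < a ->
  is_avg (a * 2^-1 ^+ n.+1) (two_point i (a * 2^-1 ^+ n.+1)).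
Proof. by move=> a0; apply: is_avg_two_point; rewrite mulr_ge0 ?exprn_ge0// ltW. Qed.

Lemma is_avg_segment i a : 0 < a -> is_avg a (segment_avg i a).
Proof. by move=> a0; apply: is_avg_infcomp => n; exact: two_pointsP. Qed.

(** The n-fold composition averages f over the dyadic points j a / 2^n with j
    < 2^n; moving by one grid step changes only the two end points. *)
Lemma pcomp_step i a n f x :
  let P := pcomp (fun n => two_point i (a * 2^-1 ^+ n.+1)) n f in
  P (x + (a * 2^-1 ^+ n) *: e_ i) - P x = 2^-1 ^+ n * (f (x + a *: e_ i) - f x).
Proof.
elim: n a x => [|n IH] a x /=; first by rewrite expr0 mulr1 mul1r.
set P := pcomp _ n f.
have PE : P = pcomp (fun n => two_point i (a / 2 * 2^-1 ^+ n.+1)) n f.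
  congr (pcomp _ n f); apply/funext => k.
  by rewrite /= [in LHS]exprS mulrA.
have IHa y := IH (a / 2) y; rewrite /= -PE in IHa.
have aE : a * 2^-1 ^+ n.+1 = a / 2 * 2^-1 ^+ n by rewrite exprS mulrA.
rewrite aE /two_point expr1.
have e1 := IHa x; have e2 := IHa (x + (a / 2) *: e_ i).
have ha : x + (a / 2) *: e_ i + (a / 2) *: e_ i = x + a *: e_ i.
  by rewrite -addrA -scalerDl -splitr.
rewrite ha in e2; rewrite [x + _ *: _ + (a / 2) *: _]addrAC.
set p1 := P (x + _ + _) in e2 *; set p2 := P (x + (a / 2 * _) *: _) in e1 *.
rewrite exprS; move: e1 e2; lra.
Qed.

(** Summation of single steps; the base point drifts by at most K grid steps,
    over which f (x + a e_i) - f x is almost constant. *)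
Lemma pcomp_steps i a n f r x k K : 0 <= r -> lipschitzE r f -> 0 < a -> (k <= K)%N ->
  let P := pcomp (fun n => two_point i (a * 2^-1 ^+ n.+1)) n f in
  let s := a * 2^-1 ^+ n in
  is_true (`|P (x + (k%:R * s) *: e_ i) - P x
      - k%:R * 2^-1 ^+ n * (f (x + a *: e_ i) - f x)|
    <= k%:R * 2^-1 ^+ n * (2 * r * (K%:R * s))).
Proof.
move=> r0 fr a0 kK P s; have s0 : 0 <= s by rewrite mulr_ge0 ?exprn_ge0// ltW.
elim: k kK => [|k IH] kK; first by rewrite !mul0r scale0r addr0 subrr subr0 normr0.
have hE : x + (k.+1%:R * s) *: e_ i = (x + (k%:R * s) *: e_ i) + s *: e_ i.
  by rewrite -addrA -scalerDl -(natr1 k) mulrDl mul1r.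
set y := x + (k%:R * s) *: e_ i in IH hE.
have st := pcomp_step i a n f y; rewrite -/P -/s /= in st.
rewrite hE; set q := 2^-1 ^+ n in IH st *.
have q0 : 0 <= q by rewrite exprn_ge0.
clearbody s q.
rewrite (_ : P (y + s *: e_ i) = P y + q * (f (y + a *: e_ i) - f y)); last by rewrite -st; ring.
rewrite (_ : _ - _ = (P y - P x - k%:R * q * (f (x + a *: e_ i) - f x)) +
   q * ((f (y + a *: e_ i) - f (x + a *: e_ i)) - (f y - f x))); last first.
  by rewrite -(natr1 k); ring.
apply: le_trans (ler_normD _ _) _.
rewrite [leRHS](_ : _ = k%:R * q * (2 * r * (K%:R * s)) + q * (2 * r * (K%:R * s))); last first.
  by rewrite -(natr1 k); ring.
apply: lerD; first by apply: IH; rewrite ltnW.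
rewrite normrM ger0_norm// ler_wpM2l//.
have ks : r * enorm ((k%:R * s) *: e_ i) <= r * (K%:R * s).
  rewrite enormZ enorm_delta mulr1 ger0_norm ?mulr_ge0//.
  apply: ler_wpM2l => //; apply: ler_wpM2r => //.
  by rewrite ler_nat ltnW.
rewrite [leRHS](_ : _ = r * (K%:R * s) + r * (K%:R * s)); last by ring.
apply: le_trans (ler_normB _ _) _; rewrite lerD//; apply: le_trans ks.
  by rewrite /y addrAC lipschitzE_shift.
by rewrite /y lipschitzE_shift.
Qed.

(** The increment over a grid multiple of a / 2^n is known from the dyadic
    averages, and n tends to infinity with the increment fixed. *)
Lemma segment_avg_incr_pos i a f r x del : 0 <= r -> lipschitzE r f -> 0 < a -> 0 <= del ->
  `|segment_avg i a f (x + del *: e_ i) - segment_avg i a f x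
      - del / a * (f (x + a *: e_ i) - f x)| <= 2 * r * del ^+ 2 / a.
Proof.
move=> r0 fr a0 del0; set U := segment_avg i a f; set D := f (x + _) - f x.
apply: (@le_of_eps R _ _ (4 * r)) => e e0.
have [n Hn] := half_pow_small a e0.
set q := 2^-1 ^+ n in Hn; have q0 : 0 < q by rewrite exprn_gt0.
pose s := a * q; have s0 : 0 < s by rewrite mulr_gt0.
(* k s is the largest multiple of the grid step s below del. *)
pose k := Num.truncn (del / s).
have ds0 : 0 <= del / s by rewrite divr_ge0// ltW.
have /andP[k1 k2] : k%:R <= del / s < k.+1%:R by exact: truncn_itv.
have ks1 : k%:R * s <= del by rewrite -ler_pdivlMr.
have ks2 : del <= k%:R * s + s.
  by rewrite -[X in _ + X]mul1r -mulrDl natr1 -ler_pdivrMr// ltW.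
pose P := pcomp (fun n => two_point i (a * 2^-1 ^+ n.+1)) n f.
have UP y : `|P y - U y| <= r * s.
  by rewrite /s mulrA; apply: infcomp_dist => // m; exact: two_pointsP.
have Pr : lipschitzE r P.
  by apply: (is_avg_lip (is_avg_pcomp _ n)) => // m; exact: two_pointsP.
have H1 : `|P (x + del *: e_ i) - P (x + (k%:R * s) *: e_ i)| <= r * s.
  apply: le_trans (Pr _ _) _; apply: ler_wpM2l => //.
  rewrite opprD addrACA subrr add0r -scalerBl.
  by rewrite enormZ enorm_delta mulr1 ger0_norm ?subr_ge0// lerBlDl.
have H2 := pcomp_steps i n x r0 fr a0 (leqnn k); rewrite /= -/P -/q -/s -/D in H2.
have HD : `|D| <= r * a.
  by apply: le_trans (lipschitzE_shift _ _ fr) _; rewrite enormZ enorm_delta mulr1 gtr0_norm.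
have kq1 : k%:R * q <= del / a.
  by rewrite ler_pdivlMr// -mulrA [q * a]mulrC.
have kq2 : del / a <= k%:R * q + q.
  rewrite ler_pdivrMr//; apply: le_trans ks2 _.
  by rewrite /s le_eqVlt; apply/orP; left; apply/eqP; ring.
have H3 : `|(del / a - k%:R * q) * D| <= r * s.
  rewrite normrM ger0_norm ?subr_ge0// /s [r * _]mulrA [r * a * q]mulrC.
  by apply: ler_pM; rewrite ?subr_ge0 ?lerBlDl.
have H4 : k%:R * q * (2 * r * (k%:R * s)) <= 2 * r * del ^+ 2 / a.
  rewrite (_ : 2 * r * del ^+ 2 / a = del / a * (2 * r * del)); last by field; rewrite gt_eqF.
  apply: ler_pM => //; first by rewrite mulr_ge0// ltW.
    by rewrite !mulr_ge0// ltW.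
  by rewrite ler_wpM2l// mulr_ge0.
have Hse : r * s <= r * e by rewrite ler_wpM2l.
rewrite mulrBl in H3; have {H2 H4} H2 := le_trans H2 H4; rewrite -[4 * r * e]mulrA.
move: (UP x) (UP (x + del *: e_ i)) H1 H2 H3 Hse; rewrite !ler_norml.
clearbody U P D s q k; lra.
Qed.

Lemma segment_avg_incr i a f r x del : 0 <= r -> lipschitzE r f -> 0 < a ->
  `|segment_avg i a f (x + del *: e_ i) - segment_avg i a f x
      - del / a * (f (x + a *: e_ i) - f x)| <= 4 * r * del ^+ 2 / a.
Proof.
move=> r0 fr a0; have q0 : 0 <= r * del ^+ 2 / a.
  by rewrite divr_ge0 ?(ltW a0)// mulr_ge0// sqr_ge0.
(* A negative increment is a positive one from x + del e_i, at the price of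
   replacing the difference of f at that point by the one at x. *)
have [del0|/ltW del0] := leP 0 del.
  apply: le_trans (segment_avg_incr_pos i x r0 fr a0 del0) _.
  by move: q0; lra.
have d0 : 0 <= - del by rewrite oppr_ge0.
have := segment_avg_incr_pos i (x + del *: e_ i) r0 fr a0 d0.
rewrite (_ : x + del *: e_ i + - del *: e_ i = x) ?sqrrN; last by rewrite scaleNr addrK.
set U := segment_avg i a f; set y := x + del *: e_ i => H.
have K z : `|f (y + z) - f (x + z)| <= r * - del.
  have -> : y + z = (x + z) + del *: e_ i by rewrite addrAC.
  by apply: le_trans (lipschitzE_shift _ _ fr) _; rewrite enormZ enorm_delta mulr1 ler0_norm.
have Ka := K (a *: e_ i); have K0 := K 0; rewrite !addr0 in K0.
have L : `|del / a * ((f (y + a *: e_ i) - f y) - (f (x + a *: e_ i) - f x))|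
    <= 2 * r * del ^+ 2 / a.
  rewrite normrM normrM normfV (ler0_norm del0) (gtr0_norm a0).
  rewrite (_ : 2 * r * del ^+ 2 / a = - del / a * (2 * r * - del)); last by ring.
  rewrite ler_wpM2l ?divr_ge0 ?(ltW a0)//.
  rewrite (_ : _ - _ = (f (y + a *: e_ i) - f (x + a *: e_ i)) - (f y - f x)); last by ring.
  by apply: le_trans (ler_normB _ _) _; move: Ka K0; lra.
rewrite (_ : _ - _ = - (U x - U y - (- del) / a * (f (y + a *: e_ i) - f y)) +
  del / a * ((f (y + a *: e_ i) - f y) - (f (x + a *: e_ i) - f x))); last by ring.
apply: le_trans (ler_normD _ _) _; rewrite normrN.
by rewrite (_ : 4 * r * del ^+ 2 / a = 2 * r * del ^+ 2 / a + 2 * r * del ^+ 2 / a); [exact: lerD|ring].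
Qed.

(** The fundamental theorem of calculus: the derivative of the mean over a
    segment is the difference quotient over that segment. *)
Lemma derive_segment_avg i a f r x : 0 <= r -> lipschitzE r f -> 0 < a ->
  derivable (segment_avg i a f) x (e_ i) /\
  'D_(e_ i) (segment_avg i a f) x = a^-1 * (f (a *: e_ i + x) - f x).
Proof.
move=> r0 fr a0; set U := segment_avg i a f.
have H : (fun h => h^-1 *: ((U \o shift x) (h *: e_ i) - U x)) @ 0^' -->
    (a^-1 * (f (a *: e_ i + x) - f x) : R).
  apply/cvgrPdist_le => e e0; have c0 : 0 < 4 * r + 1 by rewrite ltr_wpDl// mulr_ge0.
  near=> h; have h0 : h != 0 by near: h; exact: nbhs_dnbhs_neq.
  have hn0 : 0 < `|h| by rewrite normr_gt0.
  have he : 4 * r * `|h| / a <= e.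
    rewrite ler_pdivrMr//.
    apply: le_trans (_ : (4 * r + 1) * `|h| <= _); first by rewrite ler_wpM2r// lerDl.
    rewrite mulrC -ler_pdivlMr//.
    by near: h; apply: dnbhs0_le; apply: divr_gt0 => //; apply: mulr_gt0.
  have hK (u : R) : h * (h^-1 *: u) = u by rewrite [LHS]mulrA divff// mul1r.
  rewrite -(ler_pM2l hn0) -normrM mulrBr /= hK.
  rewrite distrC [h *: _ + x]addrC [a *: _ + x]addrC mulrA.
  apply: le_trans (segment_avg_incr i x h r0 fr a0) _.
  rewrite (_ : 4 * r * h ^+ 2 / a = `|h| * (4 * r * `|h| / a)); last first.
    by rewrite -[h ^+ 2]ger0_norm ?sqr_ge0// normrX; ring.
  by rewrite ler_wpM2l.
split; last by apply/cvg_lim.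
by apply/cvg_ex; eexists; exact: H.
Unshelve. all: by end_near. Qed.

Definition box_avg a : F -> F := foldr (fun i M => segment_avg i a \o M) id (enum 'I_d).

Lemma is_avg_foldr s a : 0 < a ->
  is_avg ((size s)%:R * a) (foldr (fun i M => segment_avg i a \o M) id s).
Proof.
move=> a0; elim: s => [|i s IH] /=; first by rewrite mul0r; exact: is_avg_id.
rewrite -natr1 addrC mulrDl mul1r; apply: is_avg_comp => //.
exact: is_avg_segment.
Qed.

Lemma is_avg_box a : 0 < a -> is_avg (d%:R * a) (box_avg a).
Proof. by move=> a0; have := is_avg_foldr (enum 'I_d) a0; rewrite size_enum_ord. Qed.

(** The factors commute, so the one for the coordinate i can be brought to the
    front, where it can be differentiated. *)
Lemma box_avg_factor a i : 0 < a -> exists rho M, is_avg rho M /\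
  forall r f, 0 <= r -> lipschitzE r f -> box_avg a f = segment_avg i a (M f).
Proof.
move=> a0; rewrite /box_avg; have : i \in enum 'I_d by rewrite mem_enum.
elim: (enum 'I_d) => // j s IH; rewrite inE => /orP[/eqP <-|/IH[rho [M [HM ME]]]].
  exists ((size s)%:R * a), (foldr (fun i M => segment_avg i a \o M) id s).
  by split=> //; exact: is_avg_foldr.
exists (a + rho), (segment_avg j a \o M); split.
  by apply: is_avg_comp => //; exact: is_avg_segment.
move=> r f r0 fr.
apply: (etrans (congr1 (segment_avg j a) (ME r f r0 fr))).
apply: (is_avg_comm (is_avg_segment j a0) (is_avg_segment i a0) r0).
exact: (is_avg_lip HM).
Qed.

(** Convolution with a smooth law: along each coordinate, the law of a series
    of independent uniform variables of lengths eps/2, eps/4, ...; splitting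
    off the first one reproduces the same law at half the scale, and its
    uniform factor turns a derivative into a difference quotient. *)
Definition mollify eps : F -> F := infcomp (fun n => box_avg (eps * 2^-1 ^+ n.+1)).

Lemma box_avgsP eps n : 0 < eps ->
  is_avg (d%:R * eps * 2^-1 ^+ n.+1) (box_avg (eps * 2^-1 ^+ n.+1)).
Proof. by move=> e0; rewrite -mulrA; apply: is_avg_box; rewrite mulr_gt0// exprn_gt0. Qed.

Lemma is_avg_mollify eps : 0 < eps -> is_avg (d%:R * eps) (mollify eps).
Proof. by move=> e0; apply: is_avg_infcomp => n; exact: box_avgsP. Qed.

Lemma mollify_half eps r f : 0 < eps -> 0 <= r -> lipschitzE r f ->
  mollify eps f = box_avg (eps / 2) (mollify (eps / 2) f).
Proof.
move=> e0 r0 fr; pose A n := box_avg (eps * 2^-1 ^+ n.+1).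
have E := @infcompS R d A (d%:R * eps) r f (fun n => box_avgsP n e0) r0 fr.
apply: (etrans E); rewrite /A expr1; congr (box_avg _ (infcomp _ f)).
by apply/funext => n; rewrite /= [in LHS]exprS mulrA.
Qed.

Lemma mollify_factor i eps rho X : 0 < eps -> is_avg rho X ->
  exists rho' X', is_avg rho' X' /\ forall r f, 0 <= r -> lipschitzE r f ->
    X (mollify eps f) = segment_avg i (eps / 2) (X' (mollify (eps / 2) f)).
Proof.
move=> e0 HX; have e2 : 0 < eps / 2 by rewrite divr_gt0.
have [rho' [M [HM ME]]] := box_avg_factor i e2.
exists (rho + rho'), (X \o M); split; first exact: is_avg_comp.
move=> r f r0 fr /=; have mr := is_avg_lip (is_avg_mollify e2) r0 fr.
rewrite (mollify_half e0 r0 fr) (ME r)//.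
apply: (is_avg_comm HX (is_avg_segment i e2) r0).
exact: (is_avg_lip HM).
Qed.

(** A partial derivative of a mollified function is again an average of a
    mollified bounded Lipschitz function, at half the scale; this shape is
    stable, so all iterated partial derivatives follow by induction. *)
Lemma derive_mollify i eps rho X r f : 0 < eps -> is_avg rho X -> lipb r f ->
  (forall x, derivable (X (mollify eps f)) x (e_ i)) /\
  exists eps' rho' X' r' f', [/\ 0 < eps', is_avg rho' X', lipb r' f' &
    (fun x => 'D_(e_ i) (X (mollify eps f)) x) = X' (mollify eps' f')].
Proof.
move=> e0 HX fr; have e2 : 0 < eps / 2 by rewrite divr_gt0.
have r0 := lipb_ge0 fr.
have [rho' [X' [HX' XE]]] := mollify_factor i e0 HX.
have HM := is_avg_mollify e2; have HXM := is_avg_comp HX' HM.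
set a := eps / 2 in e2 XE HM HXM *.
have gr : lipschitzE r (X' (mollify a f)) by exact: (is_avg_lip HXM r0 fr.1).
rewrite (XE r f r0 fr.1); split.
  by move=> x; have [] := derive_segment_avg i x r0 gr e2.
exists a, rho', X', (`|a^-1| * (r + r)), (a^-1 *: (translate (a *: e_ i) f - f)).
have dr : lipb (r + r) (translate (a *: e_ i) f - f).
  by apply: lipbD; [exact: lipb_translate|exact: lipbN].
split=> //; first exact: lipbZ.
apply/funext => x; have [_ ->] := derive_segment_avg i x r0 gr e2.
have rr : 0 <= r + r by rewrite addr_ge0.
have lt : lipschitzE r (translate (a *: e_ i) f) := (lipb_translate _ fr).1.
have ln : lipschitzE r (- f) := (lipbN fr).1.
rewrite -[RHS]/((X' \o mollify a) _ x) (is_avgZ HXM _ _ rr dr.1).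
rewrite (is_avgD HXM _ r0 lt ln) (is_avg_translate HXM _ _ r0 fr.1).
have -> : - f = -1 *: f by rewrite scaleN1r.
by rewrite (is_avgZ HXM _ _ r0 fr.1) mulN1r.
Qed.

Lemma Cb_infty_mollify eps r f : 0 < eps -> lipb r f -> Cb_infty (mollify eps f).
Proof.
move=> e0 fr s.
have [eps' [rho' [X [r' [f' [e'0 HX fr' E]]]]]] : exists eps' rho' X r' f',
    [/\ 0 < eps', is_avg rho' X, lipb r' f' &
      partials s (mollify eps f) = X (mollify eps' f')].
  elim: s => [|i s [eps' [rho' [X [r' [f' [e'0 HX fr' E]]]]]]].
    by exists eps, 0, id, r, f; split=> //; exact: is_avg_id.
  have [_ [e1 [rho1 [X1 [r1 [f1 [? ? ? E1]]]]]]] := derive_mollify i e'0 HX fr'.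
  by exists e1, rho1, X1, r1, f1; split=> //=; rewrite -/(partials s _) E.
rewrite E; have gr := lipb_is_avg (is_avg_comp HX (is_avg_mollify e'0)) fr'.
split.
- by move=> x i; have [] := derive_mollify i e'0 HX fr'.
- exact: lipschitzE_continuous gr.1.
- by apply/supnorm_ltyP; exists r'; exact: gr.2.
Qed.

Lemma smoothing_exists rho : 0 < rho -> exists2 M, is_avg rho M &
  forall r f, lipb r f -> Cb_infty (M f).
Proof.
move=> rho0; have e0 : 0 < rho / d.+1%:R by rewrite divr_gt0.
exists (mollify (rho / d.+1%:R)); last by move=> r f; exact: Cb_infty_mollify.
apply: is_avg_le (is_avg_mollify e0).
by rewrite mulrCA ger_pMr// ler_pdivrMr// mul1r ler_nat.
Qed.

End Smoothing.

(** * Density of smooth Lipschitz functions *)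

Section Density.
Context (R : realType) (d : nat) (kappa : 'rV[R]_d -> R).
Local Notation E := 'rV[R]_d.
Implicit Types (x y z : E) (f g : E -> R).
Hypothesis hk : bounded_continuous_weight kappa.
Local Notation Ck := (Ckappa kappa).
Local Notation wb := (wbd kappa).

Lemma lipschitzE_min r f g : lipschitzE r f -> lipschitzE r g ->
  lipschitzE r (fun x => Num.min (f x) (g x)).
Proof.
move=> fr gr x y; move: (fr x y) (gr x y); set c := r * _.
rewrite !ler_norml => /andP[a1 a2] /andP[b1 b2].
by case: (leP (f x) (g x)) => H1; case: (leP (f y) (g y)) => H2; apply/andP; split; lra.
Qed.

Lemma lipschitzE_max r f g : lipschitzE r f -> lipschitzE r g ->
  lipschitzE r (fun x => Num.max (f x) (g x)).
Proof.
move=> fr gr x y; move: (fr x y) (gr x y); set c := r * _.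
rewrite !ler_norml => /andP[a1 a2] /andP[b1 b2].
by case: (leP (f x) (g x)) => H1; case: (leP (f y) (g y)) => H2; apply/andP; split; lra.
Qed.

(** The inf-convolution of f over the box with a steep cone. *)
Lemma lipschitz_approx_box f rho e : continuous f -> 0 <= rho -> 0 < e ->
  exists r g, [/\ 0 <= r, lipschitzE r g & forall x, `|x| <= rho -> `|f x - g x| <= e].
Proof.
move=> fc rho0 e0.
have [K HK] := continuous_bounded_box rho fc.
have [de de0 Hde] := continuous_unif_box rho fc e0.
have K0 : 0 <= K by apply: le_trans (HK 0 _); rewrite ?normr0.
(* Beyond distance de, a cone of this slope exceeds the oscillation 2 K of f
   on the box. *)
pose r := 2 * K / de; have r0 : 0 <= r by rewrite divr_ge0 ?mulr_ge0// ltW.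
pose S x := [set f y + r * enorm (x - y) | y in box rho].
have S0 x : S x !=set0 by exists (f 0 + r * enorm (x - 0)); exists 0 => //=; rewrite /box/= normr0.
have Slb x : has_lbound (S x).
  exists (- K) => _ [y yr <-]; have := HK y yr; rewrite ler_norml => /andP[fy _].
  by apply: le_trans fy _; rewrite lerDl mulr_ge0// enorm_ge0.
pose g x := inf (S x).
have gle x y : `|y| <= rho -> g x <= f y + r * enorm (x - y).
  by move=> yr; apply: ge_inf => //; exists y.
have gge x c : (forall y, `|y| <= rho -> c <= f y + r * enorm (x - y)) -> c <= g x.
  by move=> H; apply: lb_le_inf => // _ [y yr <-]; exact: H.
exists r, g; split=> //.
  have H x y : g x - g y <= r * enorm (x - y).
    rewrite lerBlDr -lerBlDl; apply: gge => z zr; rewrite lerBlDl.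
    apply: le_trans (gle x z zr) _; rewrite addrCA lerD2l -mulrDr ler_wpM2l//.
    by apply: le_trans (enormD _ _); rewrite addrA subrK.
  move=> x y; rewrite ler_norml lerNl opprB H andbT.
  by rewrite -enormN opprB H.
move=> x xr; have h1 : g x <= f x.
  by apply: le_trans (gle x x xr) _; rewrite subrr enorm0 mulr0 addr0.
rewrite ger0_norm ?subr_ge0// lerBlDr -lerBlDl; apply: gge => y yr.
have [xy|xy] := ltP `|x - y| de.
  rewrite lerBlDl addrA; apply: le_trans (_ : e + f y <= _); last first.
    by rewrite lerDl mulr_ge0// enorm_ge0.
  by rewrite -lerBlDr; apply: le_trans (ler_norm _) (Hde _ xr _ xy).
have : 2 * K <= r * enorm (x - y).
  rewrite /r mulrAC ler_pdivlMr// ler_wpM2l ?mulr_ge0//.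
  exact: le_trans xy (norm_le_enorm _).
move: (HK x xr) (HK y yr); rewrite !ler_norml => /andP[_ a2] /andP[b1 _].
by move: (r * _) => c ?; move: (ltW e0); lra.
Qed.

(** Approximation by a Lipschitz function on a box, truncated by a Lipschitz
    tent that vanishes off a larger box so that the weighted norm stays
    under control. *)
Lemma lipb_dense f M rho e c : Ck f -> wb M f -> 0 < e -> 0 < c ->
  exists r g, [/\ lipb r g, wb (M + c) g & forall x, `|x| <= rho -> `|f x - g x| <= e].
Proof.
move=> [fc _] fM e0 c0; have [kb kb0 Hkb] := weight_bound hk.
pose rh : R := `|rho| + 1; have rh0 : 0 <= rh by rewrite addr_ge0.
(* An error of c / kb in the supremum norm is an error of at most c in the
   weighted one. *)
pose e1 : R := Num.min e (c / kb); have e10 : 0 < e1 by rewrite lt_min e0 divr_gt0.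
have [r [g [r0 gr fg]]] := lipschitz_approx_box fc rh0 e10.
have [K HK] := continuous_bounded_box rh fc.
have K0 : 0 <= K by apply: le_trans (HK 0 _); rewrite ?normr0.
pose K' := K + e1; have K'0 : 0 <= K' by rewrite addr_ge0// ltW.
(* The tent equals K' on the box of radius rho and vanishes off the box of
   radius rh = |rho| + 1; clipping g between -tent and tent does not change it
   where tent = K', as K' bounds g on the larger box. *)
pose tent x := Num.max 0 (Num.min K' (K' * (rh - `|x|))).
have tent0 x : 0 <= tent x by rewrite le_max lexx.
have tentK x : tent x <= K' by rewrite ge_max K'0 ge_min lexx.
pose h x := Num.min (Num.max (g x) (- tent x)) (tent x).
pose s := r + K'.
have tents : lipschitzE s tent.
  apply: (@lipschitzE_le _ _ K'); first by rewrite lerDr.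
  have cst a : lipschitzE K' (fun=> a : R).
    by move=> x y; rewrite subrr normr0 mulr_ge0// enorm_ge0.
  apply: lipschitzE_max => //; apply: lipschitzE_min => // x y.
  have -> : K' * (rh - `|x|) - K' * (rh - `|y|) = K' * (`|y| - `|x|) by ring.
  rewrite normrM ger0_norm// ler_wpM2l// distrC.
  by apply: le_trans (ler_dist_dist _ _) _; exact: norm_le_enorm.
have hs : lipschitzE s h.
  apply: lipschitzE_min => //; apply: lipschitzE_max; last exact: lipschitzEN.
  by apply: lipschitzE_le gr; rewrite lerDl.
have ht x : `|h x| <= tent x.
  rewrite ler_norml /h ge_min lexx orbT andbT le_min le_max lexx orbT.
  by apply: le_trans (tent0 x); rewrite oppr_le0.
have hg x : `|h x| <= `|g x|.
  move: (tent0 x); rewrite /h; case: (leP (g x) (- tent x)) => H1.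
    move=> t0; have tg : tent x <= `|g x|.
      by rewrite -normrN; apply: le_trans (ler_norm _); rewrite lerNr.
    by case: (leP (- tent x) (tent x)) => H2; rewrite ?normrN ger0_norm.
  case: (leP (g x) (tent x)) => H2 // t0.
  by rewrite ger0_norm// (le_trans (ltW H2))// ler_norm.
have g_le x : `|x| <= rh -> `|g x| <= `|f x| + e1.
  move=> /fg; rewrite -[X in `|X| <= _ + _](subKr (f x)) => H.
  by apply: le_trans (ler_normB _ _) _; rewrite lerD2l.
exists s, h; split.
- by split=> // x; apply: le_trans (ht x) _; apply: le_trans (tentK x) _; rewrite lerDr.
- move=> x; have [xr|xr] := leP `|x| rh.
    apply: le_trans (ler_wpM2r (weight_ge0 hk x) (le_trans (hg x) (g_le x xr))) _.
    rewrite mulrDl; apply: lerD; first exact: fM.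
    apply: le_trans (_ : e1 * kb <= _); first by rewrite ler_wpM2l// ltW.
    by rewrite -ler_pdivlMr// ge_min lexx orbT.
  have -> : h x = 0.
    apply/eqP; rewrite -normr_le0; apply: le_trans (ht x) _.
    rewrite /tent ge_max lexx ge_min; apply/orP; right.
    by rewrite mulr_ge0_le0// subr_le0 ltW.
  by rewrite normr0 mul0r addr_ge0 ?(wbd_ge0 hk fM)// ltW.
move=> x xr.
have xrh : `|x| + 1 <= rh by rewrite lerD2r (le_trans xr)// ler_norm.
have xrh' : `|x| <= rh by apply: le_trans xrh; rewrite lerDl.
have te : tent x = K'.
  rewrite /tent (min_idPl _) ?(max_idPr _)//.
  by rewrite ler_peMr// lerBrDl.
have gK : `|g x| <= K' by apply: le_trans (g_le x xrh') _; rewrite lerD2r HK.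
have -> : h x = g x.
  move: gK; rewrite ler_norml /h te => /andP[g1 g2].
  by rewrite (max_idPl _)// (min_idPl _).
by apply: le_trans (fg x xrh') _; rewrite ge_min lexx.
Qed.

Definition test_fun g := Cb_infty g /\ exists r, lipb r g.

(** Mollification moves a Lipschitz function by at most its Lipschitz constant
    times the radius, uniformly on the whole space. *)
Lemma test_fun_dense f M rho e : Ck f -> wb M f -> 0 < e ->
  exists g, [/\ test_fun g, wb (M + 1) g & forall x, `|x| <= rho -> `|f x - g x| <= e].
Proof.
move=> fC fM e0; have [kb kb0 Hkb] := wbd_sup hk.
have e2 : 0 < e / 2 by rewrite divr_gt0.
have h2 : 0 < 2^-1 :> R by rewrite invr_gt0.
have [r [g [gr gM fg]]] := lipb_dense rho fC fM e2 h2.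
have r0 := lipb_ge0 gr; have r1 : 0 < r + 1 by rewrite ltr_wpDl.
pose m : R := Num.min (e / 2) (2^-1 / kb).
have m0 : 0 < m by rewrite lt_min e2 divr_gt0.
have e10 : 0 < m / (r + 1) by rewrite divr_gt0.
have [A HA HC] := smoothing_exists d e10.
have near x : `|A g x - g x| <= m.
  apply: le_trans (is_avg_near HA x r0 gr.1) _.
  by rewrite mulrCA ger_pMr// ler_pdivrMr// mul1r lerDl.
exists (A g); split.
- by split; [exact: HC gr|exists r; exact: (lipb_is_avg HA)].
- have -> : M + 1 = 2^-1 + (M + 2^-1) by field.
  rewrite -[A g](subrK g); apply: wbdD => //.
  apply: wbd_le (Hkb _ _ near).
  by rewrite -ler_pdivlMr// ge_min lexx orbT.
move=> x xr; rewrite -[X in `|X|](subrKA (g x)) (splitr e).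
apply: le_trans (ler_normD _ _) _; rewrite lerD ?fg// distrC.
by apply: le_trans (near x) _; rewrite ge_min lexx.
Qed.

End Density.

(** * Comparison of limit semigroups *)

Section Dini.
Context {R : realType}.

(** A function whose lower right Dini derivative is at least -c, and that does
    not jump down from the left, decreases at most at rate c: the last time at
    which this holds with c + e cannot lie before t. *)
Lemma dini_lower (v : R -> R) (t c : R) : 0 <= t ->
  (forall s e, 0 <= s < t -> 0 < e -> exists2 tau, 0 < tau &
     forall h, 0 < h < tau -> s + h <= t -> v s - (c + e) * h <= v (s + h)) ->
  (forall s e, 0 < s <= t -> 0 < e -> exists2 tau, 0 < tau &
     forall h, 0 < h < tau -> h <= s -> v (s - h) <= v s + e) ->
  v 0 - c * t <= v t.
Proof.
move=> t0 Hr Hl; rewrite lerBlDr; apply: (@le_of_eps R _ _ t) => e e0.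
(* The times at which the estimate holds with c + e; m is the last one. *)
pose A := [set s | 0 <= s <= t /\ v 0 - (c + e) * s <= v s].
have A0 : A 0 by split; rewrite ?lexx ?t0// mulr0 subr0.
have supA : has_sup A by split; [exists 0|exists t => s [/andP[]]].
pose m := sup A.
have m0 : 0 <= m by apply: ub_le_sup => //; case: supA.
have mt : m <= t by apply: sup_le_ub; [exists 0|move=> s [/andP[]]].
(* The supremum is attained because v does not jump down from the left. *)
have Am : A m.
  split; first by rewrite m0 mt.
  have [m_eq0|m_neq0] := eqVneq m 0; first by rewrite m_eq0; case: A0.
  have m_gt0 : 0 < m by rewrite lt_def m_neq0.
  have me : 0 < m <= t by rewrite m_gt0 mt.
  apply: (@le_of_eps R _ _ (1 + `|c + e|)) => e' e'0.
  have [tau tau0 Htau] := Hl m e' me e'0.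
  have q0 : 0 < Num.min tau e' by rewrite lt_min tau0 e'0.
  have [a [/andP[a0 at_] Aa] am] := sup_adherent q0 supA.
  have am' : a <= m by apply: ub_le_sup; [case: supA|split => //; rewrite a0 at_].
  rewrite -/m ltrBlDl -ltrBlDr lt_min in am.
  have [ma|ma] := eqVneq a m.
    by rewrite -ma; apply: le_trans Aa _; rewrite lerDl mulr_ge0 ?addr_ge0// ltW.
  have lam : a < m by rewrite lt_def eq_sym ma.
  have /andP[h1 h2] := am.
  have vam : v a <= v m + e'.
    have := Htau (m - a); rewrite subr_gt0 lam h1 subKr; apply => //.
    by rewrite gerBl.
  rewrite [(1 + _) * e']mulrDl mul1r addrA.
  apply: le_trans (_ : v a + `|c + e| * e' <= _); last by rewrite lerD2r.
  rewrite (_ : _ - _ = (v 0 - (c + e) * a) - (c + e) * (m - a)); last by ring.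
  rewrite lerD// -mulNr; apply: le_trans (_ : `|c + e| * (m - a) <= _).
    by rewrite ler_wpM2r ?subr_ge0// -normrN ler_norm.
  by rewrite ler_wpM2l// ltW.
have [mt'|mt'] := eqVneq m t; first by move: Am; rewrite mt' => -[_]; lra.
have mlt : 0 <= m < t by rewrite m0 lt_def eq_sym mt'.
have e2 : 0 < e by [].
have [tau tau0 Htau] := Hr m (e / 2) mlt (divr_gt0 e0 (ltr0n _ 2)).
pose h := Num.min (tau / 2) (t - m).
have /andP[_ mltt] := mlt.
have h0 : 0 < h by rewrite lt_min divr_gt0//= subr_gt0.
have ht : m + h <= t by rewrite -lerBrDl ge_min lexx orbT.
have htau : h < tau by rewrite gt_min ltr_pdivrMr// ltr_pMr// ltr1n.
have := Htau h; rewrite h0 htau => /(_ isT ht) H.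
suff : m + h <= m by rewrite gerDl leNgt h0.
apply: ub_le_sup; first by case: supA.
split; first by rewrite ht andbT addr_ge0// ltW.
move: Am => [_] Am; apply: le_trans H.
have : e / 2 * h <= e * h by rewrite ler_wpM2r ?(ltW h0)// ler_pdivrMr// ler_peMr ?(ltW e0)// ler1n.
by move: Am; lra.
Qed.

End Dini.

Section Comparison.
Context (R : realType) (d : nat) (kappa : 'rV[R]_d -> R).
Local Notation E := 'rV[R]_d.
Local Notation F := (E -> R).
Implicit Types (x y z : E) (f g : F) (Phi : F -> F).
Hypothesis hk : bounded_continuous_weight kappa.
Local Notation Ck := (Ckappa kappa).
Local Notation wb := (wbd kappa).

Lemma Ck_Cb_infty f : Cb_infty f -> Ck f.
Proof.
move=> /(_ [::]) [_ /= fc /supnorm_ltyP[M fM]]; apply/CkP; split=> //.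
by have [kb _ H] := wbd_sup hk; exists (M * kb); exact: H.
Qed.

Lemma Ck_sum (I : Type) (s : seq I) (f : I -> F) :
  (forall i, Ck (f i)) -> Ck (\sum_(i <- s) f i).
Proof. by move=> H; apply: big_ind => //; [exact: Ck0|exact: CkD]. Qed.

Lemma slop_sum (I : Type) (s : seq I) (f : I -> F) Phi C x : slop kappa Phi C ->
  (forall i, Ck (f i)) -> Phi (\sum_(i <- s) f i) x <= \sum_(i <- s) Phi (f i) x.
Proof.
move=> HP H; elim: s => [|i s IH]; first by rewrite !big_nil (slop0 HP).
rewrite !big_cons; apply: le_trans (slop_add HP (H i) (Ck_sum s H) x) _.
by rewrite lerD2l.
Qed.

(** Sublinearity applied to a finite average of translates gives the average
    of Phi applied to the translates, and each of these is compared with a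
    translate of Phi f. *)
Lemma jensen_avg Phi C c b l rho M r f x : slop kappa Phi C -> lipop Phi c b l ->
  0 <= l -> is_avg rho M -> lipb r f -> Phi (M f) x <= M (Phi f) x + l * r * rho.
Proof.
move=> HP LP l0 HM fr; have r0 := lipb_ge0 fr.
apply: (@le_of_eps R _ _ (c * r + b * r)) => e e0.
have [s [s0 sr sM]] := HM.2 e e0.
have Pr := lipop_lip LP fr.
have ar : lipb r (avg s f).
  split=> [|y]; first exact: avg_lip fr.1.
  rewrite -[avg s f y]subr0 -[X in _ - X](avg_cst s0 0 y).
  by apply: avg_dist => // z _; rewrite subr0 fr.2.
have H1 : Phi (M f) x - Phi (avg s f) x <= c * (r * e).
  apply: le_trans (ler_norm _) _.
  apply: (sup_dist hk HP (lipop_sup LP)) (lipb_is_avg HM fr) ar _ _.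
  by move=> y; exact: sM fr.1 _.
have H2 : Phi (avg s f) x <= avg s (Phi f) x + l * r * rho.
  have -> : avg s f = (size s)%:R^-1 *: \sum_(y <- s) translate y f.
    apply/funext => y; rewrite /avg scalefE fct_sumE; congr (_ * _).
    by apply: eq_bigr => z _; rewrite /translate addrC.
  have tC y : Ck (translate y f) := Ck_lipb hk (lipb_translate y fr).
  rewrite (slop_hom HP) ?invr_ge0//; last exact: Ck_sum.
  rewrite -[l * r * rho](avg_cst s0 _ x) -avgD scalefE ler_wpM2l ?invr_ge0//.
  apply: le_trans (slop_sum _ _ HP tC) _; rewrite big_seq [leRHS]big_seq.
  apply: ler_sum => y ys; rewrite addfE -lerBlDl [x + y]addrC.
  apply: le_trans (ler_norm _) _; rewrite distrC.
  apply: le_trans (lipop_trans LP fr y x) _.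
  by rewrite ler_wpM2l ?mulr_ge0// sr.
have H3 : avg s (Phi f) x - M (Phi f) x <= b * r * e.
  by apply: le_trans (ler_norm _) _; rewrite distrC sM ?(lipb_ge0 Pr)//; exact: Pr.1.
by rewrite mulrDl -mulrA; move: H1 H2 H3; lra.
Qed.

(** Equicontinuity, at 0 and on the positive cone, of a set of operators for
    the mixed topology: a norm bound together with smallness on a large box
    forces smallness on a given box. *)
Definition tight (D : set (F -> F)) := forall M rho e, 0 < e ->
  exists rho' de, 0 < de /\ forall Phi f, D Phi -> Ck f -> (forall x, 0 <= f x) ->
    wb M f -> (forall x, `|x| <= rho' -> f x <= de) ->
    forall x, `|x| <= rho -> Phi f x <= e.

Lemma tight_dist D C M rho e : tight D -> (forall Phi, D Phi -> slop kappa Phi C) -> 0 < e ->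
  exists rho' de, 0 < de /\ forall Phi f g, D Phi -> Ck f -> Ck g ->
    wb M f -> wb M g -> (forall x, `|x| <= rho' -> `|f x - g x| <= de) ->
    forall x, `|x| <= rho -> `|Phi f x - Phi g x| <= e.
Proof.
move=> HD DC e0; have [rho' [de [de0 H]]] := HD (M + M) rho e e0.
exists rho', de; split=> // Phi f g DP fC gC fM gM fg x xr.
have fgC := Ck_abs (CkB hk fC gC).
apply: le_trans (slop_dist hk (DC Phi DP) x fC gC fgC _) _; first by [].
apply: (H Phi _ DP fgC) => // [y|]; first exact: normr_ge0.
by apply/wbd_abs; exact: wbdB.
Qed.

Section Semigroups.
Context (w w' L : R) (G : F -> F).
Hypotheses (w0 : 0 <= w) (w'0 : 0 <= w') (L0 : 0 <= L).

(** What the uniform estimates on a scheme leave in the limit: G is the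
    derivative at 0 on smooth functions, in the sense of locally uniform
    convergence of the difference quotients, which are bounded in norm by the
    previous field. *)
Record limit_sg (T : R -> F -> F) : Prop := {
  ls_slop : forall t, 0 <= t -> slop kappa (T t) (expR (w * t));
  ls_lip : forall t, 0 <= t ->
    lipop (T t) (expR (w * t)) (expR (w' * t)) (L * t * expR (w' * t));
  ls_0 : forall f, Ck f -> T 0 f = f;
  ls_add : forall s t f, 0 <= s -> 0 <= t -> Ck f -> T (s + t) f = T s (T t f);
  ls_tight : forall T0, tight [set Phi | exists2 t, 0 <= t <= T0 & Phi = T t];
  ls_time : forall f, Cb_infty f -> exists C, forall t, 0 <= t ->
    wb (C * t * expR (w * t)) (T t f - f);
  ls_gen : forall f rho e, Cb_infty f -> 0 < e -> exists2 tau, 0 < tau &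
    forall h, 0 < h < tau -> forall x, `|x| <= rho ->
      `|T h f x - f x - h * G f x| <= h * e }.

Lemma expR_wle (a s t : R) : 0 <= a -> s <= t -> expR (a * s) <= expR (a * t).
Proof. by move=> a0 st; rewrite ler_expR ler_wpM2l. Qed.

Lemma ls_slop_le T t t' : limit_sg T -> 0 <= t -> t <= t' ->
  slop kappa (T t) (expR (w * t')).
Proof.
by move=> HT t0 tt; apply: (slop_le hk) (ls_slop HT t0); exact: expR_wle.
Qed.

Lemma ls_time_le T f : limit_sg T -> Cb_infty f -> exists2 C, 0 <= C &
  forall h t, 0 <= h <= t -> wb (C * expR (w * t) * h) (T h f - f).
Proof.
move=> HT fS; have [C HC] := ls_time HT fS; exists `|C| => // h t /andP[h0 ht].
apply: wbd_le (HC h h0); rewrite mulrAC ler_wpM2r//.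
apply: le_trans (ler_wpM2r (expR_ge0 _) (ler_norm C)) _.
by rewrite ler_wpM2l// expR_wle.
Qed.

Section Compare.
Hypothesis hmod : moderate kappa.
Context (S T : R -> F -> F) (HS : limit_sg S) (HT : limit_sg T).

(** The moderate growth of the weight, in the form used for averages of
    translates over a ball of radius at most 1. *)
Lemma moderate_le : exists2 C, 0 <= C &
  forall x y, enorm y <= 1 -> kappa x <= C * kappa (x + y).
Proof.
have [C HC] := hmod; exists C.
  apply: le_trans (HC 0 0 _); rewrite ?enorm0//.
  by rewrite divr_ge0 ?weight_ge0.
move=> x y y1; rewrite -ler_pdivrMr ?weight_gt0//.
by rewrite -[y]opprK HC// enormN.
Qed.

(** Along the curve s |-> T (t - s) M (S s f) the lower right Dini derivative
    is at least -C rho: M (S s f) is smooth, so that S and T have the same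
    derivative there, and S h after M is at most M after S h up to O (h rho)
    by Jensen's inequality. *)
Lemma compare_mollified t r f : 0 <= t -> Cb_infty f -> lipb r f ->
  exists2 C, 0 <= C & forall rho M x, rho <= 1 -> is_avg rho M ->
    (forall r f, lipb r f -> Cb_infty (M f)) ->
    T t (M f) x <= M (S t f) x + C * rho.
Proof.
move=> t0 fS fr; have r0 := lipb_ge0 fr.
set ew := expR (w * t); set ew' := expR (w' * t).
have ew0 : 0 <= ew := expR_ge0 _.
have ew'0 : 0 <= ew' := expR_ge0 _.
pose r' := ew' * r; have r'0 : 0 <= r' by rewrite mulr_ge0.
have Sf s : 0 <= s <= t -> lipb r' (S s f).
  move=> /andP[s0 st]; apply: lipb_le (lipop_lip (ls_lip HS s0) fr).
  by rewrite ler_wpM2r// expR_wle.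
exists (ew * (L * ew' * r') * t); first by rewrite !mulr_ge0.
move=> rho M x rho1 HM MC; have rho0 := HM.1.
pose g s := M (S s f).
have gr s : 0 <= s <= t -> lipb r' (g s) by move=> /Sf; exact: (lipb_is_avg HM).
have gS s : 0 <= s <= t -> Cb_infty (g s) by move=> /Sf/MC.
have gC s : 0 <= s <= t -> Ck (g s) by move=> /gr; exact: Ck_lipb.
have Cf := Ck_lipb hk fr.
pose v s := T (t - s) (g s) x.
have vt : v t = M (S t f) x by rewrite /v subrr (ls_0 HT)//; apply: gC; rewrite t0 lexx.
have v0 : v 0 = T t (M f) x by rewrite /v subr0 /g (ls_0 HS).
pose c0 := L * ew' * r' * rho; have c00 : 0 <= c0 by rewrite !mulr_ge0.
suff : v 0 - (ew * c0) * t <= v t.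
  by rewrite v0 vt lerBlDr; congr (_ <= _ + _); rewrite /c0; ring.
apply: dini_lower => //.
- move=> s e /andP[s0 st] e0.
  have st' : 0 <= s <= t by rewrite s0 ltW.
  have [CT CT0 HCT] := ls_time_le HT (gS s st').
  have [CS CS0 HCS] := ls_time_le HS (gS s st').
  pose K := (CT + CS) * ew.
  have [rho' [de [de0 Hti]]] := ls_tight HT t K `|x| e0.
  have de2 : 0 < de / 2 by rewrite divr_gt0.
  have [t1 t10 H1] := ls_gen HT rho' (gS s st') de2.
  have [t2 t20 H2] := ls_gen HS rho' (gS s st') de2.
  exists (Num.min t1 t2); first by rewrite lt_min t10.
  move=> h /andP[h0]; rewrite lt_min => /andP[ht1 ht2] sht.
  have h0' := ltW h0.
  have ht : h <= t by apply: le_trans sht; rewrite lerDr.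
  have h0t : 0 <= h <= t by rewrite h0'.
  have sh : 0 <= s + h <= t by rewrite addr_ge0.
  have a0 : 0 <= t - (s + h) by rewrite subr_ge0.
  have aT : t - (s + h) <= t by rewrite gerBl addr_ge0.
  rewrite /v (_ : t - s = t - (s + h) + h); last by ring.
  set a := t - (s + h) in a0 aT *.
  have SlT := ls_slop HT h0'; have SlS := ls_slop HS h0'.
  have Sla := ls_slop HT a0.
  have gsC := gC s st'; have gshC := gC _ sh.
  have ThC := slop_Ck SlT gsC; have ShC := slop_Ck SlS gsC.
  rewrite (ls_add HT a0 h0' gsC).
  (* The difference quotients of T and S at g s differ by D, which is
     bounded in norm and small on boxes, hence mapped by T to a function
     small at x. *)
  pose D : F := absf (h^-1 *: (T h (g s) - S h (g s))).
  have D0 y : 0 <= D y by exact: normr_ge0.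
  have DC : Ck D by apply: (Ck_abs); apply: (CkZ); exact: (CkB hk).
  have DK : wb K D.
    apply/wbd_abs; have -> : K = `|h^-1| * (K * h).
      by rewrite ger0_norm ?invr_ge0// mulrCA mulVf ?mulr1// gt_eqF.
    apply: wbdZ; rewrite /K !mulrDl.
    have -> : T h (g s) - S h (g s) = (T h (g s) - g s) - (S h (g s) - g s).
      by rewrite opprB addrA subrK.
    by apply: (wbdB hk); [exact: HCT|exact: HCS].
  have hD y : T h (g s) y - S h (g s) y <= h * D y.
    rewrite /D /absf normrM ger0_norm ?invr_ge0// mulrA divff ?gt_eqF// mul1r.
    exact: ler_norm.
  have Dde y : `|y| <= rho' -> D y <= de.
    move=> yr; rewrite /D /absf normrM ger0_norm ?invr_ge0// mulrC ler_pdivrMr//.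
    have B1 : `|T h (g s) y - g s y - h * G (g s) y| <= h * (de / 2).
      by apply: H1 => //; rewrite h0.
    have B2 : `|S h (g s) y - g s y - h * G (g s) y| <= h * (de / 2).
      by apply: H2 => //; rewrite h0.
    rewrite (_ : (T h (g s) - S h (g s)) y = (T h (g s) y - g s y - h * G (g s) y) -
      (S h (g s) y - g s y - h * G (g s) y)); last by rewrite !fctE3; ring.
    apply: le_trans (ler_normB _ _) _; move: B1 B2; lra.
  have TD : T a D x <= e.
    by apply: Hti => //; exists a => //; rewrite a0.
  have jen y : S h (g s) y <= g (s + h) y + h * c0.
    have -> : g (s + h) = M (S h (S s f)) by rewrite /g addrC (ls_add HS h0' s0 Cf).
    have l0 : 0 <= L * h * expR (w' * h) by rewrite !mulr_ge0// expR_ge0.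
    apply: le_trans (jensen_avg y SlS (ls_lip HS h0') l0 HM (Sf s st')) _.
    rewrite lerD2l [leRHS]mulrC /c0.
    rewrite (_ : L * ew' * r' * rho * h = L * h * ew' * r' * rho); last by ring.
    by rewrite !ler_wpM2r// ler_wpM2l ?mulr_ge0// expR_wle.
  have hc0 : 0 <= h * c0 by rewrite mulr_ge0.
  have cstl : lipb (h * c0) ((fun=> h * c0) : F).
    by split=> [y z|y]; rewrite ?subrr ?normr0 ?mulr_ge0 ?enorm_ge0// ger0_norm.
  have cstC := Ck_lipb hk cstl.
  have Tc : T a (fun=> h * c0) x <= ew * (h * c0).
    apply: le_trans (ler_norm _) _.
    apply: le_trans (lipop_sup (ls_lip HT a0) cstl cstl.2 x) _.
    by rewrite ler_wpM2r// expR_wle.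
  have hDC : Ck (h *: D) by exact: CkZ.
  have B : T a (T h (g s)) x - T a (g (s + h)) x <= h * T a D x + T a (fun=> h * c0) x.
    apply: le_trans (slop_sub hk Sla x ThC gshC) _.
    have -> : h * T a D x = T a (h *: D) x by rewrite (slop_hom Sla).
    apply: le_trans (slop_add Sla hDC cstC x).
    apply: (slop_mono Sla); [exact: (CkB hk)|exact: (CkD hk)|].
    by move=> y; rewrite !fctE3; move: (hD y) (jen y); lra.
  have : h * T a D x <= h * e by rewrite ler_wpM2l.
  by move: B Tc; lra.
- move=> s e /andP[s0 st] e0; have s0' := ltW s0.
  have st' : 0 <= s <= t by rewrite s0'.
  have [CT CT0 HCT] := ls_time_le HT (gS s st').
  have [CS CS0 HCS] := ls_time_le HS fS.
  have [Cm Cm0 HCm] := moderate_le.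
  pose K := ew * (ew * (Cm * (ew * (CS * ew))) + CT * ew).
  have K0 : 0 <= K by rewrite !(mulr_ge0, addr_ge0).
  have kx := weight_gt0 hk x.
  have Kk1 : 0 < K / kappa x + 1 by rewrite ltr_wpDl// divr_ge0// ltW.
  exists (e / (K / kappa x + 1)); first by rewrite divr_gt0.
  move=> h /andP[h0 he] hs; have h0' := ltW h0.
  have ht : 0 <= h <= t by rewrite h0' (le_trans hs).
  have sh : 0 <= s - h <= t by rewrite subr_ge0 hs (le_trans _ st)// gerBl.
  have a0 : 0 <= t - s by rewrite subr_ge0.
  rewrite /v (_ : t - (s - h) = t - s + h); last by ring.
  have gsC := gC s st'; have gshC := gC _ sh.
  have SlT := ls_slop_le HT h0' (andP ht).2.
  have aT : t - s <= t by rewrite gerBl.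
  have Sla := ls_slop_le HT a0 aT.
  rewrite (ls_add HT a0 h0' gshC).
  have ThC := slop_Ck SlT gshC; have ThC' := slop_Ck SlT gsC.
  have B1 : wb (ew * (CS * ew * h)) (S s f - S (s - h) f).
    have SlS := ls_slop_le HS (andP sh).1 (andP sh).2.
    have -> : S s f = S (s - h) (S h f) by rewrite -(ls_add HS) ?subrK//; case/andP: sh.
    apply: (slop_wbd_dist hk SlS) => //; last exact: HCS.
    by apply: (slop_Ck (ls_slop HS h0')).
  have B2 : wb (Cm * (ew * (CS * ew * h))) (g (s - h) - g s).
    have -> : g (s - h) - g s = - (M (S s f - S (s - h) f)).
      apply/funext => y; rewrite !fctE3.
      have ln : lipschitzE r' (- S (s - h) f) := (lipbN (Sf _ sh)).1.
      rewrite (is_avgD HM y r'0 (Sf s st').1 ln).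
      have -> : - S (s - h) f = -1 *: S (s - h) f by rewrite scaleN1r.
      by rewrite (is_avgZ HM _ _ r'0 (Sf _ sh).1) /g; ring.
    apply: wbdN.
    have dr : lipschitzE (r' + r') (S s f - S (s - h) f).
      by apply: lipschitzED; [exact: (Sf s st').1|exact: (lipbN (Sf _ sh)).1].
    apply: (is_avg_wbd HM (weight_gt0 hk) Cm0 _ _ dr) => //; last by rewrite addr_ge0.
    by move=> y z zr; apply: HCm; exact: le_trans zr rho1.
  (* Continuity in time from the left: both g and T move by O (h) in the
     norm. *)
  have B3 : wb (ew * (Cm * (ew * (CS * ew * h))) + CT * ew * h) (T h (g (s - h)) - g s).
    rewrite -(subrKA (T h (g s))); apply: (wbdD hk); last exact: HCT.
    exact: (slop_wbd_dist hk SlT).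
  have B4 := slop_wbd_dist hk Sla ThC gsC B3.
  have {}B4 : wb (K * h) (T (t - s) (T h (g (s - h))) - T (t - s) (g s)).
    rewrite -/ew in B4; apply: wbd_le B4; rewrite le_eqVlt; apply/orP; left; apply/eqP.
    rewrite /K; clearbody ew; ring.
  rewrite -lerBlDl; apply: le_trans (ler_norm _) _.
  apply: le_trans (wbd_at hk x B4) _.
  rewrite ltr_pdivlMr// in he; apply: le_trans (ltW he).
  by rewrite mulrAC mulrDr mulr1 mulrC lerDl.
Qed.

(** The radius of the mollification tends to 0 in the previous comparison. *)
Lemma limit_sg_le_test t f x : 0 <= t -> test_fun f -> T t f x <= S t f x.
Proof.
move=> t0 [fS [r fr]]; have r0 := lipb_ge0 fr.
have [C C0 HC] := compare_mollified t0 fS fr.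
apply: (@le_of_eps R _ _ (C + expR (w' * t) * r + expR (w * t) * r)) => e e0.
pose rho := Num.min e 1.
have rho0 : 0 < rho by rewrite lt_min e0 ltr01.
have rho1 : rho <= 1 by rewrite ge_min lexx orbT.
have rhoe : rho <= e by rewrite ge_min lexx.
have [M HM MC] := smoothing_exists d rho0.
have H1 := HC rho M x rho1 HM MC.
have Sr := lipop_lip (ls_lip HS t0) fr.
have H2 := is_avg_near HM x (lipb_ge0 Sr) Sr.1.
have H3 : `|T t (M f) x - T t f x| <= expR (w * t) * (r * rho).
  apply: (sup_dist hk (ls_slop HT t0) (lipop_sup (ls_lip HT t0)) (lipb_is_avg HM fr) fr).
  by move=> y; exact: (is_avg_near HM y r0 fr.1).
have H4 : (C + expR (w' * t) * r + expR (w * t) * r) * rho <=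
    (C + expR (w' * t) * r + expR (w * t) * r) * e.
  by rewrite ler_wpM2l// !addr_ge0 ?mulr_ge0 ?expR_ge0.
by move: H1 H2 H3 H4; rewrite !ler_norml; lra.
Qed.

End Compare.

Lemma limit_sg_le T S t f x : moderate kappa -> limit_sg S -> limit_sg T ->
  0 <= t -> Ck f -> T t f x <= S t f x.
Proof.
move=> hmod HS HT t0 fC; have [M fM] := Ck_wbd fC.
apply: (@le_of_eps R _ _ 2) => e e0.
have tt : 0 <= t <= t by rewrite t0 lexx.
have DT Phi : [set Phi | exists2 s, 0 <= s <= t & Phi = T s] Phi -> slop kappa Phi (expR (w * t)).
  by move=> [s /andP[s0 st] ->]; exact: ls_slop_le.
have DS Phi : [set Phi | exists2 s, 0 <= s <= t & Phi = S s] Phi -> slop kappa Phi (expR (w * t)).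
  by move=> [s /andP[s0 st] ->]; exact: ls_slop_le.
have [r1 [d1 [d10 H1]]] := tight_dist (M + 1) `|x| (ls_tight HT t) DT e0.
have [r2 [d2 [d20 H2]]] := tight_dist (M + 1) `|x| (ls_tight HS t) DS e0.
have dd : 0 < Num.min d1 d2 by rewrite lt_min d10.
have [g [gT gM fg]] := test_fun_dense hk (Num.max r1 r2) fC fM dd.
have gC := Ck_Cb_infty gT.1.
have fM1 : wb (M + 1) f by apply: wbd_le fM; rewrite lerDl.
have B1 : `|T t f x - T t g x| <= e.
  apply: (H1 (T t)) => //; first by exists t.
  by move=> y yr; apply: le_trans (fg y _) _; rewrite ?le_max ?yr ?ge_min ?lexx.
have B2 : `|S t f x - S t g x| <= e.
  apply: (H2 (S t)) => //; first by exists t.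
  by move=> y yr; apply: le_trans (fg y _) _; rewrite ?le_max ?yr ?ge_min ?lexx ?orbT.
have := limit_sg_le_test hmod HS HT x t0 gT.
by move: B1 B2; rewrite !ler_norml; lra.
Qed.

Lemma limit_sg_unique T S t f : moderate kappa -> limit_sg S -> limit_sg T ->
  0 <= t -> Ck f -> T t f = S t f.
Proof.
by move=> hmod HS HT t0 fC; apply/funext => x; apply/le_anti; rewrite !limit_sg_le.
Qed.

End Semigroups.
End Comparison.

(** * Ultrafilter limits of iterated schemes *)

Section Ultra.
Context {R : realType}.

Lemma ultra_cvg (U : set_system nat) (a : nat -> R) (M : R) : UltraFilter U ->
  (forall n, `|a n| <= M) -> a n @[n --> U] --> lim (a n @[n --> U]).
Proof.
move=> UU aM; apply/cvg_ex.
have [p [_ clp]] : `[- M, M]%classic `&` cluster (a @ U) !=set0.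
  have PF : ProperFilter (a @ U) by exact: fmap_proper_filter.
  apply: (@segment_compact R (- M) M (a @ U) PF).
  change (U [set n | `[- M, M]%classic (a n)]); apply: filterE => n /=.
  by rewrite in_itv/= -ler_norml.
exists p; apply/cvgrPdist_le => e e0.
have [//|H] := in_ultra_setVsetC [set n | `|p - a n| <= e] UU.
have pe : nbhs p [set y | `|p - y| <= e].
  by apply/nbhs_ballP; exists e => //= y; rewrite /ball/= => /ltW.
by have [y [/= Hy1 Hy2]] := clp [set y | ~ (`|p - y| <= e)] _ H pe.
Qed.

(** A property that does not fail eventually can be forced along some
    ultrafilter; applied to the set where convergence fails, it reduces
    convergence to the uniqueness of ultrafilter limits. *)
Lemma ultra_extension (B : set nat) : ~ (\forall n \near \oo, ~ B n) ->
  exists V, [/\ UltraFilter V, (forall A : set nat, (\forall n \near \oo, A n) -> V A) & V B].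
Proof.
move=> nB.
(* The tails intersected with B form a proper filter. *)
have PF : ProperFilter (within B \oo).
  split; last exact: within_filter.
  move=> H; apply: nB; apply: filterS H => n /= ; exact.
have [V [UV VB]] := ultraFilterLemma PF.
exists V; split=> //; last first.
  by apply: VB; rewrite /within/=; apply: filterE.
by move=> A HA; apply: VB; rewrite /within/=; apply: filterS HA.
Qed.

End Ultra.

Section Chernoff.
Context (R : realType) (d : nat) (kappa : 'rV[R]_d -> R).
Local Notation E := 'rV[R]_d.
Local Notation F := (E -> R).
Implicit Types (x y z : E) (f g : F) (Phi : F -> F).
Hypothesis hk : bounded_continuous_weight kappa.
Local Notation Ck := (Ckappa kappa).
Local Notation wb := (wbd kappa).
Context (w w' L : R) (G : F -> F).
Hypotheses (w0 : 0 <= w) (ww' : w <= w') (L0 : 0 <= L).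

(** The hypotheses of a Chernoff type theorem: stability, almost translation
    invariance, equicontinuity of the iterates up to a fixed time, and
    consistency with G on smooth functions. *)
Record chernoff (h : nat -> R) (J : nat -> F -> F) : Prop := {
  ch_h0 : forall n, 0 < h n;
  ch_hcvg : h n @[n --> \oo] --> (0 : R);
  ch_slop : forall n, slop kappa (J n) (expR (w * h n));
  ch_lip : forall n, lipop (J n) (expR (w * h n)) (expR (w' * h n)) (L * h n);
  ch_tight : forall T0, tight kappa
    [set Phi | exists n k, k%:R * h n <= T0 /\ Phi = iter k (J n)];
  ch_gen : forall f, Cb_infty f -> Ck (G f) /\ exists2 e : nat -> R,
    e n @[n --> \oo] --> (0 : R) &
    forall n, wb (e n) ((h n)^-1 *: (J n f - f) - G f) }.

Section Fixed.
Context (h : nat -> R) (J : nat -> F -> F).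
Hypothesis HJ : chernoff h J.
Let h0 n : 0 < h n. Proof. exact: ch_h0 HJ n. Qed.
Let h0' n : 0 <= h n. Proof. exact: ltW. Qed.
Let w'0 : 0 <= w'. Proof. exact: le_trans ww'. Qed.

Lemma iter_slop n k : slop kappa (iter k (J n)) (expR (w * (k%:R * h n))).
Proof.
by rewrite mulrCA expRM_natl; apply: (slop_iter hk); exact: ch_slop HJ n.
Qed.

Lemma iter_slop_le n k t : k%:R * h n <= t -> slop kappa (iter k (J n)) (expR (w * t)).
Proof. by move=> kt; apply: (slop_le hk) (iter_slop n k); exact: expR_wle. Qed.

Lemma iter_lip_le n k t : k%:R * h n <= t ->
  lipop (iter k (J n)) (expR (w * t)) (expR (w' * t)) (L * t * expR (w' * t)).
Proof.
move=> kt; have kh0 : 0 <= k%:R * h n by rewrite mulr_ge0.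
have := lipop_iter hk k (ch_slop HJ n) (ch_lip HJ n).
rewrite -!expRM_natl [k%:R * (w * _)]mulrCA [k%:R * (w' * _)]mulrCA => H.
apply: lipop_le (H _ _ _).
- exact: expR_wle.
- exact: expR_wle.
- rewrite [k%:R * _]mulrCA; apply: ler_pM; rewrite ?expR_ge0 ?mulr_ge0//.
    by rewrite ler_wpM2l.
  exact: expR_wle.
- by rewrite ler_expR ler_wpM2r.
- by rewrite -expR0 ler_expR mulr_ge0.
- by rewrite mulr_ge0.
Qed.

Lemma ch_step f : Cb_infty f -> exists2 C, 0 <= C & forall n, wb (C * h n) (J n f - f).
Proof.
move=> fS; have [GC [e ecv He]] := ch_gen HJ fS; have [M GM] := Ck_wbd GC.
have M0 := wbd_ge0 hk GM.
have [B HB] : exists B, forall n, `|e n| <= B.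
  have ec : cvgn e by apply/cvg_ex; exists 0.
  have [B [_ HB]] := cvg_seq_bounded ec; exists (B + 1) => n.
  by apply: (HB (B + 1)) => //; rewrite ltrDl.
have B0 : 0 <= B by apply: le_trans (HB 0).
exists (B + M); first by rewrite addr_ge0.
move=> n; have -> : J n f - f = h n *: (((h n)^-1 *: (J n f - f) - G f) + G f).
  by rewrite subrK scalerA divff ?scale1r// gt_eqF.
rewrite mulrC -[X in X * _]ger0_norm//; apply: wbdZ; apply: (wbdD hk) => //.
by apply: wbd_le (He n); apply: le_trans (HB n); exact: ler_norm.
Qed.

(** Telescoping: each of the k steps displaces f by O (h), and the remaining
    iterate amplifies this by at most the exponential factor. *)
Lemma ch_time f : Cb_infty f -> exists2 C, 0 <= C &
  forall n k, wb (C * (k%:R * h n) * expR (w * (k%:R * h n))) (iter k (J n) f - f).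
Proof.
move=> fS; have [C C0 HC] := ch_step fS; exists C => // n.
have fC := Ck_Cb_infty hk fS.
elim=> [|k IH]; first by rewrite subrr !(mul0r, mulr0) => x; rewrite normr0 mul0r.
rewrite iterSr -(subrKA (iter k (J n) f)).
have JC := slop_Ck (ch_slop HJ n) fC.
have H := slop_wbd_dist hk (iter_slop n k) JC fC (HC n).
apply: wbd_le (wbdD hk H IH).
have kk : expR (w * (k%:R * h n)) <= expR (w * (k.+1%:R * h n)).
  by apply: expR_wle => //; rewrite ler_wpM2r// ler_nat.
rewrite (_ : _ + _ = C * (k.+1%:R * h n) * expR (w * (k%:R * h n))); last first.
  by rewrite -natr1; ring.
by rewrite ler_wpM2l// !mulr_ge0.
Qed.

Lemma ch_time_dist f : Cb_infty f -> exists2 C, 0 <= C & forall n k m T0,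
  k%:R * h n <= T0 -> m%:R * h n <= T0 ->
  wb (C * expR (w * T0) * `|k%:R * h n - m%:R * h n|) (iter k (J n) f - iter m (J n) f).
Proof.
move=> fS; have [C C0 HC] := ch_time fS; exists C => // n.
have fC := Ck_Cb_infty hk fS.
have H k m T0 : (k <= m)%N -> m%:R * h n <= T0 ->
  wb (C * expR (w * T0) * `|k%:R * h n - m%:R * h n|) (iter m (J n) f - iter k (J n) f).
  move=> km mT; rewrite -(subnKC km) iterD.
  have JC : Ck (iter (m - k) (J n) f) by exact: (slop_Ck (iter_slop n _) fC).
  apply: wbd_le (slop_wbd_dist hk (iter_slop n k) JC fC (HC n (m - k)%N)).
  rewrite subnKC// distrC -mulrBl -natrB// ger0_norm ?mulr_ge0//.
  rewrite [leLHS](_ : _ = C * (expR (w * (k%:R * h n)) * expR (w * ((m - k)%:R * h n))) *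
    ((m - k)%:R * h n)); last first.
    by move: ((m - k)%:R * h n) (expR _) (expR _) => D a b; ring.
  rewrite -expRD -mulrDr -mulrDl -natrD subnKC//.
  rewrite ler_wpM2r ?mulr_ge0// ler_wpM2l//.
  exact: expR_wle.
move=> k m T0 kT mT; have [km|/ltnW km] := leqP k m; last first.
  by rewrite distrC; exact: H.
by rewrite -[X in wb _ X]opprB; apply: wbdN; exact: H.
Qed.

Lemma ch_tight_dist M rho e T0 : 0 < e -> exists rho' de, 0 < de /\
  forall n k f g, k%:R * h n <= T0 -> Ck f -> Ck g -> wb M f -> wb M g ->
    (forall x, `|x| <= rho' -> `|f x - g x| <= de) ->
    forall x, `|x| <= rho -> `|iter k (J n) f x - iter k (J n) g x| <= e.
Proof.
move=> e0.
have DC Phi : [set Phi | exists n k, k%:R * h n <= T0 /\ Phi = iter k (J n)] Phi ->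
    slop kappa Phi (expR (w * T0)).
  by move=> [n [k [kT ->]]]; exact: iter_slop_le.
have [rho' [de [de0 H]]] := tight_dist hk M rho (ch_tight HJ T0) DC e0.
exists rho', de; split=> // n k f g kT fC gC fM gM fg.
by apply: H => //; exists n, k.
Qed.

(** On smooth functions this is the previous Lipschitz estimate in time;
    equicontinuity and density extend it, uniformly in n. It applies to G f,
    which is continuous but need not be smooth. *)
Lemma ch_continuity0 g rho e : Ck g -> 0 < e -> exists2 tau, 0 < tau &
  forall n k, k%:R * h n <= tau -> forall x, `|x| <= rho -> `|iter k (J n) g x - g x| <= e.
Proof.
move=> gC e0; have [M gM] := Ck_wbd gC; have e3 : 0 < e / 3 by rewrite divr_gt0.
have [rho' [de [de0 H]]] := ch_tight_dist (M + 1) rho 1 e3.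
have m0 : 0 < Num.min de (e / 3) by rewrite lt_min de0.
have [f [[fS _] fM gf]] := test_fun_dense hk (Num.max rho rho') gC gM m0.
have [C C0 HC] := ch_time fS.
have [c c0 Hc] := weight_lower hk rho.
have K0 : 0 < C * expR w / c + 1 by rewrite ltr_wpDl// divr_ge0 ?mulr_ge0 ?expR_ge0// ltW.
exists (Num.min 1 (e / 3 / (C * expR w / c + 1))); first by rewrite lt_min ltr01 divr_gt0.
move=> n k; rewrite le_min => /andP[k1 k2] x xr.
have kh0 : 0 <= k%:R * h n by rewrite mulr_ge0.
have A1 : `|iter k (J n) g x - iter k (J n) f x| <= e / 3.
  apply: H => //; first exact: Ck_Cb_infty.
    by apply: wbd_le gM; rewrite lerDl.
  by move=> y yr; apply: le_trans (gf y _) _; rewrite ?le_max ?yr ?orbT// ge_min lexx.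
have A2 : `|g x - f x| <= e / 3.
  by apply: le_trans (gf x _) _; rewrite ?le_max ?xr// ge_min lexx orbT.
have A3 : `|iter k (J n) f x - f x| <= e / 3.
  apply: le_trans (wbd_at hk x (HC n k)) _.
  rewrite ler_pdivlMr// in k2; apply: le_trans k2.
  rewrite [leLHS](_ : _ = k%:R * h n * (C * expR (w * (k%:R * h n)) / kappa x)); last first.
    by move: (k%:R * h n) => a; ring.
  rewrite ler_wpM2l//; apply: le_trans (_ : C * expR w / c <= _); last by rewrite lerDl.
  apply: ler_pM.
  - by rewrite mulr_ge0 ?expR_ge0.
  - by rewrite invr_ge0 weight_ge0.
  - by rewrite ler_wpM2l// ler_expR ler_piMr.
  - by rewrite lef_pV2 ?posrE ?weight_gt0// Hc.
by move: A1 A2 A3; rewrite !ler_norml; lra.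
Qed.

(** J^(k+1) f - J^k f lies between plus and minus J^k applied to plus and
    minus h G f up to a small error, and J^k (G f) is still close to G f for
    small times. *)
Lemma ch_derivative f rho e : Cb_infty f -> 0 < e -> exists2 tau, 0 < tau &
  \forall n \near \oo, forall k, k%:R * h n <= tau -> forall x, `|x| <= rho ->
    `|iter k (J n) f x - f x - k%:R * h n * G f x| <= k%:R * h n * e.
Proof.
move=> fS e0; have e2 : 0 < e / 2 by rewrite divr_gt0.
have fC := Ck_Cb_infty hk fS.
have [GC [eps ecv He]] := ch_gen HJ fS.
have [tau1 tau10 H1] := ch_continuity0 rho GC e2.
have [tau2 tau20 H2] := ch_continuity0 rho (CkN GC) e2.
have [c c0 Hc] := weight_lower hk rho.
pose tau := Num.min tau1 tau2.
have ew : 0 < expR (w * tau) := expR_gt0 _.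
have q0 : 0 < e / 2 * c / expR (w * tau) by rewrite divr_gt0 ?mulr_gt0.
exists tau; first by rewrite lt_min tau10.
have /cvgrPdist_le/(_ _ q0) := ecv; apply: filterS => n /=.
rewrite sub0r normrN => en.
pose q := (h n)^-1 *: (J n f - f).
have JC := slop_Ck (ch_slop HJ n) fC.
have dC : Ck (J n f - f) by exact: (CkB hk).
have qC : Ck q by exact: CkZ.
have dq : J n f - f = h n *: q by rewrite /q scalerA divff ?scale1r// gt_eqF.
(* Used for g = G f and g = - G f, with g' the corresponding difference
   quotient of J n. *)
have err g g' k x : Ck g -> Ck g' -> wb (eps n) (g' - g) -> `|x| <= rho ->
    k%:R * h n <= tau -> `|iter k (J n) g x - g x| <= e / 2 -> iter k (J n) g' x <= g x + e.
  move=> gC g'C gg xr kt gx.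
  have := slop_wbd_dist hk (iter_slop_le kt) g'C gC gg.
  move=> /(wbd_at hk x) B.
  have B' : expR (w * tau) * eps n / kappa x <= e / 2.
    rewrite ler_pdivrMr ?weight_gt0//.
    apply: le_trans (_ : e / 2 * c <= _); last by rewrite ler_wpM2l ?(ltW e2)// Hc.
    by rewrite mulrC -ler_pdivlMr// (le_trans (ler_norm _)).
  by move: (le_trans B B') gx; rewrite !ler_norml !fctE3; lra.
move=> k kt x xr; elim: k kt => [|k IH] kt.
  by rewrite !mul0r subrr subr0 normr0.
have kt' : k%:R * h n <= tau by apply: le_trans kt; rewrite ler_wpM2r// ler_nat.
have kt1 : k%:R * h n <= tau1 by apply: le_trans kt' _; rewrite ge_min lexx.
have kt2 : k%:R * h n <= tau2 by apply: le_trans kt' _; rewrite ge_min lexx orbT.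
have Sk := iter_slop n k.
have U1 : iter k (J n) (J n f) x - iter k (J n) f x <= h n * (G f x + e).
  apply: le_trans (slop_sub hk Sk x JC fC) _.
  rewrite dq (slop_hom Sk)// scalefE ler_wpM2l//.
  by apply: err => //; first [exact: He|exact: H1].
have U2 : iter k (J n) f x - iter k (J n) (J n f) x <= h n * (- G f x + e).
  apply: le_trans (slop_sub hk Sk x fC JC) _.
  rewrite -opprB dq -scalerN (slop_hom Sk)//; last exact: CkN.
  rewrite scalefE ler_wpM2l//.
  apply: (err (- G f)) => //; [exact: CkN|exact: CkN| |exact: H2].
  by rewrite -opprD; apply: wbdN; exact: He.
move: (IH kt') U1 U2; rewrite iterSr -natr1 !ler_norml mulrDl mul1r.
move: (k%:R * h n) => s.
by rewrite !mulrDl !mulrDr; lra.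
Qed.

Section UltraLimit.
Context (U : set_system nat).
Hypotheses (UU : UltraFilter U)
  (Uoo : forall A : set nat, (\forall n \near \oo, A n) -> U A).

Definition steps (t : R) n := Num.truncn (t / h n).

Lemma steps_le t n : 0 <= t -> (steps t n)%:R * h n <= t.
Proof.
move=> t0; rewrite -ler_pdivlMr//.
by have /andP[] := truncn_itv (divr_ge0 t0 (h0' n)).
Qed.

Lemma steps_gt t n : t < ((steps t n)%:R + 1) * h n.
Proof. by rewrite -ltr_pdivrMr// natr1 truncnS_gt. Qed.

Definition ulim (t : R) f : F := fun x => lim (iter (steps t n) (J n) f x @[n --> U]).

Lemma ulim_near t f x e : 0 <= t -> Ck f -> 0 < e ->
  \forall n \near U, `|ulim t f x - iter (steps t n) (J n) f x| <= e.
Proof.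
move=> t0 fC e0; have [M fM] := Ck_wbd fC.
have : iter (steps t n) (J n) f x @[n --> U] --> ulim t f x.
  apply: (@ultra_cvg _ _ _ (expR (w * t) * M / kappa x)) => n.
  exact: (wbd_at hk x (slop_wbd (iter_slop_le (steps_le n t0)) fC fM)).
by move=> /cvgrPdist_le; apply.
Qed.

Lemma ulim_approx t f x e : 0 <= t -> Ck f -> 0 < e ->
  exists n, `|ulim t f x - iter (steps t n) (J n) f x| <= e.
Proof. by move=> t0 fC e0; exact: filter_ex (ulim_near x t0 fC e0). Qed.

Lemma ulim_wbd t f M : 0 <= t -> Ck f -> wb M f -> wb (expR (w * t) * M) (ulim t f).
Proof.
move=> t0 fC fM x; rewrite -ler_pdivlMr ?weight_gt0//.
apply: (@le_of_eps R _ _ 1) => e e0; have [n Hn] := ulim_approx x t0 fC e0.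
have := wbd_at hk x (slop_wbd (iter_slop_le (steps_le n t0)) fC fM).
by move: Hn; set b := _ / _; rewrite !ler_norml; lra.
Qed.

Lemma ulim_lip t : 0 <= t ->
  lipop (ulim t) (expR (w * t)) (expR (w' * t)) (L * t * expR (w' * t)).
Proof.
move=> t0; have Ln n := iter_lip_le (steps_le n t0).
split=> [r f M fr fM x|r f fr|r f fr x y]; have fC := Ck_lipb hk fr.
- apply: (@le_of_eps R _ _ 1) => e e0; have [n Hn] := ulim_approx x t0 fC e0.
  have := lipop_sup (Ln n) fr fM x; move: Hn.
  by set b := _ * M; rewrite !ler_norml; lra.
- split=> [x y|x].
    apply: (@le_of_eps R _ _ 2) => e e0.
    have [n [H1 H2]] := filter_ex (filterI (ulim_near x t0 fC e0) (ulim_near y t0 fC e0)).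
    have := (lipop_lip (Ln n) fr).1 x y.
    by move: H1 H2; set a := _ * enorm _; rewrite !ler_norml; lra.
  apply: (@le_of_eps R _ _ 1) => e e0; have [n H1] := ulim_approx x t0 fC e0.
  have := (lipop_lip (Ln n) fr).2 x.
  by move: H1; set a := _ * r; rewrite !ler_norml; lra.
- have tC : Ck (translate x f) := Ck_lipb hk (lipb_translate x fr).
  apply: (@le_of_eps R _ _ 2) => e e0.
  have [n [H1 H2]] := filter_ex (filterI (ulim_near (x + y) t0 fC e0) (ulim_near y t0 tC e0)).
  have := lipop_trans (Ln n) fr x y.
  by move: H1 H2; set a := _ * enorm _; rewrite !ler_norml; lra.
Qed.

Lemma ulim_tight_dist M rho e T0 : 0 < e -> exists rho' de, 0 < de /\
  forall t f g, 0 <= t <= T0 -> Ck f -> Ck g -> wb M f -> wb M g ->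
    (forall x, `|x| <= rho' -> `|f x - g x| <= de) ->
    forall x, `|x| <= rho -> `|ulim t f x - ulim t g x| <= e.
Proof.
move=> e0; have [rho' [de [de0 H]]] := ch_tight_dist M rho T0 e0.
exists rho', de; split=> // t f g /andP[t0 tT] fC gC fM gM fg x xr.
apply: (@le_of_eps R _ _ 2) => e' e'0.
have [n [H1 H2]] := filter_ex (filterI (ulim_near x t0 fC e'0) (ulim_near x t0 gC e'0)).
have := H n (steps t n) f g (le_trans (steps_le n t0) tT) fC gC fM gM fg x xr.
by move: H1 H2; rewrite !ler_norml; lra.
Qed.

(** The limit is taken pointwise, so continuity has to be recovered: for a
    Lipschitz function the limit is Lipschitz, and equicontinuity makes a
    general limit a locally uniform limit of such ones. *)
Lemma ulim_Ck t f : 0 <= t -> Ck f -> Ck (ulim t f).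
Proof.
move=> t0 fC; have [M fM] := Ck_wbd fC; apply/CkP; split; last first.
  by exists (expR (w * t) * M); exact: ulim_wbd.
apply: locally_uniform_continuous => rho e e0.
have [rho' [de [de0 H]]] := ulim_tight_dist (M + 1) rho t e0.
have [g [[gS [r gr]] gM fg]] := test_fun_dense hk rho' fC fM de0.
exists (ulim t g).
  exact: lipschitzE_continuous (lipop_lip (ulim_lip t0) gr).1.
apply: H => //; rewrite ?t0 ?lexx//; first exact: Ck_Cb_infty.
by apply: wbd_le fM; rewrite lerDl.
Qed.

Lemma ulim_slop t : 0 <= t -> slop kappa (ulim t) (expR (w * t)).
Proof.
move=> t0; have Sn n := iter_slop_le (steps_le n t0).
split; first exact: expR_ge0.
- by move=> f; exact: ulim_Ck.
- move=> f g fC gC x; apply: (@le_of_eps R _ _ 3) => e e0.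
  have [n [[H1 H2] H3]] := filter_ex (filterI (filterI (ulim_near x t0 fC e0)
    (ulim_near x t0 gC e0)) (ulim_near x t0 (CkD hk fC gC) e0)).
  have := slop_add (Sn n) fC gC x.
  by move: H1 H2 H3; rewrite !ler_norml; lra.
- move=> a f a0 fC; apply/funext => x; apply/eqP; rewrite -subr_eq0 -normr_le0.
  apply: (@le_of_eps R _ _ (1 + a)) => e e0.
  have [n [H1 H2]] := filter_ex (filterI (ulim_near x t0 fC e0) (ulim_near x t0 (CkZ a fC) e0)).
  rewrite (slop_hom (Sn n))// in H2.
  rewrite (_ : _ - _ = (ulim t (a *: f) x - (a *: iter (steps t n) (J n) f) x) -
    a * (ulim t f x - iter (steps t n) (J n) f x)); last by rewrite !fctE3; ring.
  rewrite add0r mulrDl mul1r; apply: le_trans (ler_normB _ _) _; rewrite lerD//.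
  by rewrite normrM ger0_norm// ler_wpM2l.
- move=> f g fC gC fg x; apply: (@le_of_eps R _ _ 2) => e e0.
  have [n [H1 H2]] := filter_ex (filterI (ulim_near x t0 fC e0) (ulim_near x t0 gC e0)).
  have := slop_mono (Sn n) fC gC fg x.
  by move: H1 H2; rewrite !ler_norml; lra.
- by move=> M f fC fM; exact: ulim_wbd.
Qed.

(** Pointwise convergence of functions with a common Lipschitz constant is
    uniform on boxes. *)
Lemma ulim_unif t r f rho e : 0 <= t -> lipb r f -> 0 < e ->
  \forall n \near U, forall x, `|x| <= rho ->
    `|ulim t f x - iter (steps t n) (J n) f x| <= e.
Proof.
move=> t0 fr e0; have fC := Ck_lipb hk fr; have r0 := lipb_ge0 fr.
pose B := expR (w' * t) * r * d%:R.
have B0 : 0 <= B by rewrite !mulr_ge0 ?expR_ge0.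
have B1 : 0 < B + 1 by rewrite ltr_wpDl.
have e3 : 0 < e / 3 by rewrite divr_gt0.
have near g x y : lipb (expR (w' * t) * r) g -> `|x - y| < e / 3 / (B + 1) ->
    `|g x - g y| <= e / 3.
  move=> gr xy; apply: le_trans (gr.1 x y) _.
  apply: le_trans (_ : B * `|x - y| <= _).
    by rewrite /B -[leRHS]mulrA ler_wpM2l ?mulr_ge0 ?expR_ge0// enorm_le.
  apply: le_trans (_ : (B + 1) * `|x - y| <= _); first by rewrite ler_wpM2r// lerDl.
  by rewrite mulrC -ler_pdivlMr// ltW.
apply: box_cover => x xr; exists (e / 3 / (B + 1)); first by rewrite divr_gt0.
apply: filterS (ulim_near x t0 fC e3) => n Hn y xy.
have H1 := near _ _ _ (lipop_lip (ulim_lip t0) fr) xy.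
have H2 := near _ _ _ (lipop_lip (iter_lip_le (steps_le n t0)) fr) xy.
by move: Hn H1 H2; rewrite !ler_norml; lra.
Qed.

Lemma ulim_time f : Cb_infty f -> exists C, forall t, 0 <= t ->
  wb (C * t * expR (w * t)) (ulim t f - f).
Proof.
move=> fS; have [C C0 HC] := ch_time fS; exists C => t t0 x.
have fC := Ck_Cb_infty hk fS.
rewrite -ler_pdivlMr ?weight_gt0//.
apply: (@le_of_eps R _ _ 1) => e e0; have [n H1] := ulim_approx x t0 fC e0.
have st := steps_le n t0.
have : wb (C * t * expR (w * t)) (iter (steps t n) (J n) f - f).
  apply: wbd_le (HC n (steps t n)); apply: ler_pM.
  - by rewrite !mulr_ge0.
  - exact: expR_ge0.
  - by rewrite ler_wpM2l.
  - exact: expR_wle.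
move=> /(wbd_at hk x); move: H1; set a := C * _ * _ / _.
by rewrite !ler_norml !fctE3; lra.
Qed.

Lemma ulim_gen f rho e : Cb_infty f -> 0 < e -> exists2 tau, 0 < tau &
  forall s, 0 < s < tau -> forall x, `|x| <= rho ->
    `|ulim s f x - f x - s * G f x| <= s * e.
Proof.
move=> fS e0; have fC := Ck_Cb_infty hk fS.
have [tau tau0 Htau] := ch_derivative rho fS e0.
exists tau => // s /andP[s0 st] x xr.
apply: (@le_of_eps R _ _ (1 + `|G f x|)) => q q0.
(* The time k h differs from s by less than one step, which is at most q. *)
have hq : \forall n \near U, h n <= q.
  apply: Uoo; have /cvgrPdist_le/(_ _ q0) := ch_hcvg HJ.
  by apply: filterS => n /=; rewrite sub0r normrN; apply: le_trans; exact: ler_norm.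
have [n [[H1 H2] H3]] := filter_ex (filterI (filterI (ulim_near x (ltW s0) fC q0)
  (Uoo Htau)) hq).
have sl := steps_le n (ltW s0); have sg := steps_gt s n.
have := H2 (steps s n) (le_trans sl (ltW st)) x xr.
set k := (steps s n)%:R * h n in sl *.
have sk : s - k <= q.
  by apply: le_trans H3; rewrite lerBlDl -[X in _ + X]mul1r -mulrDl ltW.
have B : `|(s - k) * G f x| <= q * `|G f x|.
  by rewrite normrM ger0_norm ?subr_ge0// ler_wpM2r.
have ke : k * e <= s * e by rewrite ler_wpM2r// ltW.
move: B; rewrite mulrBl mulrDl mul1r [`|G f x| * q]mulrC.
move: H1 ke; move: (q * `|_|) (s * e) (k * e) (s * _) (k * _) => a1 a2 a3 a4 a5.
by rewrite !ler_norml; lra.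
Qed.

Lemma steps_add s t n : 0 <= s -> 0 <= t ->
  `|(steps (s + t) n)%:R * h n - (steps s n + steps t n)%:R * h n| <= h n + h n.
Proof.
move=> s0 t0.
move: (steps_le n s0) (steps_le n t0) (steps_le n (addr_ge0 s0 t0)).
move: (steps_gt s n) (steps_gt t n) (steps_gt (s + t) n).
by rewrite natrD ler_norml !mulrDl !mul1r; lra.
Qed.

(** The semigroup law holds for the iterates up to the rounding of the numbers
    of steps, which costs O (h) on smooth functions. *)
Lemma ulim_add_test s t g : 0 <= s -> 0 <= t -> test_fun g ->
  ulim (s + t) g = ulim s (ulim t g).
Proof.
move=> s0 t0 [gS [r gr]]; have gC := Ck_lipb hk gr; have [M gM] := Ck_wbd gC.
have st0 : 0 <= s + t by rewrite addr_ge0.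
have tC := ulim_Ck t0 gC.
have [C C0 HC] := ch_time_dist gS.
apply/funext => x; apply/eqP; rewrite -subr_eq0 -normr_le0.
pose K := C * expR (w * (s + t)) * 2 / kappa x.
have K0 : 0 <= K by rewrite divr_ge0 ?weight_ge0// !mulr_ge0// expR_ge0.
apply: (@le_of_eps R _ _ (3 + K)) => e e0; rewrite add0r.
have [rho' [de [de0 Hti]]] := ch_tight_dist (expR (w * t) * M) `|x| s e0.
have hq : \forall n \near U, h n <= e.
  apply: Uoo; have /cvgrPdist_le/(_ _ e0) := ch_hcvg HJ.
  by apply: filterS => n /=; rewrite sub0r normrN; apply: le_trans; exact: ler_norm.
have [n [[[H1 H2] H3] H4]] := filter_ex (filterI (filterI (filterI (ulim_near x st0 gC e0)
  (ulim_near x s0 tC e0)) (ulim_unif rho' t0 gr de0)) hq).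
have JM := slop_wbd (iter_slop_le (steps_le n t0)) gC gM.
have JC := slop_Ck (iter_slop_le (steps_le n t0)) gC.
have B1 : `|iter (steps s n) (J n) (ulim t g) x -
    iter (steps s n) (J n) (iter (steps t n) (J n) g) x| <= e.
  by apply: Hti => //; [exact: steps_le|exact: ulim_wbd].
have B2 : `|iter (steps (s + t) n) (J n) g x -
    iter (steps s n) (J n) (iter (steps t n) (J n) g) x| <= K * e.
  rewrite -iterD.
  have k1 := steps_le n st0.
  have k2 : (steps s n + steps t n)%:R * h n <= s + t.
    by rewrite natrD mulrDl lerD ?steps_le.
  apply: le_trans (wbd_at hk x (HC n _ _ _ k1 k2)) _.
  rewrite [leRHS](_ : _ = C * expR (w * (s + t)) * (2 * e) / kappa x); last first.
    by rewrite /K; ring.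
  apply: ler_wpM2r; first by rewrite invr_ge0 weight_ge0.
  apply: ler_wpM2l; first by rewrite mulr_ge0 ?expR_ge0.
  by apply: le_trans (steps_add n s0 t0) _; move: H4; lra.
rewrite mulrDl; move: H1 H2 B1 B2; rewrite !ler_norml.
by move: (K * e) => a; lra.
Qed.

Lemma ulim_add s t f : 0 <= s -> 0 <= t -> Ck f -> ulim (s + t) f = ulim s (ulim t f).
Proof.
move=> s0 t0 fC; have [M fM] := Ck_wbd fC.
apply/funext => x; apply/eqP; rewrite -subr_eq0 -normr_le0.
apply: (@le_of_eps R _ _ 2) => e e0; rewrite add0r.
have st0 : 0 <= s + t by rewrite addr_ge0.
have st1 : 0 <= s + t <= s + t by rewrite st0 lexx.
have [r1 [d1 [d10 H1]]] := ulim_tight_dist (M + 1) `|x| (s + t) e0.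
have [r2 [d2 [d20 H2]]] := ulim_tight_dist (expR (w * t) * (M + 1)) `|x| s e0.
have [r3 [d3 [d30 H3]]] := ulim_tight_dist (M + 1) r2 t d20.
have m0 : 0 < Num.min d1 d3 by rewrite lt_min d10.
have [g [gT gM fg]] := test_fun_dense hk (Num.max r1 r3) fC fM m0.
have gC : Ck g := Ck_Cb_infty hk gT.1.
have fM1 : wb (M + 1) f by apply: wbd_le fM; rewrite lerDl.
have B1 : `|ulim (s + t) f x - ulim (s + t) g x| <= e.
  apply: H1 => // y yr.
  by apply: le_trans (fg y _) _; rewrite ?le_max ?yr// ge_min lexx.
have B2 : `|ulim s (ulim t f) x - ulim s (ulim t g) x| <= e.
  apply: H2; rewrite ?s0 ?lexx//; [exact: ulim_Ck|exact: ulim_Ck|exact: ulim_wbd|exact: ulim_wbd|].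
  apply: H3; rewrite ?t0 ?lexx// => y yr.
  by apply: le_trans (fg y _) _; rewrite ?le_max ?yr ?orbT// ge_min lexx orbT.
have E := ulim_add_test s0 t0 gT.
by move: B1 B2; rewrite E !ler_norml; lra.
Qed.

Lemma ulim_limit_sg : limit_sg kappa w w' L G ulim.
Proof.
split.
- exact: ulim_slop.
- exact: ulim_lip.
- move=> f fC; apply/funext => x; apply/eqP; rewrite -subr_eq0 -normr_le0.
  apply: (@le_of_eps R _ _ 1) => e e0; have [n] := ulim_approx x (lexx 0) fC e0.
  by rewrite /steps mul0r truncn0 add0r mul1r.
- exact: ulim_add.
- move=> T0 M rho e e0; have e2 : 0 < e / 2 by rewrite divr_gt0.
  have [rho' [de [de0 H]]] := ch_tight HJ T0 M rho e2.
  exists rho', de; split=> // _ f [t /andP[t0 tT] ->] fC f0 fM fd x xr.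
  have [n Hn] := ulim_approx x t0 fC e2.
  have := H (iter (steps t n) (J n)) f _ fC f0 fM fd x xr.
  have D : exists n0 k, k%:R * h n0 <= T0 /\ iter (steps t n) (J n) = iter k (J n0).
    by exists n, (steps t n); split=> //; apply: le_trans (steps_le n t0) tT.
  by move=> /(_ D); move: Hn; rewrite ler_norml; lra.
- exact: ulim_time.
- by move=> f rho e fS e0; exact: ulim_gen.
Qed.

End UltraLimit.

(** If the iterates failed to converge, some ultrafilter would contain the
    indices of failure; its limit is a semigroup with the same derivative,
    hence equal to T. *)
Lemma chernoff_cvg T (t : R) f (k : nat -> nat) (rho e : R) : moderate kappa ->
  limit_sg kappa w w' L G T -> 0 <= t -> Ck f ->
  (k n)%:R * h n @[n --> \oo] --> t -> 0 < e ->
  \forall n \near \oo, forall x, `|x| <= rho -> `|T t f x - iter (k n) (J n) f x| <= e.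
Proof.
move=> hmod HT t0 fC kt e0; have [M fM] := Ck_wbd fC.
have e4 : 0 < e / 4 by rewrite divr_gt0.
have DT Phi : [set Phi | exists2 s, 0 <= s <= t & Phi = T s] Phi -> slop kappa Phi (expR (w * t)).
  by move=> [s /andP[s0 st] ->]; exact: (ls_slop_le hk _ HT).
have [r1 [d1 [d10 H1]]] := tight_dist hk (M + 1) rho (ls_tight HT t) DT e4.
have [r2 [d2 [d20 H2]]] := ch_tight_dist (M + 1) rho (t + 1) e4.
have m0 : 0 < Num.min d1 d2 by rewrite lt_min d10.
have [g [[gS [r gr]] gM fg]] := test_fun_dense hk (Num.max r1 r2) fC fM m0.
have gC := Ck_lipb hk gr.
have fM1 : wb (M + 1) f by apply: wbd_le fM; rewrite lerDl.
have B1 x : `|x| <= rho -> `|T t f x - T t g x| <= e / 4.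
  apply: (H1 (T t)) => //; first by exists t; rewrite ?t0 ?lexx.
  by move=> y yr; apply: le_trans (fg y _) _; rewrite ?le_max ?yr// ge_min lexx.
have [c c0 Hc] := weight_lower hk rho.
have [C C0 HC] := ch_time_dist gS.
pose K := C * expR (w * (t + 1)); have K0 : 0 <= K by rewrite mulr_ge0 ?expR_ge0.
pose q : R := Num.min 1 (e / 4 * c / (K + 1) / 2).
have K1 : 0 < K + 1 by rewrite ltr_wpDl.
have q0 : 0 < q by rewrite lt_min ltr01 !divr_gt0// mulr_gt0.
have hq : \forall n \near \oo, h n <= q.
  have /cvgrPdist_le/(_ _ q0) := ch_hcvg HJ.
  by apply: filterS => n /=; rewrite sub0r normrN; apply: le_trans; exact: ler_norm.
have kq : \forall n \near \oo, `|t - (k n)%:R * h n| <= q.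
  by move/cvgrPdist_le : kt; apply.
have good : \forall n \near \oo, forall x, `|x| <= rho ->
    `|T t g x - iter (steps t n) (J n) g x| <= e / 4.
  apply: contrapT => bad.
  have [|V [VU Voo VB]] := @ultra_extension (~` [set n | forall x, `|x| <= rho ->
      `|T t g x - iter (steps t n) (J n) g x| <= e / 4]).
    by move=> H; apply: bad; apply: filterS H => n /= /contrapT.
  have HV := ulim_limit_sg VU Voo.
  have E : T t g = ulim V t g := limit_sg_unique hk w0 w'0 L0 hmod HV HT t0 gC.
  have := ulim_unif VU rho t0 gr e4; rewrite -E => HU.
  by have [n []] := filter_ex (filterI VB HU).
apply: filterS2 good (filterI hq kq) => n Hg [Hh Hk] x xr.
have q1 : q <= 1 by rewrite ge_min lexx.
have kT : (k n)%:R * h n <= t + 1.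
  by move: Hk; rewrite ler_norml => /andP[Hk _]; move: Hk q1; lra.
have sT : (steps t n)%:R * h n <= t + 1.
  by apply: le_trans (steps_le n t0) _; rewrite lerDl.
have B2 : `|iter (k n) (J n) f x - iter (k n) (J n) g x| <= e / 4.
  apply: H2 => // y yr.
  by apply: le_trans (fg y _) _; rewrite ?le_max ?yr ?orbT// ge_min lexx orbT.
have B3 : `|iter (k n) (J n) g x - iter (steps t n) (J n) g x| <= e / 4.
  apply: le_trans (wbd_at hk x (HC n _ _ _ kT sT)) _; rewrite -/K.
  rewrite ler_pdivrMr ?weight_gt0//.
  apply: le_trans (_ : e / 4 * c <= _); last by rewrite ler_wpM2l ?(ltW e4)// Hc.
  have D : `|(k n)%:R * h n - (steps t n)%:R * h n| <= 2 * q.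
    move: Hk Hh (steps_le n t0) (ltW (steps_gt t n)); rewrite mulrDl mul1r !ler_norml.
    by lra.
  apply: le_trans (ler_wpM2l K0 D) _.
  apply: le_trans (_ : (K + 1) * (2 * q) <= _).
    by rewrite ler_wpM2r ?lerDl// mulr_ge0// ltW.
  have : q <= e / 4 * c / (K + 1) / 2 by rewrite ge_min lexx orbT.
  by rewrite ler_pdivlMr// ler_pdivlMr// (_ : (K + 1) * (2 * q) = q * 2 * (K + 1)); [|ring].
have := B1 x xr; move: (Hg x xr) B2 B3; rewrite !ler_norml; lra.
Qed.

End Fixed.
End Chernoff.

(** * Limit semigroups in the mixed topology *)

Section MixedTopology.
Context (R : realType) (d : nat) (kappa : 'rV[R]_d -> R).
Local Notation E := 'rV[R]_d.
Local Notation F := (E -> R).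
Implicit Types (x y z : E) (f g : F) (Phi : F -> F).
Hypothesis hk : bounded_continuous_weight kappa.
Local Notation Ck := (Ckappa kappa).
Local Notation wb := (wbd kappa).

Lemma family_cvg_box (u : nat -> F) f :
  (forall rho e, 0 < e -> \forall n \near \oo, forall x, `|x| <= rho -> `|f x - u n x| <= e) ->
  {family compact, u @ \oo --> f}.
Proof.
move=> H; apply/fam_cvgP => K cK.
have [rho Krho] := compact_sub_box cK.
move=> P /uniform_nbhs[V [entV VP]].
move: entV; rewrite -entourage_from_ballE => -[e /= e0 eV].
have e2 : 0 < e / 2 by rewrite divr_gt0.
apply: filterS (H rho _ e2) => n Hn; apply: VP => x /Krho xr; apply: eV => /=.
rewrite /ball/=; apply: le_lt_trans (Hn x xr) _.
by rewrite ltr_pdivrMr// ltr_pMr// ltr1n.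
Qed.

Lemma mixed_cvg_at u f x : mixed_cvg kappa u f -> u n x @[n --> \oo] --> f x.
Proof.
move=> [_ _ _ /fam_cvgP /(_ [set x])]; rewrite uniform_set1; apply.
exact: compact_set1.
Qed.

Lemma mixed_cvg_unique u f g : mixed_cvg kappa u f -> mixed_cvg kappa u g -> f = g.
Proof.
move=> uf ug; apply/funext => x.
by rewrite -(cvg_lim _ (mixed_cvg_at (x := x) uf))// -(cvg_lim _ (mixed_cvg_at (x := x) ug)).
Qed.

(** The norm bound is only required eventually: finitely many functions of
    C_kappa have a common bound. *)
Lemma mixed_cvgI u f B : (forall n, Ck (u n)) -> Ck f ->
  (\forall n \near \oo, wb B (u n)) ->
  (forall rho e, 0 < e -> \forall n \near \oo, forall x, `|x| <= rho -> `|f x - u n x| <= e) ->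
  mixed_cvg kappa u f.
Proof.
move=> uC fC [N _ HN] H; split=> //; last exact: family_cvg_box.
have [B' HB'] : exists B', forall n, (n < N)%N -> wb B' (u n).
  elim: N {HN} => [|N [B' IH]]; first by exists 0.
  have [M HM] := Ck_wbd (uC N); exists (Num.max B' M) => n.
  rewrite ltnS leq_eqVlt => /orP[/eqP ->|nN].
    by apply: wbd_le HM; rewrite le_max lexx orbT.
  by apply: wbd_le (IH n nN); rewrite le_max lexx.
apply/ereal_lt_pinfty_le; exists (Num.max B B').
apply: ge_ereal_sup => _ [n _ <-]; apply/wnorm_leP.
have [nN|Nn] := ltnP n N.
  by apply: wbd_le (HB' n nN); rewrite le_max lexx orbT.
by apply: wbd_le (HN n Nn); rewrite le_max lexx.
Qed.

Section FromLimit.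
Context (w w' L : R) (G : F -> F) (T : R -> F -> F).
Hypotheses (w0 : 0 <= w) (HT : limit_sg kappa w w' L G T).

Lemma ls_continuity0 f rho e : Ck f -> 0 < e -> exists2 tau, 0 < tau &
  forall t, 0 <= t <= tau -> forall x, `|x| <= rho -> `|f x - T t f x| <= e.
Proof.
move=> fC e0; have [M fM] := Ck_wbd fC; have e3 : 0 < e / 3 by rewrite divr_gt0.
have DT Phi : [set Phi | exists2 s, 0 <= s <= 1 & Phi = T s] Phi -> slop kappa Phi (expR (w * 1)).
  by move=> [s /andP[s0 st] ->]; exact: (ls_slop_le hk _ HT).
have [rho' [de [de0 H]]] := tight_dist hk (M + 1) rho (ls_tight HT 1) DT e3.
have m0 : 0 < Num.min de (e / 3) by rewrite lt_min de0.
have [g [[gS _] gM fg]] := test_fun_dense hk (Num.max rho rho') fC fM m0.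
have gC := Ck_Cb_infty hk gS.
have [C C0 HC] := ls_time_le w0 HT gS.
have [c c0 Hc] := weight_lower hk rho.
pose K := C * expR (w * 1); have K0 : 0 <= K by rewrite mulr_ge0 ?expR_ge0.
have K1 : 0 < K + 1 by rewrite ltr_wpDl.
exists (Num.min 1 (e / 3 * c / (K + 1))); first by rewrite lt_min ltr01 divr_gt0// mulr_gt0.
move=> t /andP[t0]; rewrite le_min => /andP[t1 tK] x xr.
have t01 : 0 <= t <= 1 by rewrite t0.
have A1 : `|T t f x - T t g x| <= e / 3.
  apply: H => //; first by exists t.
    by apply: wbd_le fM; rewrite lerDl.
  by move=> y yr; apply: le_trans (fg y _) _; rewrite ?le_max ?yr ?orbT// ge_min lexx.
have A2 : `|f x - g x| <= e / 3.
  by apply: le_trans (fg x _) _; rewrite ?le_max ?xr// ge_min lexx orbT.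
have A3 : `|T t g x - g x| <= e / 3.
  apply: le_trans (wbd_at hk x (HC t 1 t01)) _.
  rewrite ler_pdivrMr ?weight_gt0//.
  apply: le_trans (_ : e / 3 * c <= _); last by rewrite ler_wpM2l ?(ltW e3)// Hc.
  rewrite ler_pdivlMr// in tK; apply: le_trans tK.
  by rewrite mulrC ler_wpM2l// lerDl.
by move: A1 A2 A3; rewrite !ler_norml; lra.
Qed.

Lemma null_seq_le (s : nat -> R) (tau : R) : s n @[n --> \oo] --> (0 : R) -> 0 < tau ->
  \forall n \near \oo, s n < tau.
Proof.
move=> s0 tau0; have t2 : 0 < tau / 2 by rewrite divr_gt0.
have /cvgrPdist_le/(_ _ t2) := s0.
apply: filterS => n /=; rewrite sub0r normrN => H.
apply: le_lt_trans (le_trans (ler_norm _) H) _.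
by rewrite ltr_pdivrMr// ltr_pMr// ltr1n.
Qed.

(** Continuity from above is Dini's theorem followed by equicontinuity. *)
Lemma limit_sg_semigroup : sc_convex_monotone_semigroup kappa T.
Proof.
split.
- by move=> t f t0; exact: (slop_Ck (ls_slop HT t0)).
- move=> t t0 l f g /andP[l0 l1] fC gC x; have ST := ls_slop HT t0.
  apply: le_trans (slop_add ST (CkZ l fC) (CkZ (1 - l) gC) x) _.
  by rewrite !(slop_hom ST)// subr_ge0.
- by move=> t t0; exact: (slop_mono (ls_slop HT t0)).
- move=> t u t0 uC u0 x; have ST := ls_slop HT t0.
  have u_ge0 n y : 0 <= u n y.
    have [uy ucv] := u0 y; rewrite -(cvg_lim _ ucv)//.
    by apply: nonincreasing_cvgn_ge => //; apply/cvg_ex; exists 0.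
  have T0 n y : 0 <= T t (u n) y.
    have <- : T t 0 y = 0 by rewrite (slop0 ST).
    by apply: (slop_mono ST) => //; exact: Ck0.
  split.
    move=> n m nm; apply: (slop_mono ST) => // y.
    by have [uy _] := u0 y; exact: uy.
  apply/cvgrPdist_le => e e0; have [M uM] := Ck_wbd (uC 0).
  have [rho' [de [de0 H]]] := ls_tight HT t M `|x| e0.
  have un n : continuous (u n) by have [] := uC n.
  apply: filterS (decreasing_unif_box rho' un u0 de0) => n Hn.
  rewrite sub0r normrN ger0_norm//.
  apply: (H (T t) (u n)) => //; first by exists t; rewrite ?t0 ?lexx.
  apply: (wbd_dom hk _ uM) => y; rewrite !ger0_norm//.
  by have [uy _] := u0 y; exact: uy.
- by move=> f fC; exact: (ls_0 HT).
- by move=> s t f s0 t0 fC; exact: (ls_add HT).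
- move=> r t r0 t0; apply/ereal_lt_pinfty_le; exists (expR (w * t) * `|r|).
  apply: ge_ereal_sup => _ [s /= + <-]; rewrite in_itv/= => /andP[s0 st].
  have [rC rM] := Ck_invweight hk r.
  by apply/wnorm_leP; exact: (slop_wbd (ls_slop_le hk w0 HT s0 st)).
- move=> f fC s s0 scv; have [M fM] := Ck_wbd fC.
  have sl n : slop kappa (T (s n)) (expR (w * s n)) by apply: (ls_slop HT); exact: ltW.
  apply: (@mixed_cvgI _ _ (expR (w * 1) * M)) => //.
  + by move=> n; exact: (slop_Ck (sl n)).
  + apply: filterS (null_seq_le scv ltr01) => n sn1.
    exact: (slop_wbd (ls_slop_le hk w0 HT (ltW (s0 n)) (ltW sn1))).
  + move=> rho e e0; have [tau tau0 H] := ls_continuity0 rho fC e0.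
    apply: filterS (null_seq_le scv tau0) => n sn x; apply: H.
    by rewrite !ltW.
Qed.

Lemma limit_sg_generator f : Cb_infty f -> Ck (G f) ->
  is_generator_value kappa T f (G f).
Proof.
move=> fS GC s s0 scv; have fC := Ck_Cb_infty hk fS.
have [C C0 HC] := ls_time_le w0 HT fS.
have sl n : slop kappa (T (s n)) (expR (w * s n)) by apply: (ls_slop HT); exact: ltW.
have s0' n : 0 <= s n by rewrite ltW.
apply: (@mixed_cvgI _ _ (C * expR (w * 1))) => //.
- by move=> n; apply: CkZ; apply: (CkB hk) => //; exact: (slop_Ck (sl n)).
- apply: filterS (null_seq_le scv ltr01) => n sn1.
  have sn : 0 <= s n <= 1 by rewrite s0' ltW.
  have -> : C * expR (w * 1) = `|(s n)^-1| * (C * expR (w * 1) * s n).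
    by rewrite ger0_norm ?invr_ge0// mulrCA mulVf ?mulr1// gt_eqF.
  by apply: wbdZ; exact: HC.
move=> rho e e0; have [tau tau0 H] := ls_gen HT rho fS e0.
apply: filterS (null_seq_le scv tau0) => n sn x xr.
have sn' : 0 < s n < tau by rewrite s0.
have := H (s n) sn' x xr.
move=> Hx; rewrite -(ler_pM2l (s0 n)); apply: le_trans Hx.
rewrite -[X in X * `|_|](gtr0_norm (s0 n)) -normrM !fctE3 mulrBr distrC.
have -> : s n * ((s n)^-1 * (T (s n) f x - f x)) = T (s n) f x - f x.
  by rewrite mulrA divff ?mul1r// gt_eqF.
by [].
Qed.

Lemma limit_sg_generatorE f : Cb_infty f -> Ck (G f) ->
  dom (generator kappa T) f /\ generator kappa T f = G f.
Proof.
move=> fS GC; have H := limit_sg_generator fS GC.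
split; first by split; [exact: Ck_Cb_infty|exists (G f)].
rewrite /generator/=; case: xgetP => [g _ /= Hg|]; last by move=> /(_ (G f)).
have s0 n : 0 < n.+1%:R^-1 :> R by rewrite invr_gt0.
have scv : n.+1%:R^-1 @[n --> \oo] --> (0 : R) by exact: cvg_harmonic.
exact: mixed_cvg_unique (Hg _ s0 scv) (H _ s0 scv).
Qed.

End FromLimit.
End MixedTopology.

(** * Laws of mean one on the integers *)

Section WeightedSums.
Context {R : realType}.
Implicit Types (q a : nat -> R) (b c B : R).

(** This decay makes the weighted sums converge for every sequence of at most
    geometric growth, such as the iterates of a bounded operator at a point. *)
Definition factorial_weights q := forall k, `|q k| <= (k`!%:R)^-1.

Definition wsum q a : R := limn (series (fun k => q k * a k)).

Definition geo_bounded B b a := forall k, `|a k| <= B * b ^+ k.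

(** The remainder of the exponential series, which dominates the remainder of
    every weighted sum below. *)
Definition exp_tail b n : R := expR b - series (exp_coeff b) n.

Lemma exp_tail_small b B e : 0 < e -> exists n, B * exp_tail b n <= e.
Proof.
move=> e0; have B0 : 0 < `|B| + 1 by rewrite ltr_wpDl.
have /cvgrPdist_le/(_ _ (divr_gt0 e0 B0))/filter_ex[n Hn] :
    series (exp_coeff b) n @[n --> \oo] --> expR b by exact: is_cvg_series_exp_coeff.
exists n; rewrite ler_pdivlMr// mulrC in Hn; apply: le_trans Hn.
apply: le_trans (ler_norm _) _; rewrite normrM ler_wpM2r//.
by rewrite lerDl.
Qed.

Section Bounded.
Context (q : nat -> R).
Hypothesis hq : factorial_weights q.

Lemma wterm_le B b a k : 0 <= B -> geo_bounded B b a -> `|q k * a k| <= B * exp_coeff b k.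
Proof.
move=> B0 ab; rewrite normrM exp_coeffE mulrCA; apply: ler_pM => //; exact: hq.
Qed.

Lemma exp_coeff_geo0 B b a k : 0 <= B -> geo_bounded B b a -> 0 <= B * exp_coeff b k.
Proof. by move=> B0 ab; apply: le_trans (wterm_le k B0 ab). Qed.

Lemma cvg_Bexp B b : series (fun k => B * exp_coeff b k) n @[n --> \oo] --> B * expR b.
Proof.
have -> : series (fun k => B * exp_coeff b k) = (fun n => B * series (exp_coeff b) n).
  by apply/funext => n; rewrite /series/= mulr_sumr.
by apply: cvgMr; exact: is_cvg_series_exp_coeff.
Qed.

Lemma cvg_wsum B b a : 0 <= B -> geo_bounded B b a ->
  series (fun k => q k * a k) n @[n --> \oo] --> wsum q a.
Proof.
move=> B0 ab; apply: normed_cvg.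
apply: (@series_le_cvg _ _ (fun k => B * exp_coeff b k)).
- by move=> n; exact: normr_ge0.
- by move=> n; exact: exp_coeff_geo0 ab.
- by move=> n; exact: wterm_le.
- by apply/cvg_ex; eexists; exact: cvg_Bexp.
Qed.

Lemma wsum_tail B b a n : 0 <= B -> geo_bounded B b a ->
  `|wsum q a - series (fun k => q k * a k) n| <= B * exp_tail b n.
Proof.
move=> B0 ab; set d := fun k => _.
pose e := fun k => B * exp_coeff b k.
have de k : `|d k| <= e k by exact: wterm_le.
have cd : series d n @[n --> \oo] --> wsum q a by exact: cvg_wsum ab.
have ce : series e n @[n --> \oo] --> B * expR b by exact: cvg_Bexp.
have sE m : series e m = B * series (exp_coeff b) m by rewrite /series/= mulr_sumr.
(* With e the dominating terms, the partial sums of e + d and of e - d both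
   increase. *)
have step (s : R) : `|s| <= 1 -> (fun m => series e m + s * series d m) @ \oo --> B * expR b + s * wsum q a /\
    nondecreasing_seq (fun m => series e m + s * series d m).
  move=> s1; split; first by apply: cvgD => //; exact: cvgMr.
  apply/nondecreasing_seqP => m; rewrite /series/= !big_nat_recr//= mulrDr addrACA lerDl.
  rewrite -lerBlDr sub0r; apply: le_trans (ler_norm _) _; rewrite normrN normrM.
  by apply: le_trans (de m); rewrite ler_piMl.
have H (s : R) : `|s| <= 1 -> series e n + s * series d n <= B * expR b + s * wsum q a.
  move=> /step[sc sn]; rewrite -(cvg_lim _ sc)//.
  by apply: nondecreasing_cvgn_le => //; apply/cvg_ex; eexists; exact: sc.
have s1 : `|1 : R| <= 1 by rewrite normr1.
have s2 : `|- 1 : R| <= 1 by rewrite normrN1.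
move: (H 1 s1) (H (- 1) s2); rewrite sE /exp_tail mulrBr ler_norml !mul1r !mulN1r.
by lra.
Qed.

Lemma wsum_le B b a : 0 <= B -> geo_bounded B b a -> `|wsum q a| <= B * expR b.
Proof.
move=> B0 ab; have := wsum_tail 0 B0 ab.
by rewrite /exp_tail /series/= !big_geq// !subr0.
Qed.

Lemma wsumD x B b a a' : 0 <= B -> geo_bounded B b a -> geo_bounded B b a' ->
  wsum q (fun k => x * a k + a' k) = x * wsum q a + wsum q a'.
Proof.
move=> B0 ab ab'; apply: cvg_lim => //.
have -> : series (fun k => q k * (x * a k + a' k)) =
    (fun n => x * series (fun k => q k * a k) n + series (fun k => q k * a' k) n).
  apply/funext => n; rewrite /series/= mulr_sumr -big_split/=.
  by apply: eq_bigr => k _; ring.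
by apply: cvgD; [apply: cvgMr; exact: cvg_wsum ab|exact: cvg_wsum ab'].
Qed.

End Bounded.

Lemma factorial_weights_abs q : factorial_weights q -> factorial_weights (fun k => `|q k|).
Proof. by move=> hq k; rewrite normr_id. Qed.

Lemma wsum_mono q B b a a' : factorial_weights q -> (forall k, 0 <= q k) -> 0 <= B ->
  geo_bounded B b a -> geo_bounded B b a' -> (forall k, a k <= a' k) ->
  wsum q a <= wsum q a'.
Proof.
move=> hq q0 B0 ab ab' aa; apply: lim_series_le => [||k].
- by apply/cvg_ex; eexists; exact: cvg_wsum ab.
- by apply/cvg_ex; eexists; exact: cvg_wsum ab'.
- by rewrite ler_wpM2l.
Qed.

Lemma wsum_abs q B b a a' : factorial_weights q -> 0 <= B ->
  geo_bounded B b a' -> (forall k, `|a k| <= a' k) ->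
  `|wsum q a| <= wsum (fun k => `|q k|) a'.
Proof.
move=> hq B0 ab' aa.
have ab : geo_bounded B b a by move=> k; apply: le_trans (aa k) (le_trans (ler_norm _) (ab' k)).
have c1 := cvg_wsum hq B0 ab.
have c2 := cvg_wsum (factorial_weights_abs hq) B0 ab'.
have H (s : R) : `|s| <= 1 -> s * wsum q a <= wsum (fun k => `|q k|) a'.
  move=> s1; apply: (ler_cvg_to (cvgMr c1) c2); apply: nearW => n.
  rewrite /series/= mulr_sumr; apply: ler_sum => k _.
  apply: le_trans (ler_norm _) _; rewrite !normrM mulrA; apply: ler_pM => //.
  by rewrite ler_piMl.
rewrite ler_norml lerNl; apply/andP; split.
  by rewrite -mulN1r H// normrN1.
by rewrite -[wsum q a]mul1r H// normr1.
Qed.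

Lemma geo_exp b : 0 <= b -> geo_bounded 1 b (fun k => b ^+ k).
Proof. by move=> b0 k; rewrite mul1r ger0_norm ?exprn_ge0. Qed.

Lemma geo_mulrn b : 0 <= b -> geo_bounded 1 (2 * b) (fun k => k%:R * b ^+ k).
Proof.
move=> b0 k; rewrite mul1r ger0_norm ?mulr_ge0 ?exprn_ge0// exprMn.
by rewrite ler_wpM2r ?exprn_ge0// -natrX ler_nat ltnW// ltn_expl.
Qed.

Lemma geo_mulrn2 b : 0 <= b -> geo_bounded 1 (4 * b) (fun k => k%:R * k%:R * b ^+ k).
Proof.
move=> b0 k; rewrite mul1r ger0_norm ?mulr_ge0 ?exprn_ge0// exprMn.
rewrite ler_wpM2r ?exprn_ge0// -natrM -natrX ler_nat (_ : 4 = 2 * 2)%N// expnMn.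
by rewrite leq_mul// ltnW// ltn_expl.
Qed.

Lemma geo_bounded_le B b B' b' a : B <= B' -> 0 <= b -> b <= b' -> 0 <= B ->
  geo_bounded B b a -> geo_bounded B' b' a.
Proof.
move=> BB b0 bb B0 ab k; apply: le_trans (ab k) _.
by apply: ler_pM; rewrite ?exprn_ge0// lerXn2r ?nnegrE// (le_trans b0).
Qed.

(** Weights of a probability law on the integers with mean 1: one step of an
    implicit scheme (a point mass at 1) and the exponential (a Poisson law) are
    the two instances. *)
Record unit_mean q : Prop := {
  um_weights : factorial_weights q;
  um_ge0 : forall k, 0 <= q k;
  um_mass : wsum q (fun=> 1) = 1;
  um_mean : wsum q (fun k => k%:R) = 1;
  um_exp : forall c, 0 <= c -> wsum q (fun k => c ^+ k) <= expR (c - 1) }.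

Definition dirac_weights (s : R) k : R := if k == 1%N then s else 0.
Definition poisson_weights (s : R) k : R := expR (- 1) * s ^+ k / k`!%:R.

Lemma dirac_weightsP s : `|s| <= 1 -> factorial_weights (dirac_weights s).
Proof.
move=> s1 k; rewrite /dirac_weights; case: eqP => [->|_]; last by rewrite normr0 invr_ge0.
by rewrite invr1.
Qed.

Lemma dirac_wsum s a : wsum (dirac_weights s) a = s * a 1%N.
Proof.
apply: cvg_lim => //; apply: cvg_near_cst.
exists 2%N => // n /= n2; apply/eqP; rewrite /series/= -(subnKC n2).
rewrite big_nat_recl// big_nat_recl//= big1 ?addr0; last by move=> i _; rewrite mul0r.
by rewrite /dirac_weights/= mul0r add0r.
Qed.

Lemma dirac_unit_mean : unit_mean (dirac_weights 1).
Proof.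
split; rewrite ?dirac_wsum ?mulr1//.
- by apply: dirac_weightsP; rewrite normr1.
- by move=> k; rewrite /dirac_weights; case: eqP.
- move=> c c0; rewrite dirac_wsum mul1r expr1.
  by have := expR_ge1Dx (c - 1); rewrite addrC subrK.
Qed.

Lemma poisson_weightsP s : `|s| <= 1 -> factorial_weights (poisson_weights s).
Proof.
move=> s1 k; rewrite /poisson_weights normrM normfV [X in _ * X^-1]ger0_norm// ler_piMl ?invr_ge0//.
rewrite normrM normrX ger0_norm ?expR_ge0//; apply: mulr_ile1.
- exact: expR_ge0.
- by rewrite exprn_ge0.
- by rewrite -[leRHS]expR0 ler_expR lerN10.
- by rewrite exprn_ile1.
Qed.

Lemma poisson_wsum_exp c : wsum (poisson_weights 1) (fun k => c ^+ k) = expR (c - 1).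
Proof.
apply: cvg_lim => //.
have -> : (fun k => poisson_weights 1 k * c ^+ k) = (fun k => expR (- 1) * exp_coeff c k).
  apply/funext => k; rewrite exp_coeffE /poisson_weights expr1n; ring.
by rewrite addrC expRD; exact: cvg_Bexp.
Qed.

Lemma poisson_unit_mean : unit_mean (poisson_weights 1).
Proof.
have h1 : factorial_weights (poisson_weights 1) by apply: poisson_weightsP; rewrite normr1.
split=> //.
- by move=> k; rewrite /poisson_weights expr1n mulr1 divr_ge0 ?expR_ge0.
- have H := poisson_wsum_exp 1; rewrite subrr expR0 in H; rewrite -[RHS]H.
  by congr wsum; apply/funext => k; rewrite expr1n.
- apply: cvg_lim => //; rewrite -cvg_shiftS.
  have -> : (fun n => series (fun k => poisson_weights 1 k * k%:R) n.+1) =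
      series (fun k => expR (- 1) * exp_coeff 1 k).
    apply/funext => n; rewrite /series/= big_nat_recl// mulr0 add0r.
    apply: eq_bigr => k _; rewrite exp_coeffE /poisson_weights !expr1n factS natrM.
    by field; rewrite !pnatr_eq0 -lt0n fact_gt0 nat1r pnatr_eq0.
  have E : expR (- 1) * expR 1 = 1 :> R by rewrite -expRD addNr expR0.
  by have := @cvg_Bexp (expR (- 1)) 1; rewrite E.
- by move=> c _; rewrite poisson_wsum_exp.
Qed.

End WeightedSums.

(** * Mixtures of powers of an operator *)

Section Mixtures.
Context (R : realType) (d : nat) (kappa : 'rV[R]_d -> R).
Local Notation E := 'rV[R]_d.
Local Notation F := (E -> R).
Implicit Types (x y z : E) (f g : F) (Q : F -> F).
Hypothesis hk : bounded_continuous_weight kappa.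
Local Notation Ck := (Ckappa kappa).
Local Notation wb := (wbd kappa).

Definition linear_on_Ck Q := forall (a : R) f g, Ck f -> Ck g ->
  Q (a *: f + g) = a *: Q f + Q g.

Lemma slop_linear Q c : 0 <= c -> (forall f, Ck f -> Ck (Q f)) -> linear_on_Ck Q ->
  monotone_on_Ckappa kappa Q -> (forall M f, Ck f -> wb M f -> wb (c * M) (Q f)) ->
  slop kappa Q c.
Proof.
move=> c0 QC Ql Qm Qw; split=> //.
  by move=> f g fC gC x; have := Ql 1 f g fC gC; rewrite !scale1r => ->.
have Q0 : Q 0 = 0.
  have := Ql (- 1) 0 0 (Ck0 _) (Ck0 _).
  by rewrite scaler0 addr0 scaleN1r addNr.
by move=> a f a0 fC; have := Ql a f 0 fC (Ck0 _); rewrite !addr0 Q0 addr0.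
Qed.

Section Linear.
Context (Q : F -> F).
Hypotheses (Ql : linear_on_Ck Q) (QC : forall f, Ck f -> Ck (Q f)).

Lemma linear_on_CkB f g : Ck f -> Ck g -> Q (f - g) = Q f - Q g.
Proof.
move=> fC gC; have := Ql (- 1) gC fC.
by rewrite !scaleN1r [- g + f]addrC [- Q g + Q f]addrC.
Qed.

Lemma linear_on_CkZ a f : Ck f -> Q (a *: f) = a *: Q f.
Proof.
move=> fC; have Q0 : Q 0 = 0.
  have := Ql (- 1) (Ck0 _) (Ck0 _).
  by rewrite scaler0 addr0 scaleN1r addNr.
by have := Ql a fC (Ck0 _); rewrite !addr0 Q0 addr0.
Qed.

Lemma iter_Ck k f : Ck f -> Ck (iter k Q f).
Proof. by move=> fC; elim: k => //= k IH; exact: QC. Qed.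

Lemma iter_linear k : linear_on_Ck (iter k Q).
Proof.
elim: k => // k IH a f g fC gC; rewrite !iterS IH// Ql//; exact: iter_Ck.
Qed.

End Linear.

Definition mix (q : nat -> R) Q f : F := fun x => wsum q (fun k => iter k Q f x).

Section Mix.
Context (Q : F -> F) (c : R).
Hypotheses (HQ : slop kappa Q c) (Ql : linear_on_Ck Q).
Let c0 : 0 <= c := slop_ge0 HQ.
Let QC := slop_Ck HQ.

Lemma iter_geo M f x : Ck f -> wb M f ->
  geo_bounded (M / kappa x) c (fun k => iter k Q f x).
Proof.
move=> fC fM k; have := wbd_at hk x (slop_wbd (slop_iter hk k HQ) fC fM).
by rewrite -mulrA mulrC.
Qed.

Lemma iter_geo_ge0 M f x : wb M f -> 0 <= M / kappa x.
Proof. by move=> fM; rewrite divr_ge0 ?weight_ge0// (wbd_ge0 hk fM). Qed.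

Lemma iter_geo2 f g x y : Ck f -> Ck g -> exists B, [/\ 0 <= B,
  geo_bounded B c (fun k => iter k Q f x) & geo_bounded B c (fun k => iter k Q g y)].
Proof.
move=> fC gC; have [M fM] := Ck_wbd fC; have [M' gM] := Ck_wbd gC.
have B1 := iter_geo_ge0 x fM; have B2 := iter_geo_ge0 y gM.
exists (M / kappa x + M' / kappa y); split; first exact: addr_ge0.
  by apply: (geo_bounded_le _ c0 (lexx c) B1); [rewrite lerDl|exact: iter_geo].
by apply: (geo_bounded_le _ c0 (lexx c) B2); [rewrite lerDr|exact: iter_geo].
Qed.

Section AnyWeights.
Context (q : nat -> R).
Hypothesis hq : factorial_weights q.

Lemma mix_wbd M f : Ck f -> wb M f -> wb (expR c * M) (mix q Q f).
Proof.
move=> fC fM x; rewrite -ler_pdivlMr ?weight_gt0//.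
apply: le_trans (wsum_le hq (iter_geo_ge0 x fM) (iter_geo x fC fM)) _.
by rewrite mulrC mulrA.
Qed.

Lemma mix_partial_tail M f n : Ck f -> wb M f ->
  wb (M * exp_tail c n) (mix q Q f - \sum_(k < n) q k *: iter k Q f).
Proof.
move=> fC fM x; rewrite -ler_pdivlMr ?weight_gt0//.
have := wsum_tail hq n (iter_geo_ge0 x fM) (iter_geo x fC fM).
rewrite mulrAC !fctE3 fct_sumE /series/= big_mkord; exact.
Qed.

Lemma mix_Ck f : Ck f -> Ck (mix q Q f).
Proof.
move=> fC; have [M fM] := Ck_wbd fC; apply: (Ck_closed hk) => e e0.
have [n Hn] := exp_tail_small c M e0.
exists (\sum_(k < n) q k *: iter k Q f).
  by apply: (Ck_sum hk) => k; apply: CkZ; exact: iter_Ck.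
exact: wbd_le Hn (mix_partial_tail n fC fM).
Qed.

Lemma mix_linear : linear_on_Ck (mix q Q).
Proof.
move=> a f g fC gC; apply/funext => x.
have [B [B0 fB gB]] := iter_geo2 x x fC gC.
rewrite !fctE3 -(wsumD hq a B0 fB gB); congr wsum.
by apply/funext => k; rewrite (iter_linear Ql QC).
Qed.

Lemma iter_dominated k f g x : Ck f -> Ck g -> (forall y, `|f y| <= g y) ->
  `|iter k Q f x| <= iter k Q g x.
Proof.
move=> fC gC fg; have HQk := slop_iter hk k HQ.
rewrite -[iter k Q f x]subr0.
have <- : iter k Q 0 x = 0 by rewrite (slop0 HQk).
by apply: (slop_dist hk HQk) => //; [exact: Ck0|move=> y; rewrite subr0].
Qed.

Lemma mix_dominated f g x : Ck f -> Ck g -> (forall y, `|f y| <= g y) ->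
  `|mix q Q f x| <= mix (fun k => `|q k|) Q g x.
Proof.
move=> fC gC fg; have [B [B0 fB gB]] := iter_geo2 x x fC gC.
by apply: (wsum_abs hq B0 gB) => k; exact: iter_dominated.
Qed.

Lemma mix_lip b l r f x y : lipop Q c b l -> c <= b -> 1 <= b -> 0 <= l -> lipb r f ->
  `|mix q Q f x - mix q Q f y| <= expR b * r * enorm (x - y).
Proof.
move=> LQ cb b1 l0 fr; have fC := Ck_lipb hk fr; have r0 := lipb_ge0 fr.
have [B [B0 fB gB]] := iter_geo2 y x fC fC.
rewrite addrC -mulN1r -(wsumD hq (- 1) B0 fB gB) [expR b * r]mulrC mulrAC.
apply: (wsum_le hq) => [|k]; first by rewrite mulr_ge0 ?enorm_ge0.
rewrite mulN1r addrC.
rewrite (_ : r * enorm (x - y) * b ^+ k = b ^+ k * r * enorm (x - y)); last by ring.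
exact: (lipop_lip (lipop_iter hk k HQ LQ cb b1 l0) fr).1.
Qed.

End AnyWeights.

Lemma mix_slop_ge0 q : factorial_weights q -> (forall k, 0 <= q k) ->
  slop kappa (mix q Q) (expR c).
Proof.
move=> hq q0; apply: slop_linear; first exact: expR_ge0.
- by move=> f; exact: mix_Ck.
- exact: mix_linear.
- move=> f g fC gC fg x; have [B [B0 fB gB]] := iter_geo2 x x fC gC.
  by apply: (wsum_mono hq q0 B0 fB gB) => k; exact: (slop_mono (slop_iter hk k HQ)).
- by move=> M f; exact: mix_wbd.
Qed.

Lemma iter_weight (v : F) m f k : (forall m f, Ck f -> wbd v m f -> wbd v (c * m) (Q f)) ->
  Ck f -> wbd v m f -> wbd v (c ^+ k * m) (iter k Q f).
Proof.
move=> Qv fC fm; elim: k => [|k IH]; first by rewrite mul1r.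
by rewrite exprS -mulrA; apply: Qv => //; exact: (iter_Ck QC).
Qed.

Lemma iter_weight_geo (v : F) m f x : (forall x, 0 < v x) ->
  (forall m f, Ck f -> wbd v m f -> wbd v (c * m) (Q f)) ->
  Ck f -> wbd v m f -> 0 <= m / v x /\ geo_bounded (m / v x) c (fun k => iter k Q f x).
Proof.
move=> v0 Qv fC fm; have m0 : 0 <= m by apply: le_trans (fm 0); rewrite mulr_ge0// ltW.
split; first by rewrite divr_ge0// ltW.
move=> k; rewrite (_ : m / v x * c ^+ k = c ^+ k * m / v x); last by ring.
by rewrite ler_pdivlMr//; exact: iter_weight.
Qed.

Lemma mix_weight_any q (v : F) m f : factorial_weights q -> (forall x, 0 < v x) ->
  (forall m f, Ck f -> wbd v m f -> wbd v (c * m) (Q f)) -> Ck f -> wbd v m f ->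
  wbd v (expR c * m) (mix q Q f).
Proof.
move=> hq v0 Qv fC fm x; have [mv g] := iter_weight_geo x v0 Qv fC fm.
by rewrite -ler_pdivlMr// -mulrA mulrC; exact: wsum_le.
Qed.

(** Q^(k+1) eta is at most Q^k eta + Q^k (m / kappa), and m / kappa has norm
    m. *)
Lemma iter_barrier (eta : F) (m C : R) k x : Ck eta -> 0 <= m -> c <= C -> 1 <= C ->
  (forall y, Q eta y <= eta y + m / kappa y) ->
  iter k Q eta x <= eta x + m / kappa x * (k%:R * C ^+ k).
Proof.
move=> eC m0 cC C1 Qe; have C0 : 0 <= C := le_trans ler01 C1.
elim: k => [|k IH]; first by rewrite mul0r mulr0 addr0.
rewrite iterSr; have HQk := slop_iter hk k HQ.
have [mC mM] := Ck_invweight hk m.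
apply: le_trans (slop_mono HQk (QC eC) (CkD hk eC mC) Qe x) _.
apply: le_trans (slop_add HQk eC mC x) _.
have H := wbd_at hk x (slop_wbd HQk mC mM).
apply: le_trans (lerD IH (le_trans (ler_norm _) H)) _.
have kC : c ^+ k <= C ^+ k by apply: lerXn2r; rewrite ?nnegrE.
have kC1 : C ^+ k <= C ^+ k.+1 by rewrite exprS ler_peMl// exprn_ge0.
have mk : 0 <= m / kappa x by rewrite divr_ge0 ?weight_ge0.
rewrite -addrA lerD2l (ger0_norm m0) -natr1.
apply: le_trans (_ : m / kappa x * (k%:R * C ^+ k) + m / kappa x * C ^+ k <= _).
  by rewrite lerD2l -mulrA mulrC ler_wpM2l.
by rewrite -mulrDr ler_wpM2l// mulrDl mul1r lerD// ler_wpM2l.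
Qed.

Lemma mix_barrier q (eta : F) (m C : R) x : factorial_weights q -> (forall k, 0 <= q k) ->
  Ck eta -> 0 <= m -> c <= C -> 1 <= C -> 0 <= eta x ->
  (forall y, Q eta y <= eta y + m / kappa y) ->
  mix q Q eta x <= eta x * wsum q (fun=> 1) + m / kappa x * expR (2 * C).
Proof.
move=> hq q0 eC m0 cC C1 e0 Qe; have C0 : 0 <= C := le_trans ler01 C1.
have [M eM] := Ck_wbd eC; have M0 := iter_geo_ge0 x eM.
have mk : 0 <= m / kappa x by rewrite divr_ge0 ?weight_ge0.
have C21 : 1 <= 2 * C by apply: le_trans C1 _; rewrite ler_peMl// ler1n.
have g1 : geo_bounded 1 (2 * C) (fun=> 1 : R).
  by move=> k; rewrite normr1 mul1r exprn_ege1.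
have g2 : geo_bounded 1 (2 * C) (fun k => k%:R * C ^+ k) by exact: geo_mulrn.
pose B := M / kappa x + eta x + m / kappa x.
have B0 : 0 <= B by rewrite !addr_ge0.
have g3 : geo_bounded B (2 * C) (fun k => eta x * 1 + m / kappa x * (k%:R * C ^+ k)).
  move=> k; apply: le_trans (ler_normD _ _) _; rewrite normrM [X in _ + X]normrM (ger0_norm e0) (ger0_norm mk).
  apply: le_trans (lerD (ler_wpM2l e0 (g1 k)) (ler_wpM2l mk (g2 k))) _.
  rewrite mul1r -mulrDl ler_wpM2r ?exprn_ge0 ?mulr_ge0//.
  by rewrite /B -addrA lerDr.
have g4 : geo_bounded B (2 * C) (fun k => iter k Q eta x).
  apply: (geo_bounded_le _ c0 _ M0 (iter_geo x eC eM)).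
    by rewrite /B -addrA lerDl addr_ge0.
  by apply: le_trans cC _; rewrite ler_peMl// ler1n.
have gm : geo_bounded (m / kappa x) (2 * C) (fun k => m / kappa x * (k%:R * C ^+ k)).
  by move=> k; rewrite normrM (ger0_norm mk) ler_wpM2l// -[leRHS]mul1r.
apply: le_trans (wsum_mono hq q0 B0 g4 g3 _) _.
  by move=> k; rewrite mulr1; exact: iter_barrier.
pose B' := 1 + m / kappa x; have B'0 : 0 <= B' by rewrite addr_ge0.
have C20 : 0 <= 2 * C := le_trans ler01 C21.
have g1' : geo_bounded B' (2 * C) (fun=> 1 : R).
  by apply: geo_bounded_le g1; rewrite ?lexx// lerDl.
have gm' : geo_bounded B' (2 * C) (fun k => m / kappa x * (k%:R * C ^+ k)).
  by apply: geo_bounded_le gm; rewrite ?lexx// lerDr.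
rewrite (wsumD hq _ B'0 g1' gm') lerD2l.
by apply: le_trans (ler_norm _) (wsum_le hq mk gm).
Qed.

Section UnitMean.
Context (q : nat -> R).
Hypothesis Hq : unit_mean q.
Let hq := um_weights Hq.

(** Sharper than the bound valid for all factorial weights: the exponent is b
    - 1, which is O (h) for b = 1 + O (h). *)
Lemma um_le B b a : 0 <= B -> 0 <= b -> geo_bounded B b a ->
  `|wsum q a| <= expR (b - 1) * B.
Proof.
move=> B0 b0 ab; have gb := geo_exp b0.
have g0 : geo_bounded 1 b (fun=> 0 : R) by move=> k; rewrite normr0 mul1r exprn_ge0.
have gB : geo_bounded B b (fun k => B * b ^+ k).
  by move=> k; rewrite ger0_norm// mulr_ge0// exprn_ge0.
apply: le_trans (wsum_abs hq B0 gB ab) _.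
have -> : (fun k => `|q k|) = q by apply/funext => k; rewrite ger0_norm ?(um_ge0 Hq).
have -> : (fun k => B * b ^+ k) = (fun k => B * b ^+ k + 0) by apply/funext => k; rewrite addr0.
rewrite (wsumD hq B ler01 gb g0) mulrC.
have -> : wsum q (fun=> 0) = 0.
  have z : geo_bounded 0 b (fun=> 0 : R) by move=> k; rewrite normr0 mul0r.
  by have := wsum_le hq (lexx 0) z; rewrite mul0r normr_le0 => /eqP.
by rewrite addr0 ler_wpM2r// (um_exp Hq).
Qed.

Lemma mix_slop : slop kappa (mix q Q) (expR (c - 1)).
Proof.
apply: slop_linear; first exact: expR_ge0.
- by move=> f; exact: mix_Ck.
- exact: mix_linear.
- move=> f g fC gC fg x; have [B [B0 fB gB]] := iter_geo2 x x fC gC.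
  apply: (wsum_mono hq (um_ge0 Hq) B0 fB gB) => k.
  exact: (slop_mono (slop_iter hk k HQ)).
- move=> M f fC fM x; rewrite -ler_pdivlMr ?weight_gt0// -mulrA.
  exact: (um_le (iter_geo_ge0 x fM) c0 (iter_geo x fC fM)).
Qed.

Lemma mix_lipop b l : lipop Q c b l -> c <= b -> 1 <= b -> 0 <= l ->
  lipop (mix q Q) (expR (c - 1)) (expR (c - 1) + l * expR (2 * b)) (l * expR (2 * b)).
Proof.
move=> LQ cb b1 l0; have b0 : 0 <= b := le_trans ler01 b1.
have LQk k := lipop_iter hk k HQ LQ cb b1 l0.
apply: (lipop_of hk mix_slop); rewrite ?expR_ge0 ?mulr_ge0 ?expR_ge0//.
  move=> r f M fr fM x; have M0 : 0 <= M := le_trans (normr_ge0 _) (fM 0).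
  apply: um_le => // k; rewrite mulrC; exact: (lipop_sup (LQk k) fr fM).
move=> r f fr x y; have r0 := lipb_ge0 fr; have fC := Ck_lipb hk fr.
have tC := Ck_lipb hk (lipb_translate x fr).
have [B [B0 tB fB]] := iter_geo2 y (x + y) tC fC.
rewrite addrC -mulN1r -(wsumD hq (- 1) B0 tB fB).
rewrite (_ : l * expR (2 * b) * r * enorm x = l * r * enorm x * expR (2 * b)); last by ring.
apply: (wsum_le hq) => [|k]; first by rewrite !mulr_ge0 ?enorm_ge0.
rewrite mulN1r addrC; apply: le_trans (lipop_trans (LQk k) fr x y) _.
have H := geo_mulrn b0 k; rewrite mul1r ger0_norm ?mulr_ge0 ?exprn_ge0// in H.
rewrite (_ : k%:R * l * b ^+ k * r * enorm x = l * r * enorm x * (k%:R * b ^+ k)); last by ring.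
by rewrite ler_wpM2l// !mulr_ge0 ?enorm_ge0.
Qed.

Lemma mix_weight (v : F) m f : (forall x, 0 < v x) ->
  (forall m f, Ck f -> wbd v m f -> wbd v (c * m) (Q f)) -> Ck f -> wbd v m f ->
  wbd v (expR (c - 1) * m) (mix q Q f).
Proof.
move=> v0 Qv fC fm x; have [mv g] := iter_weight_geo x v0 Qv fC fm.
by rewrite -ler_pdivlMr// -mulrA; exact: um_le.
Qed.

(** Q^k f - f is h times the sum of the Q^j g over j < k, and each Q^j g
    differs from g by O (j del); hence the square of k. *)
Lemma iter_consistency (h C del : R) f g k : 0 < h -> c <= C -> 1 <= C -> Ck f -> Ck g ->
  Q f - f = h *: g -> wb del (Q g - g) ->
  wb (h * del * (k%:R * k%:R * C ^+ k)) (iter k Q f - f - (k%:R * h) *: g).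
Proof.
move=> h0 cC C1 fC gC fg gd; have C0 : 0 <= C := le_trans ler01 C1.
have d0 := wbd_ge0 hk gd; have h0' := ltW h0.
have HQk k := slop_iter hk k HQ.
have kC j : c ^+ j <= C ^+ j by apply: lerXn2r; rewrite ?nnegrE.
have kC1 j : C ^+ j <= C ^+ j.+1 by rewrite exprS ler_peMl// exprn_ge0.
have gj j : wb (del * (j%:R * C ^+ j)) (iter j Q g - g).
  elim: j => [|j IH]; first by rewrite subrr mul0r mulr0 => x; rewrite normr0 mul0r.
  rewrite iterSr -(subrKA (iter j Q g)).
  apply: wbd_le (wbdD hk (slop_wbd_dist hk (HQk j) (QC gC) gC gd) IH).
  rewrite mulrC -mulrDr ler_wpM2l// -natr1 addrC mulrDl mul1r.
  by rewrite lerD ?ler_wpM2l// (le_trans (kC j)).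
elim: k => [|k IH].
  by rewrite subrr !mul0r scale0r subrr mulr0 => x; rewrite normr0 mul0r.
have E : iter k.+1 Q f - f - (k.+1%:R * h) *: g =
    h *: (iter k Q g - g) + (iter k Q f - f - (k%:R * h) *: g).
  rewrite iterSr -[Q f](subrK f) fg (iter_linear Ql QC)//.
  apply/funext => x; rewrite !fctE3 -natr1; ring.
rewrite E; have := wbdZ h (gj k); rewrite ger0_norm// => gk.
apply: wbd_le (wbdD hk gk IH).
rewrite -mulrA -mulrDr -!mulrA ler_wpM2l// -mulrDr ler_wpM2l//.
have kk : 0 <= k%:R :> R by [].
apply: le_trans (_ : k%:R * C ^+ k.+1 + k%:R * (k%:R * C ^+ k.+1) <= _).
  by rewrite lerD ?ler_wpM2l.
have CS : 0 <= C ^+ k.+1 by rewrite exprn_ge0.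
rewrite -natr1 -subr_ge0 (_ : _ - _ = (k%:R + 1) * C ^+ k.+1); last by ring.
by rewrite mulr_ge0// addr_ge0.
Qed.

(** Mass 1 and mean 1 cancel the terms f and k h g of the expansion of Q^k f,
    leaving the error term. *)
Lemma mix_consistency (h C del : R) f : 0 < h -> c <= C -> 1 <= C -> Ck f ->
  let g := h^-1 *: (Q f - f) in wb del (Q g - g) ->
  wb (expR (4 * C) * del) (h^-1 *: (mix q Q f - f) - g).
Proof.
move=> h0 cC C1 fC g gd x; have C0 : 0 <= C := le_trans ler01 C1.
have gC : Ck g by apply: CkZ; apply: (CkB hk) => //; exact: QC.
have fg : Q f - f = h *: g by rewrite /g scalerA divff ?scale1r// gt_eqF.
have d0 := wbd_ge0 hk gd.
have H k : `|iter k Q f x - f x - k%:R * h * g x| <= h * del / kappa x * (4 * C) ^+ k.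
  have := wbd_at hk x (iter_consistency k h0 cC C1 fC gC fg gd).
  rewrite !fctE3 => /le_trans; apply.
  rewrite mulrAC ler_wpM2l ?divr_ge0 ?mulr_ge0 ?weight_ge0 ?(ltW h0)//.
  have := geo_mulrn2 C0 k; rewrite mul1r; apply: le_trans; exact: ler_norm.
have hd : 0 <= h * del / kappa x by rewrite divr_ge0 ?weight_ge0// mulr_ge0// ltW.
have [M fM] := Ck_wbd fC.
pose b := 4 * C + 1 + c.
have b1 : 1 <= b by rewrite /b -addrA addrC -addrA lerDl addr_ge0 ?mulr_ge0.
have b0 : 0 <= b := le_trans ler01 b1.
pose B := M / kappa x + 1; have MK := iter_geo_ge0 x fM.
have B0 : 0 <= B by rewrite addr_ge0.
have g1 : geo_bounded 1 b (fun=> 1 : R).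
  by move=> k; rewrite normr1 mul1r exprn_ege1.
have g2 : geo_bounded 1 b (fun k => k%:R : R).
  apply: (@geo_bounded_le _ 1 2) => //; first by rewrite /b; move: C1 c0; lra.
  by move=> k; rewrite ger0_norm// mul1r -natrX ler_nat ltnW// ltn_expl.
have g3 : geo_bounded (M / kappa x) b (fun k => iter k Q f x).
  apply: geo_bounded_le (iter_geo x fC fM) => //.
  by rewrite /b lerDr addr_ge0// mulr_ge0.
have widen B' a : 0 <= B' -> B' <= B -> geo_bounded B' b a -> geo_bounded B b a.
  by move=> ? ?; exact: geo_bounded_le.
have B1 : 1 <= B by rewrite lerDr.
have BM : M / kappa x <= B by rewrite lerDl.
have g4 : geo_bounded (B + `|h * g x|) b (fun k => - (h * g x) * k%:R + iter k Q f x).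
  move=> k; apply: le_trans (ler_normD _ _) _; rewrite addrC mulrDl lerD//.
    exact: widen MK BM g3 k.
  by rewrite normrM normrN ler_wpM2l// -[leRHS]mul1r; exact: g2.
have B2 : 0 <= B + `|h * g x| by rewrite addr_ge0.
have g1' : geo_bounded (B + `|h * g x|) b (fun=> 1 : R).
  by apply: geo_bounded_le g1 => //; apply: le_trans B1 _; rewrite lerDl.
have E : wsum q (fun k => - f x * 1 + (- (h * g x) * k%:R + iter k Q f x)) =
    - f x + (- (h * g x) + mix q Q f x).
  rewrite (wsumD hq _ B2 g1' g4) (um_mass Hq) mulr1.
  by rewrite (wsumD hq _ B0 (widen _ _ ler01 B1 g2) (widen _ _ MK BM g3)) (um_mean Hq) mulr1.
have H' : `|mix q Q f x - f x - h * g x| <= h * del / kappa x * expR (4 * C).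
  rewrite (_ : _ - _ = - f x + (- (h * g x) + mix q Q f x)); last by ring.
  rewrite -E; apply: (wsum_le hq hd) => k; apply: le_trans (H k).
  by rewrite le_eqVlt; apply/orP; left; apply/eqP; congr `|_|; ring.
rewrite -ler_pdivlMr ?weight_gt0// -(ler_pM2l h0) -[X in X * `|_|](gtr0_norm h0) -normrM.
rewrite (_ : h * _ = mix q Q f x - f x - h * g x); last first.
  by rewrite !fctE3; field; rewrite gt_eqF.
by apply: le_trans H' _; rewrite le_eqVlt; apply/orP; left; apply/eqP; ring.
Qed.

End UnitMean.
End Mix.
End Mixtures.

(** * Suprema of families and equicontinuity *)

Section Psup.
Context (R : realType) (d : nat) (Theta : Type).
Local Notation E := 'rV[R]_d.
Local Notation F := (E -> R).
Hypothesis hT : inhabited Theta.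
Implicit Types (P : Theta -> F).

Lemma psup_le P x c : (forall th, P th x <= c) -> psup P x <= c.
Proof.
move=> H; have [th] := hT; apply: ge_sup; first by exists (P th x), th.
by move=> _ [t _ <-].
Qed.

Lemma le_psup P x c th : (forall th, P th x <= c) -> P th x <= psup P x.
Proof. by move=> H; apply: ub_le_sup; [exists c => _ [t _ <-]|exists th]. Qed.

Lemma psup_norm P x c : (forall th, `|P th x| <= c) -> `|psup P x| <= c.
Proof.
move=> H; have H' th : P th x <= c := le_trans (ler_norm _) (H th).
rewrite ler_norml psup_le// andbT; have [th] := hT.
by apply: le_trans (le_psup th H'); move: (H th); rewrite ler_norml => /andP[].
Qed.

(** The a priori bound b keeps the suprema finite. *)
Lemma psup_dist P P' x x' b c : (forall th, `|P th x| <= b) -> (forall th, `|P' th x'| <= b) ->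
  (forall th, `|P th x - P' th x'| <= c) -> `|psup P x - psup P' x'| <= c.
Proof.
move=> Pb Pb' H.
have H1 th : P th x <= b := le_trans (ler_norm _) (Pb th).
have H2 th : P' th x' <= b := le_trans (ler_norm _) (Pb' th).
rewrite ler_norml lerNl opprB !lerBlDr; apply/andP; split; apply: psup_le => th.
  have := le_psup th H1; move: (H th); rewrite ler_norml; lra.
by have := le_psup th H2; move: (H th); rewrite ler_norml; lra.
Qed.

Lemma psup_affine_dist P P' x (a h b b' e : R) : 0 < h ->
  (forall th, P th x <= b) -> (forall th, P' th x <= b') ->
  (forall th, `|h^-1 * (P th x - a) - P' th x| <= e) ->
  `|h^-1 * (psup P x - a) - psup P' x| <= e.
Proof.
move=> h0 Pb Pb' H; rewrite ler_norml; apply/andP; split.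
  rewrite lerBrDr -lerBrDl opprK; apply: psup_le => th.
  have : h^-1 * (P th x - a) <= h^-1 * (psup P x - a).
    by rewrite ler_wpM2l ?invr_ge0 ?(ltW h0)// lerD2r (le_psup th Pb).
  by move: (H th); rewrite ler_norml; lra.
rewrite lerBlDr ler_pdivrMl// lerBlDr; apply: psup_le => th.
rewrite -lerBlDr -ler_pdivrMl//.
by have := le_psup th Pb'; move: (H th); rewrite ler_norml; lra.
Qed.

End Psup.

Section Tightness.
Context (R : realType) (d : nat) (kappa : 'rV[R]_d -> R).
Local Notation E := 'rV[R]_d.
Local Notation F := (E -> R).
Implicit Types (x y z : E) (f g eta : F) (Phi : F -> F).
Hypothesis hk : bounded_continuous_weight kappa.
Local Notation Ck := (Ckappa kappa).
Local Notation wb := (wbd kappa).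
Context (Theta : Type) (A : Theta -> partial_op R d) (omega : R).

(** The cut-off hypothesis provides such functions that vanish at a given
    point and dominate a multiple of 1 / kappa off a compact set. *)
Definition barrier (e : R) eta := [/\ Ck eta, forall y, 0 <= eta y &
  forall th, dom (A th) eta /\ wb e (A th eta)].

(** All weights invariant under the scaled resolvents are quantified over
    because the auxiliary weight of the hypothesis is one of them, whereas the
    class of operators with this property is closed under powers, mixtures and
    suprema. *)
Definition respects_weights C Phi := forall v : F, (forall x, 0 < v x) ->
  (forall lam th f m, omega < lam -> Ck f -> wbd v m f ->
     wbd v m ((lam - omega) *: resolvent (A th) lam f)) ->
  forall m f, Ck f -> wbd v m f -> wbd v (C * m) (Phi f).

Definition respects_barriers C Phi := forall e eta, 0 <= e -> barrier e eta ->
  forall y, Phi eta y <= C * (eta y + e / kappa y).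

(** A common form of the two alternative hypotheses: under the first,
    operators with this property are equicontinuous thanks to the weights;
    under the second, thanks to the barriers. *)
Record controlled (C : R) Phi : Prop := {
  ct_slop : slop kappa Phi C;
  ct_weights : respects_weights C Phi;
  ct_barriers : respects_barriers C Phi }.

(** A function bounded for kappa and small on a large box is small for the
    auxiliary weight, which is negligible against kappa at infinity; this
    smallness is preserved, and the auxiliary weight is bounded below on
    boxes. *)
Lemma tight_weight D C : cond_weight kappa A omega -> (forall Phi, D Phi -> controlled C Phi) ->
  tight kappa D.
Proof.
move=> [v [hv vk vR]] DC M rho e e0.
have v0 := weight_gt0 hv.
have hvR lam th f m : omega < lam -> Ck f -> wbd v m f ->
    wbd v m ((lam - omega) *: resolvent (A th) lam f).
  by move=> ol fC; move: m; apply/wnorm_homo; exact: vR.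
have [c c0 Hc] := weight_lower hv rho; have [vb vb0 Hvb] := weight_bound hv.
have C1 : 0 < `|C| + 1 by rewrite ltr_wpDl.
pose m := e * c / (`|C| + 1); have m0 : 0 < m by rewrite divr_gt0// mulr_gt0.
have M1 : 0 < `|M| + 1 by rewrite ltr_wpDl.
have [rho' Hrho'] := vk _ (divr_gt0 m0 M1).
exists rho', (m / vb); split; first exact: divr_gt0.
move=> Phi f DP fC f0 fM fd x xr; have [SP WP _] := DC _ DP.
have C0 := slop_ge0 SP.
have fm : wbd v m f.
  move=> y; rewrite ger0_norm//; have [yr|yr] := leP `|y| rho'.
    rewrite -(divfK (lt0r_neq0 vb0) m); apply: ler_pM => //; first exact: ltW.
    exact: fd.
  have H := Hrho' y (lt_le_trans yr (norm_le_enorm y)).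
  have k0 := weight_gt0 hk y.
  rewrite ger0_norm ?divr_ge0 ?ltW// in H.
  rewrite (_ : f y * v y = f y * kappa y * (v y / kappa y)); last by field; rewrite gt_eqF.
  have fy : f y * kappa y <= `|M|.
    by apply: le_trans (ler_norm M); have := fM y; rewrite ger0_norm.
  apply: le_trans (_ : `|M| * (m / (`|M| + 1)) <= _).
    apply: ler_pM => //; last exact: ltW.
      by rewrite mulr_ge0// ltW.
    by rewrite divr_ge0// ltW.
  by rewrite mulrCA ger_pMr// ler_pdivrMr// mul1r lerDl.
have := WP v v0 hvR m f fC fm x => H.
have : Phi f x * v x <= C * m by apply: le_trans H; rewrite ler_wpM2r ?ler_norm// ltW.
rewrite -ler_pdivlMr// => /le_trans; apply; rewrite ler_pdivrMr//.
apply: le_trans (_ : e * c <= _); last by rewrite ler_wpM2l ?Hc// ltW.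
rewrite /m mulrCA ger_pMr ?mulr_gt0// ler_pdivrMr// mul1r.
by apply: le_trans (ler_norm C) _; rewrite lerDl.
Qed.

(** A function bounded by M / kappa and small on a large box lies below 2 M /
    kappa times (1 - zeta_x) plus a small multiple of 1 / kappa; the operators
    hardly raise this barrier, which vanishes at x. *)
Lemma tight_cutoff D C : cond_cutoff kappa A -> (forall Phi, D Phi -> controlled C Phi) ->
  tight kappa D.
Proof.
move=> HA DC M rho e e0.
have [c c0 Hc] := weight_lower hk rho; have [kb kb0 Hkb] := weight_bound hk.
have C1 : 0 < `|C| + 1 by rewrite ltr_wpDl.
pose m := e * c / (2 * (`|C| + 1)); have m0 : 0 < m by rewrite divr_gt0 ?mulr_gt0.
pose e1 : R := Num.min 2^-1 m; have e10 : 0 < e1 by rewrite lt_min invr_gt0 ltr0n.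
have r0 : 0 <= 2 * `|M| by rewrite mulr_ge0.
have [zeta [Kt [cK HZ]]] := HA e1 (2 * `|M|) _ e10 r0 (compact_box (rho := rho)).
have [rho' Hrho'] := compact_sub_box cK.
exists rho', (m / kb); split; first exact: divr_gt0.
move=> Phi f DP fC f0 fM fd x xr; have [SP _ BP] := DC _ DP.
have C0 := slop_ge0 SP.
have [zc [z01 zx] zK zD zA] := HZ x xr.
set eta : F := fun y => _ in zD zA.
have [rC rM] := Ck_invweight hk (2 * `|M|).
have eta0 y : 0 <= eta y.
  by have /andP[_ z1] := z01 y; rewrite mulr_ge0 ?subr_ge0// divr_ge0 ?weight_ge0.
have etaC : Ck eta.
  apply/CkP; split.
    move=> y; apply: (@continuousM _ _ (fun y => 2 * `|M| / kappa y) (fun y => 1 - zeta x y)).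
      by have [cc _] := rC; exact: cc.
    exact: (continuousB (@cst_continuous _ _ (1 : R) y) (zc y)).
  exists `|2 * `|M| |; apply: (wbd_dom hk _ rM) => y.
  have /andP[z0 z1] := z01 y.
  rewrite normrM ler_piMr// ger0_norm ?subr_ge0//.
  by rewrite gerBl.
have bar : barrier e1 eta.
  split=> // th; split; first exact: zD.
  apply/wnorm_leP; apply: le_trans zA; apply: ereal_sup_ubound; by exists th.
have [mC mM] := Ck_invweight hk m.
have fle y : f y <= eta y + m / kappa y.
  have k0 := weight_gt0 hk y.
  have [yr|yr] := leP `|y| rho'.
    apply: le_trans (fd y yr) _; apply: ler_wpDl => //.
    by rewrite ler_wpM2l ?(ltW m0)// lef_pV2 ?posrE.
  apply: ler_wpDr; first by rewrite divr_ge0 ?ltW.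
  (* Off the box zeta is at most 1/2, so that 2 M (1 - zeta) is at least M. *)
  have z2 : zeta x y <= 2^-1.
    apply: le_trans (zK y _) _; last by rewrite ge_min lexx.
    by move=> /Hrho' /= H; move: yr; rewrite ltNge H.
  have fy : f y <= `|M| / kappa y.
    by rewrite ler_pdivlMr//; apply: le_trans (ler_norm M); have := fM y; rewrite ger0_norm.
  apply: le_trans fy _; rewrite /eta mulrAC ler_wpM2r ?invr_ge0 ?(ltW k0)//.
  have M0 : 0 <= `|M| by [].
  have : `|M| * (2 * (1 - zeta x y)) >= `|M| * 1 by apply: ler_wpM2l => //; lra.
  by rewrite mulr1 (_ : 2 * `|M| * _ = `|M| * (2 * (1 - zeta x y))); [|ring].
apply: le_trans (slop_mono SP fC (CkD hk etaC mC) fle x) _.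
apply: le_trans (slop_add SP etaC mC x) _.
have B1 := BP e1 eta (ltW e10) bar x.
have B2 := le_trans (ler_norm _) (wbd_at hk x (slop_wbd SP mC mM)).
have ex : eta x = 0 by rewrite /eta zx subrr mulr0.
rewrite ex add0r in B1.
apply: le_trans (lerD B1 B2) _; rewrite (ger0_norm (ltW m0)) mulrA -mulrDl -mulrDr.
rewrite ler_pdivrMr ?weight_gt0//.
apply: le_trans (_ : e * c <= _); last by rewrite ler_wpM2l ?Hc// ltW.
apply: le_trans (_ : (`|C| + 1) * (m + m) <= _).
  apply: ler_pM => //; first by rewrite addr_ge0// ltW.
    by apply: le_trans (ler_norm C) _; rewrite lerDl.
  by rewrite lerD2r ge_min lexx orbT.
by rewrite le_eqVlt; apply/orP; left; apply/eqP; rewrite /m; field; rewrite gt_eqF.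
Qed.

Lemma tight_controlled D C : cond_weight kappa A omega \/ cond_cutoff kappa A ->
  (forall Phi, D Phi -> controlled C Phi) -> tight kappa D.
Proof. by move=> [] H; [exact: tight_weight|exact: tight_cutoff]. Qed.

End Tightness.

(** * The exponential series of a difference operator *)

Section ExpDifferences.
Context {R : realType}.
Implicit Types (a : nat -> R) (b : nat -> nat -> R).

(** Comparison with the series of exp (2 c), whose terms are larger by the
    factor 2^k. *)
Lemma exp_tail_geo (c : R) n : 0 <= c -> exp_tail c n <= 2^-1 ^+ n * expR (2 * c).
Proof.
move=> c0; rewrite /exp_tail lerBlDr.
have h2 : 0 <= 2^-1 ^+ n :> R by rewrite exprn_ge0.
have cv := is_cvg_series_exp_coeff c.
apply: (limr_le cv); exists n => // N /= nN.
have part m : series (exp_coeff (2 * c)) m <= expR (2 * c).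
  apply: nondecreasing_cvgn_le; last exact: is_cvg_series_exp_coeff.
  apply/nondecreasing_seqP => k; rewrite /series/= big_nat_recr//= lerDl.
  by apply: exp_coeff_ge0; rewrite mulr_ge0.
apply: le_trans (_ : 2^-1 ^+ n * (series (exp_coeff (2 * c)) N) + series (exp_coeff c) n <= _); last first.
  by rewrite lerD2r ler_wpM2l.
rewrite /series/= (big_cat_nat (leq0n n) nN)/= addrC lerD2r.
rewrite (big_cat_nat (leq0n n) nN)/= mulrDr ler_wpDl//.
  rewrite mulr_ge0// sumr_ge0// => k _; apply: exp_coeff_ge0; by rewrite mulr_ge0.
rewrite mulr_sumr !big_nat; apply: ler_sum => k /andP[nk _].
rewrite !exp_coeffE exprMn mulrCA ler_wpM2l ?invr_ge0//.
rewrite mulrA ler_peMl ?exprn_ge0// -(subnK nk) addnC exprD mulrA -exprMn mulVf ?expr1n ?mul1r//.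
by rewrite exprn_ege1// ler1n.
Qed.

(** Coefficients of the n-th forward difference of a sequence at 0. *)
Definition newton n i : R := (-1) ^+ (n + i) * 'C(n, i)%:R.

Lemma newton_differences a b : (forall j, b 0%N j = a j) ->
  (forall n j, b n.+1 j = b n j.+1 - b n j) ->
  forall n N j, (n < N)%N -> b n j = \sum_(0 <= i < N) newton n i * a (i + j)%N.
Proof.
move=> b0 bS; elim=> [|n IH] N j.
  case: N => // N _; rewrite big_nat_recl//= big1 ?addr0.
    by rewrite /newton mul1r mul1r add0n b0.
  by move=> i _; rewrite /newton bin0n mulr0 mul0r.
case: N => // N; rewrite ltnS => nN.
rewrite bS (IH N j.+1 nN) (IH N.+1 j (ltnW nN)) [in RHS]big_nat_recl// [in LHS]big_nat_recl//.
rewrite opprD addrCA; congr (_ + _).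
  by rewrite /newton !bin0 !addn0 exprS; ring.
rewrite -sumrB; apply: eq_bigr => i _; rewrite addnS addSn.
rewrite /newton binS natrD !addnS addSn !exprS; ring.
Qed.

Lemma newton_fact n i : (i <= n)%N ->
  (n`!%:R)^-1 * newton n i = (i`!%:R)^-1 * exp_coeff (-1) (n - i)%N.
Proof.
move=> ni; rewrite /newton exp_coeffE -(bin_fact ni) !natrM.
rewrite -[in (-1) ^+ (n + i)](subnK ni) -addnA addnn exprD -mul2n exprM sqrrN !expr1n mulr1.
have i0 : i`!%:R != 0 :> R by rewrite pnatr_eq0 -lt0n fact_gt0.
have j0 : (n - i)`!%:R != 0 :> R by rewrite pnatr_eq0 -lt0n fact_gt0.
have b0 : 'C(n, i)%:R != 0 :> R by rewrite pnatr_eq0 -lt0n bin_gt0.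
by field; rewrite i0 j0 b0.
Qed.

(** The factorial absorbs the binomial coefficient, 'C(n, i) / n! = 1 / (i! (n
    - i)!), so that summing over n gives a partial sum of the series of exp
    (-1). *)
Lemma newton_column i N : (i <= N)%N ->
  \sum_(0 <= n < N) (n`!%:R)^-1 * newton n i =
  (i`!%:R)^-1 * series (exp_coeff (-1)) (N - i)%N.
Proof.
move=> iN; rewrite (big_cat_nat (leq0n i) iN)/= big_nat big1 ?add0r.
  rewrite -{1}[i]add0n big_addn /series/= mulr_sumr !big_nat; apply: eq_bigr => k _.
  by rewrite newton_fact ?leq_addl// addnK.
by move=> n /andP[_ ni]; rewrite /newton bin_small// mulr0 mulr0.
Qed.

(** With S the shift of sequences, this is exp (S - 1) = exp (-1) exp S
    evaluated at 0, with partial sums in place of the series and the rate of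
    convergence made explicit. *)
Lemma exp_differences K (c : R) a b N : 0 <= K -> 0 <= c -> geo_bounded K c a ->
  (forall j, b 0%N j = a j) -> (forall n j, b n.+1 j = b n j.+1 - b n j) ->
  `|\sum_(0 <= n < N) (n`!%:R)^-1 * b n 0%N
    - \sum_(0 <= i < N) expR (- 1) * (i`!%:R)^-1 * a i|
  <= K * (expR 2 * expR (2 * c)) * 2^-1 ^+ N.
Proof.
move=> K0 c0 ac b0 bS.
have -> : \sum_(0 <= n < N) (n`!%:R)^-1 * b n 0%N =
    \sum_(0 <= i < N) a i * ((i`!%:R)^-1 * series (exp_coeff (-1)) (N - i)%N).
  (* The double sum is first written out by rows, then summed by columns. *)
  transitivity (\sum_(0 <= n < N) \sum_(0 <= i < N) a i * ((n`!%:R)^-1 * newton n i)).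
    rewrite !big_nat; apply: eq_bigr => n /andP[_ nN].
    rewrite (newton_differences b0 bS 0 nN) mulr_sumr; apply: eq_bigr => i _.
    by rewrite addn0; ring.
  rewrite exchange_big_nat/= !big_nat; apply: eq_bigr => i /andP[_ iN].
  by rewrite -mulr_sumr newton_column// ltnW.
rewrite -sumrB.
have tail m : `|series (exp_coeff (-1)) m - expR (-1 : R)| <= 2^-1 ^+ m * expR 2.
  have hq : factorial_weights (fun k => (k`!%:R)^-1 : R) by move=> k; rewrite ger0_norm ?invr_ge0.
  have g : geo_bounded 1 1 (fun k => (-1) ^+ k : R).
    by move=> k; rewrite normrX normrN1 !expr1n mul1r.
  have := wsum_tail hq m ler01 g.
  have -> : series (fun k => (k`!%:R)^-1 * (-1) ^+ k) = series (exp_coeff (-1 : R)).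
    by rewrite exp_coeffE.
  have -> : wsum (fun k => (k`!%:R)^-1) (fun k => (-1) ^+ k) = expR (-1 : R).
    by rewrite /wsum /expR exp_coeffE.
  rewrite distrC mul1r => /le_trans; apply.
  by have := exp_tail_geo m (ler01 : 0 <= 1 :> R); rewrite mulr1.
apply: le_trans (ler_norm_sum _ _ _) _.
apply: le_trans (_ : \sum_(0 <= i < N) K * expR 2 * 2^-1 ^+ N * exp_coeff (2 * c) i <= _).
  rewrite !big_nat; apply: ler_sum => i /andP[_ iN].
  rewrite (_ : _ - _ = (i`!%:R)^-1 * a i * (series (exp_coeff (-1)) (N - i)%N - expR (-1))); last by ring.
  rewrite !normrM (ger0_norm (_ : 0 <= (i`!%:R)^-1)) ?invr_ge0//.
  apply: le_trans (ler_pM _ _ (ler_wpM2l _ (ac i)) (tail _)) _; rewrite ?mulr_ge0 ?invr_ge0//.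
  rewrite exp_coeffE exprMn -(subnK (ltnW iN)) exprD addnK le_eqVlt; apply/orP; left; apply/eqP.
  have : 2^-1 ^+ i * 2 ^+ i = 1 :> R by rewrite -exprMn mulVf ?expr1n.
  move: (2^-1 ^+ i) (2 ^+ i) => p q pq.
  rewrite [RHS](_ : _ = K * expR 2 * 2^-1 ^+ (N - i) * ((i`!%:R)^-1 * c ^+ i) * (p * q)); last by ring.
  by rewrite pq; ring.
rewrite -mulr_sumr [leRHS](_ : _ = K * expR 2 * 2^-1 ^+ N * expR (2 * c)); last by ring.
rewrite ler_wpM2l ?mulr_ge0 ?expR_ge0 ?exprn_ge0//.
apply: (@nondecreasing_cvgn_le _ (series (exp_coeff (2 * c)))); last exact: is_cvg_series_exp_coeff.
apply/nondecreasing_seqP => k; rewrite /series/= big_nat_recr//= lerDl.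
by apply: exp_coeff_ge0; rewrite mulr_ge0.
Qed.

End ExpDifferences.

(** * The operator exponential *)

Section ExpOp.
Context (R : realType) (d : nat) (kappa : 'rV[R]_d -> R).
Local Notation E := 'rV[R]_d.
Local Notation F := (E -> R).
Implicit Types (x y z : E) (f g : F) (Q B : F -> F).
Hypothesis hk : bounded_continuous_weight kappa.
Local Notation Ck := (Ckappa kappa).
Local Notation wb := (wbd kappa).

Lemma wnorm_ge0 f : (0 <= wnorm kappa f)%E.
Proof.
apply: le_trans (_ : ((`|f 0| * kappa 0)%:E <= _)%E).
  by rewrite lee_fin mulr_ge0// weight_ge0.
by apply: ereal_sup_ubound; exists 0.
Qed.

Lemma wnorm_cvg0P (I : Type) (D : set_system I) (u : I -> F) : Filter D ->
  wnorm kappa (u i) @[i --> D] --> 0%E <->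
  forall e, 0 < e -> \forall i \near D, wb e (u i).
Proof.
move=> FD; split=> [/fine_cvgP[fin cv] e e0|H].
  have /cvgrPdist_le/(_ _ e0) := cv; apply: filterS2 fin => i fi /=.
  rewrite sub0r normrN => Hi; apply/wnorm_leP; rewrite -(fineK fi) lee_fin.
  exact: le_trans (ler_norm _) Hi.
have fin e i : wb e (u i) -> wnorm kappa (u i) \is a fin_num.
  move=> /wnorm_leP Hi; rewrite ge0_fin_numE ?wnorm_ge0//.
  exact: le_lt_trans Hi (ltry _).
apply/fine_cvgP; split; first by apply: filterS (H 1 ltr01) => i; exact: fin.
apply/cvgrPdist_le => e e0; apply: filterS (H e e0) => i Hi /=.
rewrite sub0r normrN ger0_norm ?fine_ge0 ?wnorm_ge0//.
by rewrite -lee_fin fineK ?(fin e)//; exact/wnorm_leP.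
Qed.

(** Limits in the norm are unique, so the chosen sum of the series is the
    given one. *)
Lemma exp_opE B f g : Ck g ->
  (forall e, 0 < e -> \forall n \near \oo,
     wb e ((\sum_(k < n) (k`!%:R)^-1 *: iter k B f) - g)) ->
  exp_op kappa B f = g.
Proof.
move=> gC Hg; rewrite /exp_op; case: xgetP => [g' _ /= [g'C /wnorm_cvg0P Hg']|]; last first.
  by move=> /(_ g) []; split=> //; apply/wnorm_cvg0P.
apply/funext => x; apply/eqP; rewrite -subr_eq0 -normr_le0.
apply: (@le_of_eps R _ _ (2 / kappa x)) => e e0.
have [n [H1 H2]] := filter_ex (filterI (Hg e e0) (Hg' e e0)).
move: (wbd_at hk x H1) (wbd_at hk x H2).
rewrite add0r (_ : 2 / kappa x * e = e / kappa x + e / kappa x); last by ring.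
by rewrite !fctE3 !ler_norml; lra.
Qed.

Section Poisson.
Context (Q B : F -> F) (c s : R).
Hypotheses (HQ : slop kappa Q c) (Ql : linear_on_Ck kappa Q) (s1 : `|s| <= 1).
Hypothesis HB : forall g, Ck g -> B g = s *: Q g - g.
Let c0 : 0 <= c := slop_ge0 HQ.

(** The exponential of s Q - 1 is a mixture of the powers of Q with Poisson
    weights: the partial sums of its series are combinations of iterated
    differences of the sequence s^k Q^k f. *)
Lemma exp_op_mix f : Ck f -> exp_op kappa B f = mix (poisson_weights s) Q f.
Proof.
move=> fC; have hq := poisson_weightsP s1.
have QC := slop_Ck HQ.
have QkC k : Ck (iter k Q f) by exact: iter_Ck.
have [M fM] := Ck_wbd fC; have M0 := wbd_ge0 hk fM.
apply: exp_opE; first exact: (mix_Ck hk HQ).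
have BC g : Ck g -> Ck (B g) by move=> gC; rewrite HB//; apply: (CkB hk) => //; apply: CkZ; exact: QC.
have Bl : linear_on_Ck kappa B.
  move=> a u v uC vC; rewrite !HB//; last by apply: (CkD hk) => //; exact: CkZ.
  by rewrite Ql//; apply/funext => x; rewrite !fctE3; ring.
have key x N : `|(\sum_(k < N) (k`!%:R)^-1 *: iter k B f - mix (poisson_weights s) Q f) x|
    <= (M / kappa x) * (expR 2 * expR (2 * c) + expR (2 * c)) * 2^-1 ^+ N.
  have Mx : 0 <= M / kappa x := iter_geo_ge0 hk x fM.
  pose a j := s ^+ j * iter j Q f x.
  pose b n j := iter n B (s ^+ j *: iter j Q f) x.
  have ga : geo_bounded (M / kappa x) c a.
    move=> k; rewrite /a normrM; apply: le_trans (iter_geo hk HQ x fC fM k).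
    by rewrite ler_piMl// normrX exprn_ile1.
  (* Since B = s Q - 1, applying B is taking a difference of the sequence
     s^j Q^j f. *)
  have bS n j : b n.+1 j = b n j.+1 - b n j.
    rewrite /b iterSr HB; last exact: CkZ.
    rewrite (linear_on_CkZ Ql)// -[s *: _ - _]/(s *: (s ^+ j *: Q (iter j Q f)) - s ^+ j *: iter j Q f).
    rewrite (linear_on_CkB (iter_linear Bl BC n)).
    - by rewrite scalerA -exprS.
    - by apply: CkZ; apply: CkZ; exact: (QkC j.+1).
    - exact: CkZ.
  have := exp_differences N Mx c0 ga (b := b) (fun j => erefl) bS.
  have := wsum_tail hq N Mx (iter_geo hk HQ x fC fM).
  rewrite -/(mix _ Q f x).
  have -> : series (fun k => poisson_weights s k * iter k Q f x) N =
      \sum_(0 <= i < N) expR (- 1) * (i`!%:R)^-1 * a i.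
    by rewrite /series/=; apply: eq_bigr => k _; rewrite /poisson_weights /a; ring.
  have tl := ler_wpM2l Mx (exp_tail_geo N c0).
  have -> : \sum_(0 <= n < N) (n`!%:R)^-1 * b n 0%N = (\sum_(k < N) (k`!%:R)^-1 *: iter k B f) x.
    by rewrite fct_sumE big_mkord; apply: eq_bigr => k _; rewrite /b expr0 scale1r.
  move=> H1 H2; have {}H1 := le_trans H1 tl; rewrite !fctE3.
  rewrite [leRHS](_ : _ = M / kappa x * (expR 2 * expR (2 * c)) * 2^-1 ^+ N +
    M / kappa x * (2^-1 ^+ N * expR (2 * c))); last by move: (2^-1 ^+ N) => p; ring.
  by move: H1 H2; rewrite !ler_norml; lra.
move=> e e0.
have [N HN] := half_pow_small (M * (expR 2 * expR (2 * c) + expR (2 * c))) e0.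
exists N => // n /= Nn x; rewrite -ler_pdivlMr ?weight_gt0//.
apply: le_trans (key x n) _; rewrite mulrAC [_ / kappa x * _]mulrAC [_ / kappa x * _]mulrAC.
rewrite ler_wpM2r ?invr_ge0 ?weight_ge0// mulrAC.
apply: le_trans HN; rewrite ler_wpM2l ?mulr_ge0 ?addr_ge0 ?mulr_ge0 ?expR_ge0//.
by rewrite ler_wiXn2l ?invr_ge0// invf_le1// ler1n.
Qed.

End Poisson.
End ExpOp.

(** * Schemes built from resolvents *)

(** The constant L of the translation hypothesis enters the Lipschitz
    estimates, so it is fixed here once and for all. *)
Definition translation_bound (R : realType) (d : nat) (Theta : Type)
    (A : Theta -> partial_op R d) (omega L0 : R) : Prop :=
  forall (r : R) f x (lam : R) (th : Theta), 0 <= r -> Lipb_r r f -> omega < lam ->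
  (((lam - omega) ^+ 2)%:E *
     supnorm (translate x (resolvent (A th) lam f)
              - resolvent (A th) lam (translate x f))%R
   <= (L0 * r * enorm x)%:E)%E.

Section Resolvents.
Context (R : realType) (d : nat) (kappa : 'rV[R]_d -> R).
Local Notation E := 'rV[R]_d.
Local Notation F := (E -> R).
Implicit Types (x y z : E) (f g : F).
Hypothesis hk : bounded_continuous_weight kappa.
Local Notation Ck := (Ckappa kappa).
Local Notation wb := (wbd kappa).
Context (Theta : Type) (A : Theta -> partial_op R d) (omega : R).
Hypotheses (hT : inhabited Theta) (hA : forall th, linear_op kappa (A th))
  (hR : cond_resolvent kappa A omega)
  (hE : cond_weight kappa A omega \/ cond_cutoff kappa A)
  (hS : cond_smooth kappa A omega).
Context (L0 : R).
Hypotheses (L00 : 0 <= L0) (hL : translation_bound A omega L0).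

Section OneResolvent.
Context (lam : R) (th : Theta).
Hypothesis ol : omega < lam.
Local Notation Res := (resolvent (A th) lam).
Let h := (lam - omega)^-1.

Lemma lam_omega_gt0 : 0 < lam - omega. Proof. by rewrite subr_gt0. Qed.

Lemma step_gt0 : 0 < h. Proof. by rewrite invr_gt0 lam_omega_gt0. Qed.

Lemma resolvent_dom f : Ck f -> dom (A th) (Res f) /\ lam *: Res f - A th (Res f) = f.
Proof.
move=> fC; have [[[_ _ fs] _] _ _ _] := hR ol th.
split.
  by apply: (@surjpinv_image_sub _ _ (fun=> 0) _ _ _ fs); exists f.
apply: (@pinvK _ _ (fun=> 0) (dom (A th)) (fun f => lam *: f - A th f)).
by rewrite inE; exact: fs.
Qed.

Lemma resolventK f : dom (A th) f -> Res (lam *: f - A th f) = f.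
Proof.
move=> fD; have [[[_ fi _] _] _ _ _] := hR ol th.
by apply: (@pinvKV _ _ (fun=> 0) (dom (A th)) (fun f => lam *: f - A th f)); rewrite ?inE.
Qed.

Lemma resolvent_linear : linear_on_Ck kappa Res.
Proof.
have [[_ [[_ _ _ H] _]] _ _ _] := hR ol th.
by move=> a f g fC gC; have [] := H a f g fC gC.
Qed.

Lemma resolvent_Ck f : Ck f -> Ck (Res f).
Proof. by have [[_ [[_ H _ _] _]] _ _ _] := hR ol th; exact: H. Qed.

Lemma resolvent_wbd M f : Ck f -> wb M f -> wb (h * M) (Res f).
Proof.
move=> fC fM; have [_ _ H _] := hR ol th.
have -> : Res f = h *: ((lam - omega) *: Res f).
  by rewrite scalerA mulVf ?scale1r// gt_eqF// lam_omega_gt0.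
rewrite -[X in X * M](gtr0_norm step_gt0); apply: wbdZ.
by have /wnorm_homo := H f fC; exact.
Qed.

(** The absolute value keeps the operator monotone for negative lam as well;
    the sign of lam is carried by the weights of the mixtures. *)
Definition scaled_resolvent (lam : R) (th : Theta) f : F := `|lam| *: resolvent (A th) lam f.
Local Notation Q := (scaled_resolvent lam th).

Lemma scaled_resolvent_linear : linear_on_Ck kappa Q.
Proof.
move=> a f g fC gC; rewrite /scaled_resolvent resolvent_linear//.
by apply/funext => x; rewrite !fctE3; ring.
Qed.

Lemma scaled_resolvent_slop : slop kappa Q (`|lam| * h).
Proof.
apply: (slop_linear); first by rewrite mulr_ge0// ltW// step_gt0.
- by move=> f fC; apply: CkZ; exact: resolvent_Ck.
- exact: scaled_resolvent_linear.
- move=> f g fC gC fg x; have [_ _ _ H] := hR ol th.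
  by rewrite ler_wpM2l//; exact: H.
- move=> M f fC fM; rewrite -mulrA -[X in wb (X * _)]normr_id; apply: wbdZ.
  exact: resolvent_wbd.
Qed.

Lemma scaled_resolvent_weight (v : F) m f :
  (forall lam th f m, omega < lam -> Ck f -> wbd v m f ->
     wbd v m ((lam - omega) *: resolvent (A th) lam f)) ->
  Ck f -> wbd v m f -> wbd v (`|lam| * h * m) (Q f).
Proof.
move=> Hv fC fm; have H := Hv lam th f m ol fC fm.
have -> : Q f = (`|lam| * h) *: ((lam - omega) *: Res f).
  by rewrite scalerA mulfVK// gt_eqF// lam_omega_gt0.
rewrite -[X in wbd v (X * _)]ger0_norm ?mulr_ge0 ?(ltW step_gt0)//.
exact: wbdZ.
Qed.

Lemma resolvent_app f : dom (A th) f -> lam *: Res f = f + Res (A th f).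
Proof.
move=> fD; have [DC AC _ _] := hA th; have H := resolventK fD.
rewrite (linear_on_CkB resolvent_linear) in H; last 2 first.
- by apply: CkZ; exact: DC.
- exact: AC.
by rewrite -{2}H subrK (linear_on_CkZ resolvent_linear)//; exact: DC.
Qed.

(** On the domain lam R eta - eta = R (A eta), which is small when A eta is.
    For negative lam the sign of lam R eta only helps, since eta is
    nonnegative. *)
Lemma scaled_resolvent_barrier e eta : barrier kappa A e eta ->
  forall y, Q eta y <= eta y + h * e / kappa y.
Proof.
move=> [eC e0 /(_ th) [eD eA]] y.
have [_ AC _ _] := hA th.
have E1 := resolvent_app eD.
have H := wbd_at hk y (resolvent_wbd (AC _ eD) eA).
have E1y : lam * Res eta y = eta y + Res (A th eta) y by rewrite -[LHS]/((lam *: Res eta) y) E1.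
have ey := e0 y; rewrite /scaled_resolvent scalefE.
have [l0|l0] := leP 0 lam.
  rewrite ger0_norm// E1y lerD2l; exact: le_trans (ler_norm _) H.
by rewrite ltr0_norm// mulNr E1y; move: H; rewrite ler_norml; lra.
Qed.

Lemma scaled_resolvent_sup r f M : lipb r f -> (forall x, `|f x| <= M) ->
  forall x, `|Q f x| <= `|lam| * h * M.
Proof.
move=> fr fM x; have [_ H _ _] := hR ol th.
have /supnorm_homo/(_ M fM x) := H f (lipb_Lipb fr).
rewrite /scaled_resolvent !scalefE !normrM normr_id (gtr0_norm lam_omega_gt0) => H'.
by rewrite -mulrA ler_wpM2l// /h ler_pdivlMl// lam_omega_gt0.
Qed.

End OneResolvent.

Lemma scaled_resolvent_lipop lam th : omega < lam ->
  let h := (lam - omega)^-1 in let l := `|lam| * h * (L0 * h) in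
  lipop (scaled_resolvent lam th) (`|lam| * h) (`|lam| * h + l) l.
Proof.
move=> ol h l; have h0 : 0 < h := step_gt0 ol.
have lo := lam_omega_gt0 ol.
apply: (lipop_of hk (scaled_resolvent_slop th ol)).
- by rewrite mulr_ge0// ltW.
- by rewrite !mulr_ge0// ltW.
- by move=> r f M; exact: scaled_resolvent_sup.
move=> r f fr x y; have r0 := lipb_ge0 fr.
have H := hL x th r0 ((Lipb_rE r f).2 fr) ol.
set u := translate x _ - _ in H.
have u_fin : `|u y| <= L0 * r * enorm x / (lam - omega) ^+ 2.
  have p2 : 0 < (lam - omega) ^+ 2 by rewrite exprn_gt0.
  rewrite ler_pdivlMr// mulrC -lee_fin EFinM; apply: le_trans H.
  rewrite lee_pmul2l ?lte_fin//.
  by apply: ereal_sup_ubound; exists y.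
rewrite /scaled_resolvent !scalefE -mulrBr normrM normr_id.
apply: le_trans (ler_wpM2l (normr_ge0 lam) u_fin) _.
rewrite le_eqVlt; apply/orP; left; apply/eqP; rewrite /l /h.
by field; rewrite gt_eqF.
Qed.

(** The constant is independent of theta; this is what makes the supremum over
    theta of such mixtures continuous. *)
Lemma mix_controlled lam th q : omega < lam -> factorial_weights q -> (forall k, 0 <= q k) ->
  let h := (lam - omega)^-1 in let c := `|lam| * h in
  controlled kappa A omega (expR c + expR 1 + h * expR (2 * (1 + c)))
    (mix q (scaled_resolvent lam th)).
Proof.
move=> ol hq q0 h c; have h0 : 0 < h := step_gt0 ol.
have HQ := scaled_resolvent_slop th ol; have Ql := scaled_resolvent_linear th ol.
have c0 : 0 <= c := slop_ge0 HQ.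
have C1 : expR c <= expR c + expR 1 + h * expR (2 * (1 + c)).
  by rewrite -addrA lerDl addr_ge0 ?expR_ge0// mulr_ge0 ?expR_ge0// ltW.
split.
- exact: (slop_le hk C1 (mix_slop_ge0 hk HQ Ql hq q0)).
- move=> v v0 vR m f fC fm x.
  have m0 : 0 <= m by apply: le_trans (fm x); rewrite mulr_ge0// ltW.
  apply: le_trans (ler_wpM2r m0 C1).
  have Qv m' g : Ck g -> wbd v m' g -> wbd v (c * m') (scaled_resolvent lam th g).
    by move=> gC gm; exact: scaled_resolvent_weight.
  exact: (mix_weight_any HQ hq v0 Qv fC fm x).
move=> e eta e0 He y; have [eC eta0 _] := He.
have c1 : `|lam| / (lam - omega) <= 1 + c by rewrite lerDr.
have c2 : 1 <= 1 + c by rewrite lerDl.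
have B := mix_barrier hk HQ hq q0 eC (mulr_ge0 (ltW h0) e0) c1 c2 (eta0 y)
  (scaled_resolvent_barrier th ol He).
have m1 : wsum q (fun=> 1) <= expR 1.
  apply: le_trans (ler_norm _) _; rewrite -[leRHS]mul1r.
  by apply: (wsum_le hq ler01) => k; rewrite normr1 expr1n mulr1.
apply: le_trans B _.
have ek : 0 <= e / kappa y by rewrite divr_ge0 ?weight_ge0.
rewrite [leRHS]mulrDr -[h * e / _]mulrA; apply: lerD.
  rewrite mulrC ler_wpM2r//; apply: le_trans m1 _.
  by rewrite addrAC lerDr addr_ge0 ?expR_ge0// mulr_ge0 ?expR_ge0// ltW.
rewrite mulrAC ler_wpM2r// lerDr addr_ge0 ?expR_ge0//.
Qed.

Lemma psup_mix_wbd lam q M f : omega < lam -> factorial_weights q -> Ck f -> wb M f ->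
  wb (expR (`|lam| / (lam - omega)) * M) (psup (fun th => mix q (scaled_resolvent lam th) f)).
Proof.
move=> ol hq fC fM x; rewrite -ler_pdivlMr ?weight_gt0//.
apply: (psup_norm hT) => th.
exact: (wbd_at hk x (mix_wbd hk (scaled_resolvent_slop th ol) hq fC fM)).
Qed.

(** A supremum of continuous functions is continuous here because the mixtures
    of a Lipschitz function have a common Lipschitz constant, and
    equicontinuity approximates the general case locally uniformly, uniformly
    in theta. *)
Lemma psup_mix_Ck lam q f : omega < lam -> factorial_weights q -> Ck f ->
  Ck (psup (fun th => mix q (scaled_resolvent lam th) f)).
Proof.
move=> ol hq fC; have [M fM] := Ck_wbd fC.
apply/CkP; split; last by exists (expR (`|lam| / (lam - omega)) * M); exact: psup_mix_wbd.
pose h := (lam - omega)^-1; pose c := `|lam| * h.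
have h0 : 0 < h := step_gt0 ol.
have HQ th := scaled_resolvent_slop th ol.
have Ql th := scaled_resolvent_linear th ol.
have bnd g M' x : Ck g -> wb M' g -> forall th,
    `|mix q (scaled_resolvent lam th) g x| <= expR c * M' / kappa x.
  by move=> gC gM th; exact: (wbd_at hk x (mix_wbd hk (HQ th) hq gC gM)).
(* The weights may be signed, so differences are dominated through their
   absolute values. *)
pose D := [set Phi | exists th, Phi = mix (fun k => `|q k|) (scaled_resolvent lam th)].
have tD : tight kappa D.
  apply: (tight_controlled hk hE) => Phi [th ->].
  by apply: mix_controlled => //; exact: factorial_weights_abs.
apply: locally_uniform_continuous => rho e e0.
have [rho' [de [de0 Hti]]] := tD (M + (M + 1)) rho e e0.
have [g [[gS [r gr]] gM fg]] := test_fun_dense hk rho' fC fM de0.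
have gC := Ck_lipb hk gr; have r0 := lipb_ge0 gr.
have fgC := CkB hk fC gC.
pose l := c * (L0 * h).
have c0 : 0 <= c by rewrite mulr_ge0// ltW.
have l0 : 0 <= l by rewrite !mulr_ge0// ltW.
exists (psup (fun th => mix q (scaled_resolvent lam th) g)).
  apply: (@lipschitzE_continuous _ _ (expR (c + l + 1) * r)) => x y.
  apply: (@psup_dist _ _ _ hT _ _ _ _
    (expR c * (M + 1) / kappa x + expR c * (M + 1) / kappa y)).
  - move=> th; apply: le_trans (bnd _ _ x gC gM th) _.
    by rewrite lerDl divr_ge0 ?weight_ge0// mulr_ge0 ?expR_ge0// (wbd_ge0 hk gM).
  - move=> th; apply: le_trans (bnd _ _ y gC gM th) _.
    by rewrite lerDr divr_ge0 ?weight_ge0// mulr_ge0 ?expR_ge0// (wbd_ge0 hk gM).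
  move=> th; have LQ := scaled_resolvent_lipop th ol.
  apply: (mix_lip hk (HQ th) hq x y _ _ _ l0 gr).
  - apply: lipop_le LQ => //; by rewrite lerDl.
  - by rewrite -addrA lerDl addr_ge0.
  - by rewrite lerDr addr_ge0.
move=> x xr; apply: (@psup_dist _ _ _ hT _ _ _ _
    (expR c * M / kappa x + expR c * (M + 1) / kappa x)).
- move=> th; apply: le_trans (bnd _ _ x fC fM th) _.
  by rewrite lerDl divr_ge0 ?weight_ge0// mulr_ge0 ?expR_ge0// (wbd_ge0 hk gM).
- move=> th; apply: le_trans (bnd _ _ x gC gM th) _.
  by rewrite lerDr divr_ge0 ?weight_ge0// mulr_ge0 ?expR_ge0// (wbd_ge0 hk fM).
move=> th.
have -> : mix q (scaled_resolvent lam th) f x - mix q (scaled_resolvent lam th) g x =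
    mix q (scaled_resolvent lam th) (f - g) x.
  by rewrite (linear_on_CkB (mix_linear hk (HQ th) (Ql th) hq)).
apply: le_trans (mix_dominated hk (HQ th) hq x fgC (Ck_abs fgC) _) _; first by [].
apply: (Hti _ (absf (f - g))) => //; first by exists th.
- exact: Ck_abs.
- by move=> y; exact: normr_ge0.
- by apply/wbd_abs; exact: wbdB.
Qed.

Definition sup_mix (q : nat -> R) (lam : R) f : F :=
  psup (fun th => mix q (scaled_resolvent lam th) f).

(** A step multiplies norms by at most exp (growth h): lam / (lam - omega) = 1
    + omega h for positive lam. *)
Definition growth := `|omega|.
(** A step of size h fails to commute with translations by at most lip_defect
    h: the first two factors bound the defect of the scaled resolvent, and the
    exponential sums the defects of its powers. *)
Definition lip_defect :=
  (1 + `|omega|) * L0 * expR (2 * ((1 + `|omega|) * (1 + L0))).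

Lemma lip_defect_ge0 : 0 <= lip_defect.
Proof. by rewrite !mulr_ge0 ?expR_ge0 ?addr_ge0. Qed.

Section OneStep.
Context (q : nat -> R) (lam : R).
Hypotheses (Hq : unit_mean q) (ol : omega < lam) (lam0 : 0 < lam)
  (h1 : (lam - omega)^-1 <= 1).
Let h := (lam - omega)^-1.
Let c := `|lam| * h.
Let C1 := 1 + `|omega|.
Let h0 : 0 < h := step_gt0 ol.
Let hq := um_weights Hq.

Lemma ratio_eq : c = 1 + omega * h.
Proof.
rewrite /c gtr0_norm//; apply: (mulIf (lt0r_neq0 (lam_omega_gt0 ol))).
by rewrite /h mulfVK ?lt0r_neq0 ?lam_omega_gt0// mulrDl mulfVK ?lt0r_neq0 ?lam_omega_gt0//; ring.
Qed.

Lemma ratio_le : c - 1 <= growth * h.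
Proof. by rewrite ratio_eq addrAC subrr add0r ler_wpM2r ?(ltW h0)// ler_norm. Qed.

Lemma ratio_le1 : c <= C1.
Proof.
rewrite -lerBlDl; apply: le_trans ratio_le _.
by rewrite /growth ler_piMr.
Qed.

Let HQ th : slop kappa (scaled_resolvent lam th) c := scaled_resolvent_slop th ol.
Let Ql th : linear_on_Ck kappa (scaled_resolvent lam th) := scaled_resolvent_linear th ol.
Let P th := mix q (scaled_resolvent lam th).

Lemma step_slop th : slop kappa (P th) (expR (growth * h)).
Proof.
apply: (slop_le hk) (mix_slop hk (HQ th) (Ql th) Hq).
by rewrite ler_expR ratio_le.
Qed.

Lemma step_lipop th : lipop (P th) (expR (growth * h))
  (expR (growth * h) + lip_defect * h) (lip_defect * h).
Proof.
have c0 : 0 <= c := slop_ge0 (HQ th).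
have C10 : 0 <= C1 by rewrite addr_ge0.
pose b := C1 * (1 + L0).
have cl : c * (L0 * h) <= C1 * L0 * h.
  by rewrite mulrA ler_wpM2r ?(ltW h0)// ler_wpM2r// ratio_le1.
have cb : c <= b.
  by apply: le_trans ratio_le1 _; rewrite /b ler_peMr// lerDl.
have b1 : 1 <= b by rewrite /b; apply: mulr_ege1; rewrite ?lerDl.
have l0 : 0 <= C1 * L0 * h by rewrite !mulr_ge0// ltW.
have LQ : lipop (scaled_resolvent lam th) c b (C1 * L0 * h).
  apply: lipop_le (scaled_resolvent_lipop th ol) => //.
  rewrite /b mulrDr mulr1 lerD ?ratio_le1//.
  by apply: le_trans cl _; rewrite ler_piMr// mulr_ge0.
have := mix_lipop hk (HQ th) (Ql th) Hq LQ cb b1 l0.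
rewrite [C1 * L0 * h * _]mulrAC -/lip_defect; apply: lipop_le => //.
  by rewrite ler_expR ratio_le.
by rewrite lerD2r ler_expR ratio_le.
Qed.

Lemma sup_mix_at f M x th : Ck f -> wb M f -> P th f x <= expR (growth * h) * M / kappa x.
Proof.
by move=> fC fM; apply: le_trans (ler_norm _) (wbd_at hk x (slop_wbd (step_slop th) fC fM)).
Qed.

Lemma le_sup_mix f x th : Ck f -> P th f x <= sup_mix q lam f x.
Proof.
move=> fC; have [M fM] := Ck_wbd fC.
by apply: (@le_psup _ _ _ (fun th => P th f)) => th'; exact: sup_mix_at.
Qed.

Lemma sup_mix_slop : slop kappa (sup_mix q lam) (expR (growth * h)).
Proof.
have hom a f x : 0 < a -> Ck f -> sup_mix q lam (a *: f) x <= a * sup_mix q lam f x.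
  move=> a0 fC; apply: (psup_le hT) => th.
  rewrite (linear_on_CkZ (mix_linear hk (HQ th) (Ql th) hq))// scalefE ler_wpM2l ?(ltW a0)//.
  exact: le_sup_mix.
split; first exact: expR_ge0.
- move=> f fC; exact: (psup_mix_Ck ol hq fC).
- move=> f g fC gC x; apply: (psup_le hT) => th.
  apply: le_trans (slop_add (step_slop th) fC gC x) _.
  by rewrite lerD ?le_sup_mix.
- move=> a f a0 fC; apply/funext => x; rewrite scalefE.
  have [a_eq0|a_neq0] := eqVneq a 0.
    rewrite a_eq0 mul0r; have [th] := hT.
    have Z t : P t (0 *: f) x = 0.
      by rewrite (slop_hom (step_slop t))// scale0r.
    apply/le_anti; rewrite (psup_le hT) => [|t]; last by rewrite -/(P t _ _) Z.
    by have := le_sup_mix x th (CkZ 0 fC); rewrite Z.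
  have {}a0 : 0 < a by rewrite lt_def a_neq0.
  apply/le_anti; rewrite hom//= -ler_pdivlMl//.
  apply: le_trans (hom a^-1 (a *: f) x _ _); rewrite ?invr_gt0//; last exact: CkZ.
  by rewrite scalerA mulVf// scale1r.
- move=> f g fC gC fg x; apply: (psup_le hT) => th.
  apply: le_trans (slop_mono (step_slop th) fC gC fg x) _; exact: le_sup_mix.
- move=> M f fC fM x; rewrite -ler_pdivlMr ?weight_gt0//.
  apply: (psup_norm hT) => th.
  exact: (wbd_at hk x (slop_wbd (step_slop th) fC fM)).
Qed.

Lemma sup_mix_lipop : lipop (sup_mix q lam) (expR (growth * h))
  (expR ((growth + lip_defect) * h)) (lip_defect * h).
Proof.
have Lh : 0 <= lip_defect * h by rewrite mulr_ge0 ?lip_defect_ge0// ltW.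
apply: (@lipop_le _ _ _ (expR (growth * h)) (expR (growth * h) + lip_defect * h)
  (lip_defect * h)) => //.
  rewrite mulrDl expRD; apply: le_trans (_ : expR (growth * h) * (1 + lip_defect * h) <= _).
    rewrite mulrDr mulr1 lerD2l ler_peMl// -expR0 ler_expR mulr_ge0 ?(ltW h0)//.
    exact: normr_ge0.
  by rewrite ler_wpM2l ?expR_ge0// expR_ge1Dx.
apply: (lipop_of hk sup_mix_slop); rewrite ?expR_ge0//.
  move=> r f M fr fM x; apply: (psup_norm hT) => th.
  exact: (lipop_sup (step_lipop th) fr fM).
move=> r f fr x y.
have tr := lipb_translate x fr; have fC := Ck_lipb hk fr; have tC := Ck_lipb hk tr.
have [M fM] := Ck_wbd fC; have [M' tM] := Ck_wbd tC.
have e0 := expR_ge0 (growth * h).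
apply: (@psup_dist _ _ _ hT _ _ _ _
  (expR (growth * h) * M / kappa (x + y) + expR (growth * h) * M' / kappa y)).
- move=> th; apply: le_trans (wbd_at hk _ (slop_wbd (step_slop th) fC fM)) _.
  by rewrite lerDl divr_ge0 ?weight_ge0// mulr_ge0// (wbd_ge0 hk tM).
- move=> th; apply: le_trans (wbd_at hk _ (slop_wbd (step_slop th) tC tM)) _.
  by rewrite lerDr divr_ge0 ?weight_ge0// mulr_ge0// (wbd_ge0 hk fM).
by move=> th; exact: (lipop_trans (step_lipop th) fr).
Qed.

Lemma sup_mix_weight (v : F) m f : (forall x, 0 < v x) ->
  (forall lam th f m, omega < lam -> Ck f -> wbd v m f ->
     wbd v m ((lam - omega) *: resolvent (A th) lam f)) ->
  Ck f -> wbd v m f -> wbd v (expR (growth * h) * m) (sup_mix q lam f).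
Proof.
move=> v0 vR fC fm x; rewrite -ler_pdivlMr//; apply: (psup_norm hT) => th.
rewrite ler_pdivlMr//.
have m0 : 0 <= m by apply: le_trans (fm x); rewrite mulr_ge0// ltW.
have Qv m' g : Ck g -> wbd v m' g -> wbd v (c * m') (scaled_resolvent lam th g).
  by move=> gC gm; exact: (scaled_resolvent_weight th ol vR gC gm).
apply: le_trans (mix_weight (HQ th) Hq v0 Qv fC fm x) _.
by rewrite ler_wpM2r// ler_expR ratio_le.
Qed.

Lemma sup_mix_barrier e eta : 0 <= e -> barrier kappa A e eta ->
  forall y, sup_mix q lam eta y <= eta y + h * e * expR (2 * C1) / kappa y.
Proof.
move=> e0 He y; have [eC eta0 _] := He; apply: (psup_le hT) => th.
have C11 : 1 <= C1 by rewrite lerDl.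
have := mix_barrier hk (HQ th) hq (um_ge0 Hq) eC (mulr_ge0 (ltW h0) e0) ratio_le1 C11
  (eta0 y) (scaled_resolvent_barrier th ol He).
by rewrite (um_mass Hq) mulr1 [h * e * _ / _]mulrAC.
Qed.

(** By the resolvent equation (Q f - f) / h equals (lam - omega) R (A f),
    which is within eps of A f by hypothesis; to move this vector by Q costs a
    multiple of eps plus omega h times its norm. *)
Lemma step_consistency f M eps th : Ck f -> dom (A th) f -> wb M (A th f) ->
  wb eps ((lam - omega) *: resolvent (A th) lam (A th f) - A th f) ->
  wb (expR (4 * C1) * (C1 * eps + growth * h * (eps + M)) + eps)
    (h^-1 *: (P th f - f) - A th f).
Proof.
move=> fC fD fM feps; have [_ AC _ _] := hA th; have AfC := AC _ fD.
have C11 : 1 <= C1 by rewrite lerDl.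
have eps0 := wbd_ge0 hk feps.
pose g := h^-1 *: (scaled_resolvent lam th f - f).
(* The difference quotient of the scaled resolvent is the Yosida approximation
   of A f. *)
have gE : g = (lam - omega) *: resolvent (A th) lam (A th f).
  rewrite /g /h invrK; congr (_ *: _).
  rewrite /scaled_resolvent gtr0_norm// (resolvent_app ol fD).
  by rewrite addrAC subrr add0r.
have gC : Ck g by rewrite gE; apply: CkZ; exact: (resolvent_Ck th ol).
have gA : wb eps (g - A th f) by rewrite gE.
have gM : wb (eps + M) g by rewrite -[g](subrK (A th f)); exact: (wbdD hk).
have QA : scaled_resolvent lam th (A th f) = c *: g.
  rewrite gE scalerA /c /h mulfVK// lt0r_neq0// lam_omega_gt0//.
have del : wb (C1 * eps + growth * h * (eps + M)) (scaled_resolvent lam th g - g).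
  rewrite -(subrKA (scaled_resolvent lam th (A th f))); apply: (wbdD hk).
    apply: wbd_le (slop_wbd_dist hk (HQ th) gC AfC gA).
    by rewrite ler_wpM2r// ratio_le1.
  rewrite QA ratio_eq (_ : _ - g = (omega * h) *: g); last first.
    by apply/funext => x; rewrite !fctE3; ring.
  have -> : growth * h = `|omega * h| by rewrite normrM (gtr0_norm h0).
  exact: wbdZ.
have H := mix_consistency hk (HQ th) (Ql th) Hq h0 ratio_le1 C11 fC del.
rewrite -(subrKA g); exact: (wbdD hk).
Qed.

Lemma sup_mix_consistency f M eps : Ck f -> (forall th, dom (A th) f) ->
  (forall th, wb M (A th f)) ->
  (forall th, wb eps ((lam - omega) *: resolvent (A th) lam (A th f) - A th f)) ->
  wb (expR (4 * C1) * (C1 * eps + growth * h * (eps + M)) + eps)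
    (h^-1 *: (sup_mix q lam f - f) - psup (fun th => A th f)).
Proof.
move=> fC fD fM feps x; rewrite -ler_pdivlMr ?weight_gt0//.
have [M' fM'] := Ck_wbd fC.
apply: (psup_affine_dist hT h0 (b := expR (growth * h) * M' / kappa x) (b' := M / kappa x)).
- by move=> th; exact: sup_mix_at.
- by move=> th; apply: le_trans (ler_norm _) (wbd_at hk x (fM th)).
move=> th; exact: (wbd_at hk x (step_consistency fC (fD th) (fM th) (feps th))).
Qed.

End OneStep.

Local Notation w := growth.
Local Notation L := lip_defect.
Local Notation G := (fun f => psup (fun th => A th f)).

Section Sequence.
Context (q : nat -> R) (lam : nat -> R).
Hypotheses (Hq : unit_mean q) (ol : forall n, omega < lam n) (lam0 : forall n, 0 < lam n)
  (h1 : forall n, (lam n - omega)^-1 <= 1) (lamoo : lam n @[n --> \oo] --> +oo).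
Let h n := (lam n - omega)^-1.
Let J n := sup_mix q (lam n).
Let h0 n : 0 < h n := step_gt0 (ol n).

Lemma step_size_cvg : h n @[n --> \oo] --> (0 : R).
Proof.
apply/cvgrPdist_le => e e0; have /cvgryPge/(_ (omega + e^-1)) := lamoo.
apply: filterS => n Hn; rewrite sub0r normrN gtr0_norm ?h0//.
rewrite /h -[leRHS]invrK lef_pV2 ?posrE ?lam_omega_gt0 ?invr_gt0//.
by rewrite lerBrDl.
Qed.

Lemma family_controlled n k T0 : k%:R * h n <= T0 ->
  controlled kappa A omega
    (expR (w * T0) * (1 + `|T0| * expR (2 * (1 + `|omega|)))) (iter k (J n)).
Proof.
move=> kT; have kh0 : 0 <= k%:R * h n by rewrite mulr_ge0// ltW.
have Sl := sup_mix_slop Hq (ol n) (lam0 n).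
have Slk := slop_iter hk k Sl; rewrite -expRM_natl mulrCA in Slk.
set K := expR (2 * _); have K0 : 0 <= K := expR_ge0 _.
have w0 : 0 <= w by exact: normr_ge0.
have e1 : expR (w * (k%:R * h n)) <= expR (w * T0) by exact: expR_wle.
have e0 : 0 <= expR (w * T0) := expR_ge0 _.
have T00 : 0 <= T0 := le_trans kh0 kT.
have C1 : expR (w * (k%:R * h n)) <= expR (w * T0) * (1 + `|T0| * K).
  by apply: le_trans e1 _; rewrite ler_peMr// lerDl mulr_ge0.
split; first exact: (slop_le hk C1 Slk).
- move=> v v0 vR m f fC fm x.
  have m0 : 0 <= m by apply: le_trans (fm x); rewrite mulr_ge0// ltW.
  apply: le_trans (ler_wpM2r m0 C1).
  rewrite -[_ * (k%:R * _)]mulrCA expRM_natl.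
  apply: (iter_weight Sl) => // m' g gC gm.
  exact: (sup_mix_weight Hq (ol n) (lam0 n)).
move=> e eta e_ge0 He y; have [eC eta0 _] := He.
pose m := h n * e * K; have m0 : 0 <= m by rewrite !mulr_ge0// ltW.
have B := sup_mix_barrier Hq (ol n) (lam0 n) (h1 n) e_ge0 He.
have c1 : 1 <= expR (w * h n) by rewrite -expR0 ler_expR mulr_ge0// ltW.
have := iter_barrier hk Sl k y eC m0 (lexx _) c1 B.
rewrite -expRM_natl [k%:R * (w * _)]mulrCA => /le_trans; apply.
have ek : 0 <= e / kappa y by rewrite divr_ge0 ?weight_ge0.
have T1 : k%:R * h n <= `|T0| by rewrite ger0_norm.
rewrite [leRHS]mulrDr; apply: lerD.
  rewrite ler_peMl// mulr_ege1//; last by rewrite lerDl mulr_ge0.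
  by rewrite -expR0 ler_expR mulr_ge0.
rewrite (_ : m / kappa y * _ = k%:R * h n * K * expR (w * (k%:R * h n)) * (e / kappa y)); last first.
  by rewrite /m; move: (expR (w * _)) => p; ring.
rewrite ler_wpM2r// mulrC; apply: ler_pM; rewrite ?expR_ge0 ?mulr_ge0 ?(ltW (h0 n))//.
by apply: le_trans (ler_wpM2r K0 T1) _; rewrite lerDr.
Qed.

(** The hypothesis on smooth functions, read along lam n, as a real null
    sequence that is uniform in theta. *)
Lemma smooth_rate f : Cb_infty f -> exists M (eps : nat -> R),
  [/\ forall th, wb M (A th f), eps n @[n --> \oo] --> (0 : R) &
    forall n th, wb (eps n) ((lam n - omega) *: resolvent (A th) (lam n) (A th f) - A th f)].
Proof.
move=> fS; have [fD /ereal_lt_pinfty_le[M HM] Hcv] := hS fS.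
have fM th : wb M (A th f).
  by apply/wnorm_leP; apply: le_trans HM; apply: ereal_sup_ubound; exists th.
pose Er l : \bar R := ereal_sup (range (fun th => wnorm kappa
  ((l - omega) *: resolvent (A th) l (A th f) - A th f))).
have Ecv : Er (lam n) @[n --> \oo] --> 0%E.
  by apply: (cvg_comp lam Er lamoo); exact: Hcv.
have Efin n : Er (lam n) \is a fin_num.
  have [th] := hT.
  have E0 : (0 <= Er (lam n))%E.
    by apply: le_trans (wnorm_ge0 hk _) _; apply: ereal_sup_ubound; exists th.
  rewrite ge0_fin_numE//; apply: le_lt_trans (ltry (M + M)).
  apply: ge_ereal_sup => _ [t _ <-]; apply/wnorm_leP; apply: (wbdB hk) => //.
  have [_ AC _ _] := hA t; have AfC := AC _ (fD t).
  have := wbdZ (lam n - omega) (resolvent_wbd t (ol n) AfC (fM t)).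
  rewrite gtr0_norm ?lam_omega_gt0// mulrA divff ?mul1r// gt_eqF// lam_omega_gt0//.
have /fine_cvgP[_ fcv] := Ecv.
exists M, (fun n => fine (Er (lam n))); split=> // n th.
apply/wnorm_leP; rewrite fineK//; apply: ereal_sup_ubound; by exists th.
Qed.

(** In particular sup_theta A^theta f belongs to C_kappa, as a limit in the
    norm of difference quotients. *)
Lemma family_consistent f : Cb_infty f -> Ck (G f) /\ exists2 e : nat -> R,
  e n @[n --> \oo] --> (0 : R) & forall n, wb (e n) ((h n)^-1 *: (J n f - f) - G f).
Proof.
move=> fS; have fC := Ck_Cb_infty hk fS; have [fD _ _] := hS fS.
have [M [eps [fM ecv Heps]]] := smooth_rate fS.
pose K := expR (4 * (1 + `|omega|)).
pose e n := K * ((1 + `|omega|) * eps n + w * h n * (eps n + M)) + eps n.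
have He n : wb (e n) ((h n)^-1 *: (J n f - f) - G f).
  exact: (sup_mix_consistency Hq (ol n) (lam0 n) (h1 n) fC fD fM (Heps n)).
have ecv' : e n @[n --> \oo] --> (0 : R).
  have -> : (0 : R) = K * ((1 + `|omega|) * 0 + w * 0 * (0 + M)) + 0 by ring.
  apply: cvgD => //; apply: cvgMr; apply: cvgD; first exact: cvgMr.
  apply: cvgM; first by apply: cvgMr; exact: step_size_cvg.
  by apply: cvgD => //; exact: cvg_cst.
split; last by exists e.
apply: (Ck_closed hk) => r r0.
have /cvgrPdist_le/(_ _ r0)/filter_ex[n] := ecv'.
rewrite sub0r normrN => en; exists ((h n)^-1 *: (J n f - f)).
  apply: CkZ; apply: (CkB hk) => //.
  exact: (psup_mix_Ck (ol n) (um_weights Hq) fC).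
rewrite -[X in wb r X]opprB; apply: wbdN; apply: wbd_le (He n).
exact: le_trans (ler_norm _) en.
Qed.

Lemma family_chernoff : chernoff kappa w (w + L) L G h J.
Proof.
split.
- exact: h0.
- exact: step_size_cvg.
- by move=> n; exact: (sup_mix_slop Hq (ol n) (lam0 n)).
- by move=> n; exact: (sup_mix_lipop Hq (ol n) (lam0 n) (h1 n)).
- move=> T0.
  apply: (tight_controlled hk hE
    (C := expR (w * T0) * (1 + `|T0| * expR (2 * (1 + `|omega|))))) => Phi [n [k [kT ->]]].
  exact: (family_controlled kT).
- exact: family_consistent.
Qed.

End Sequence.

Lemma iter_eq_on (K K' : F -> F) k f : (forall g, Ck g -> K g = K' g) ->
  (forall g, Ck g -> Ck (K' g)) -> Ck f -> iter k K f = iter k K' f.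
Proof.
move=> KK KC fC; have kC j : Ck (iter j K' f) by elim: j => //= j; exact: KC.
by elim: k => //= k ->; exact: KK.
Qed.

(** The estimates on a step need lam n positive and h n at most 1, which holds
    from some index N on; the sequence is shifted by N. The earlier operators
    map C_kappa to itself, and this suffices for the convergence of the whole
    sequence. *)
Lemma family_cvg (q : R -> nat -> R) (K : nat -> F -> F) (lam : nat -> R) T f (t : R) (k : nat -> nat) :
  moderate kappa -> (forall s : R, `|s| <= 1 -> factorial_weights (q s)) -> unit_mean (q 1) ->
  (forall n, omega < lam n) -> lam n @[n --> \oo] --> +oo ->
  (forall n g, Ck g -> K n g = sup_mix (q (Num.sg (lam n))) (lam n) g) ->
  limit_sg kappa w (w + L) L G T ->
  Ck f -> 0 <= t -> (k n)%:R * (lam n - omega)^-1 @[n --> \oo] --> t ->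
  mixed_cvg kappa (fun n => iter (k n) (K n) f) (T t f).
Proof.
move=> hmod hq q1 ol lamoo KE HT fC t0 kt; have [M fM] := Ck_wbd fC.
have sg1 n : `|Num.sg (lam n)| <= 1 by rewrite normr_sg lern1; case: eqP.
have KC n g : Ck g -> Ck (sup_mix (q (Num.sg (lam n))) (lam n) g).
  by move=> gC; exact: (psup_mix_Ck (ol n) (hq _ (sg1 n)) gC).
have KkE n j : iter j (K n) f = iter j (sup_mix (q (Num.sg (lam n))) (lam n)) f.
  by apply: iter_eq_on fC => g; [exact: KE|exact: KC].
have [N _ HN] : \forall n \near \oo, Num.max 1 (omega + 1) <= lam n.
  by have /cvgryPge := lamoo; exact.
pose la n := lam (n + N)%N.
have la_ge n : Num.max 1 (omega + 1) <= la n by apply: HN => /=; rewrite leq_addl.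
have la0 n : 0 < la n by apply: lt_le_trans (la_ge n); rewrite lt_max ltr01.
have lao n : omega < la n by exact: ol.
have la1 n : (la n - omega)^-1 <= 1.
  rewrite invf_le1 ?subr_gt0// lerBrDl; apply: le_trans (la_ge n).
  by rewrite le_max lexx orbT.
have laoo : la n @[n --> \oo] --> +oo by rewrite (cvg_shiftn N lam).
have CJ := family_chernoff q1 lao la0 la1 laoo.
have w0 : 0 <= w by exact: normr_ge0.
have L0' : 0 <= L by exact: lip_defect_ge0.
have ww : w <= w + L by rewrite lerDl.
have kE n : iter (k (n + N)%N) (K (n + N)%N) f =
    iter (k (n + N)%N) (sup_mix (q 1) (la n)) f.
  by rewrite KkE gtr0_sg//; exact: la0.
have kt' : (k (n + N)%N)%:R * (la n - omega)^-1 @[n --> \oo] --> t.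
  by rewrite (cvg_shiftn N (fun n => (k n)%:R * (lam n - omega)^-1)).
have shift (P : nat -> Prop) : (\forall n \near \oo, P (n + N)%N) -> \forall n \near \oo, P n.
  move=> [n0 _ H]; exists (n0 + N)%N => // n /= nN.
  have NN : (N <= n)%N by apply: leq_trans nN; rewrite leq_addl.
  by rewrite -(subnK NN); apply: H => /=; rewrite leq_subRL// addnC.
apply: (mixed_cvgI (B := expR (w * (t + 1)) * M)).
- by move=> n; rewrite KkE; apply: iter_Ck => // g; exact: KC.
- exact: (slop_Ck (ls_slop HT t0)).
- apply: shift; have /cvgrPdist_le/(_ _ ltr01) := kt'; apply: filterS => n Hn.
  rewrite kE; apply: (slop_wbd (iter_slop_le hk w0 CJ _) fC fM).
  by move: Hn; rewrite ler_norml; lra.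
move=> rho e e0; apply: shift.
have := chernoff_cvg hk w0 ww L0' CJ rho hmod HT t0 fC kt' e0.
by apply: filterS => n Hn x xr; rewrite kE; exact: Hn.
Qed.

Lemma Iop_mix lam f : Iop A lam f = sup_mix (dirac_weights (Num.sg lam)) lam f.
Proof.
rewrite /Iop /sup_mix; congr psup; apply/funext => th; apply/funext => x.
by rewrite /mix dirac_wsum /= /scaled_resolvent !scalefE mulrA -numEsg.
Qed.

(** Here h (lam - omega) A (lam - A)^-1 = lam (lam - A)^-1 - 1. *)
Lemma Jop_mix lam f : omega < lam -> Ck f ->
  Jop kappa A omega lam f = sup_mix (poisson_weights (Num.sg lam)) lam f.
Proof.
move=> ol fC; rewrite /Jop /sup_mix; congr psup; apply/funext => th.
have s1 : `|Num.sg lam| <= 1 by rewrite normr_sg lern1; case: eqP.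
apply: (exp_op_mix hk (scaled_resolvent_slop th ol) (scaled_resolvent_linear th ol) s1) => // g gC.
have [_ H] := resolvent_dom th ol gC.
rewrite /yosida scalerA mulVf ?scale1r; last by rewrite gt_eqF// lam_omega_gt0.
by rewrite /scaled_resolvent scalerA -numEsg -{3}H subKr.
Qed.

Lemma bounded_linear_yosida th lam : omega < lam ->
  bounded_linear kappa (yosida (A th) omega lam).
Proof.
move=> ol; have lo := lam_omega_gt0 ol.
have YE g : Ck g -> yosida (A th) omega lam g = (lam - omega) *: (lam *: resolvent (A th) lam g - g).
  by move=> gC; have [_ H] := resolvent_dom th ol gC; rewrite /yosida -{3}H subKr.
have RC g : Ck g -> Ck (resolvent (A th) lam g) by exact: (resolvent_Ck th ol).
split.
  split=> //=.
  - by move=> f fC; rewrite YE//; apply: CkZ; apply: (CkB hk) => //; apply: CkZ; exact: RC.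
  - exact: Ck0.
  move=> a f g fC gC; have fgC : Ck (a *: f + g) by apply: (CkD hk) => //; exact: CkZ.
  split=> //; rewrite !YE// (resolvent_linear th ol)//.
  by apply/funext => x; rewrite !fctE3; ring.
pose B := (lam - omega) * (`|lam| * (lam - omega)^-1 + 1).
exists B => f fC.
have fin : wnorm kappa f \is a fin_num.
  by rewrite ge0_fin_numE ?wnorm_ge0//; case: fC.
rewrite -(fineK fin) -EFinM; apply/wnorm_leP.
have fM : wb (fine (wnorm kappa f)) f by apply/wnorm_leP; rewrite fineK.
rewrite YE// /B -mulrA -[X in wb (X * _)](gtr0_norm lo); apply: wbdZ.
rewrite mulrDl mul1r; apply: (wbdB hk) => //.
by rewrite -mulrA; apply: wbdZ; exact: (resolvent_wbd).
Qed.

End Resolvents.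

Theorem theorem3p4 (R : realType) (d : nat) (kappa : 'rV[R]_d -> R)
  (Theta : Type) (A : Theta -> partial_op R d) (omega : R) (lam : nat -> R) :
  bounded_continuous_weight kappa -> moderate kappa ->
  inhabited Theta -> (forall th, linear_op kappa (A th)) ->
  cond_resolvent kappa A omega ->
  cond_weight kappa A omega \/ cond_cutoff kappa A ->
  cond_translation A omega ->
  cond_smooth kappa A omega ->
  (forall n, omega < lam n) -> lam n @[n --> \oo] --> +oo ->
  let h n := (lam n - omega)^-1 in
  let J n := Jop kappa A omega (lam n) in
  let I n := Iop A (lam n) in
  (forall n th, bounded_linear kappa (yosida (A th) omega (lam n))) /\
  exists T : R -> ('rV[R]_d -> R) -> ('rV[R]_d -> R),
  [/\ sc_convex_monotone_semigroup kappa T,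
      forall (f : 'rV[R]_d -> R) (t : R) (k : nat -> nat),
        Ckappa kappa f -> 0 <= t ->
        (k n)%:R * h n @[n --> \oo] --> t ->
        mixed_cvg kappa (fun n => iter (k n) (J n) f) (T t f),
      forall f : 'rV[R]_d -> R, @Cb_infty R d f ->
        dom (generator kappa T) f /\
        generator kappa T f = psup (fun th => A th f) &
      forall (f : 'rV[R]_d -> R) (t : R) (k : nat -> nat),
        Ckappa kappa f -> 0 <= t ->
        (k n)%:R * h n @[n --> \oo] --> t ->
        mixed_cvg kappa (fun n => iter (k n) (I n) f) (T t f)].
Proof.
move=> hk hmod hT hA hR hE [L0 [L00 hL]] hS ol lamoo h J I.
split; first by move=> n th; exact: bounded_linear_yosida.
have [U [UU Uoo]] := ultraFilterLemma (eventually_filter).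
have w0 : 0 <= growth omega by exact: normr_ge0.
have L0' : 0 <= lip_defect omega L0 by exact: lip_defect_ge0.
have ww : growth omega <= growth omega + lip_defect omega L0 by rewrite lerDl.
(* T is defined from an auxiliary sequence for which every index satisfies the
   conditions on a step; the limit does not depend on this choice, by
   uniqueness. *)
pose la (n : nat) : R := `|omega| + 1 + n.+1%:R.
have la_ge n : `|omega| + 1 <= la n by rewrite lerDl.
have lao n : omega < la n.
  by apply: lt_le_trans (la_ge n); apply: le_lt_trans (ler_norm _) _; rewrite ltrDl.
have la0 n : 0 < la n by apply: lt_le_trans (la_ge n); rewrite ltr_wpDl.
have la1 n : (la n - omega)^-1 <= 1.
  rewrite invf_le1 ?subr_gt0// lerBrDl; apply: le_trans (la_ge n).
  by rewrite lerD2r ler_norm.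
have laoo : la n @[n --> \oo] --> +oo.
  apply/cvgryPge => B; exists (Num.truncn `|B|).+1 => // n /= Bn.
  apply: le_trans (ler_norm B) _; apply: le_trans (ltW (truncnS_gt _)) _.
  apply: le_trans (_ : n.+1%:R <= _); first by rewrite ler_nat ltnW.
  by rewrite lerDr addr_ge0.
have CJ := family_chernoff hk hT hA hR hE hS L00 hL (@poisson_unit_mean R) lao la0 la1 laoo.
have HT := ulim_limit_sg hk w0 ww L0' CJ UU Uoo.
set T := ulim _ _ _ in HT; exists T.
have s1 := @poisson_weightsP R; have s2 := @dirac_weightsP R.
split.
- exact: (limit_sg_semigroup hk w0 HT).
- move=> f t k fC t0 kt.
  apply: (family_cvg hk hT hA hR hE hS L00 hL hmod s1 (@poisson_unit_mean R) ol lamoo _ HT fC t0 kt).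
  by move=> n g gC; exact: Jop_mix.
- move=> f fS.
  have [GC _] := family_consistent hk hT hA hR hE hS L00 hL (@poisson_unit_mean R) lao la0 la1 laoo fS.
  exact: (limit_sg_generatorE hk w0 HT fS GC).
- move=> f t k fC t0 kt.
  apply: (family_cvg hk hT hA hR hE hS L00 hL hmod s2 (@dirac_unit_mean R) ol lamoo _ HT fC t0 kt).
  by move=> n g gC; exact: Iop_mix.
Qed.
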